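(* Let $A,\Delta A\in\mathbb{R}^{n\times n}$, $B,\Delta B\in\mathbb{R}^{n\times p}$, $K\in\mathbb{R}^{p\times n}$, $Q,R$ positive definite and $\gamma\in(0,1)$. Set $\tilde A=A+\Delta A$, $\tilde B=B+\Delta B$, $A_K=A+BK$, $\tilde A_K=\tilde A+\tilde BK$, $\Delta A_K=\tilde A_K-A_K$, and let $P,\tilde P$ solve $P-Q-K^{\rm T}RK=\gamma A_K^{\rm T}PA_K$ and $\tilde P-Q-K^{\rm T}RK=\gamma\tilde A_K^{\rm T}\tilde P\tilde A_K$. Let $w_k$, $k\in\mathbb{N}$, be i.i.d. random vectors in $\mathbb{R}^n$ with bounded probability density function and $\mathbb{E}[w_k^{\rm T}w_k]\le\sigma^2$. For $x\in\mathbb{R}^n$ define $$G^{K}(x)=x^{\rm T}Px+2\sum_{k=0}^{\infty}\gamma^{k+1}w_k^{\rm T}PA_K^{k+1}x+\sum_{k=0}^{\infty}\gamma^{k+1}w_k^{\rm T}Pw_k+2\sum_{k=1}^{\infty}\gamma^{k+1}w_k^{\rm T}P\sum_{\tau=0}^{k-1}A_K^{k-\tau}w_\tau,$$ and $\tilde G^K(x)$ by the same formula with $P,A_K$ replaced by $\tilde P,\tilde A_K$; let $F^K_x,\tilde F^K_x$ be their cumulative distribution functions. Suppose $\max\{\|A_K\|,\|\tilde A_K\|\}=\rho_K<1$, and that $l>2\epsilon$, where $l=\|H^{-1}\|^{-1}$, $H=I\otimes I-\gamma A_K^{\rm T}\otimes A_K^{\rm T}$, and $\epsilon=\gamma\|A_K\|_F\|\Delta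 A_K\|_F+\frac{\gamma}{2}\|\Delta A_K\|_F^2$. Then $$\sup_z|F^K_x(z)-\tilde F^K_x(z)|\le\tilde c_1\|\Delta A_K\|+\tilde c_2\|\Delta A_K\|^2,$$ where the constants $\tilde c_1,\tilde c_2$ depend on the system matrices, the initial state $x$, and the parameters $\gamma,\rho_K,\sigma$.
   Context: $\|\cdot\|$ is the spectral norm, $\|\cdot\|_F$ the Frobenius norm, $\otimes$ the Kronecker product.
   Formalization: The constants may also depend on an upper bound for the probability density of the noise, which the statement's list omits; without this the claim fails for noise concentrated near a point. *)

(* Defs.v *)
From HB Require Import structures.
From mathcomp Require Import all_boot all_order all_algebra.
From mathcomp Require Import all_classical all_reals all_analysis.
From mathcomp.real_closed Require Import mxtens.
Set Implicit Arguments. Unset Strict Implicit. Unset Printing Implicit Defensive.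
Import Order.TTheory GRing.Theory Num.Theory.
Import numFieldNormedType.Exports.
Local Open Scope classical_set_scope.
Local Open Scope ring_scope.

Section defs.
Variable R : realType.

Definition vnorm2 n (v : 'cV[R]_n) : R := Num.sqrt (\sum_i v i 0 ^+ 2).

Definition specnorm m n (M : 'M[R]_(m, n)) : R :=
  sup [set vnorm2 (M *m v) | v in [set v : 'cV[R]_n | vnorm2 v = 1]].

Definition frobnorm m n (M : 'M[R]_(m, n)) : R :=
  Num.sqrt (\sum_i \sum_j M i j ^+ 2).

Definition kron m n p q (A : 'M[R]_(m, n)) (B : 'M[R]_(p, q)) := tensmx A B.

Definition posdef n (Q : 'M[R]_n) : Prop :=
  Q^T = Q /\ forall v : 'cV[R]_n, v != 0 -> 0 < (v^T *m Q *m v) 0 0.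

Definition bil n (u : 'cV[R]_n) (M : 'M[R]_n) (v : 'cV[R]_n) : R :=
  (u^T *m M *m v) 0 0.

Definition tcol n (t : n.-tuple R) : 'cV[R]_n := \col_i tnth t i.

(* ---- random vectors in R^n (valued in n.-tuple R, product Borel sigma-algebra) *)

Definition mutually_independent d (T : measurableType d) (P : probability T R)
    n (w : nat -> T -> n.-tuple R) : Prop :=
  forall (s : seq nat) (B : nat -> set (n.-tuple R)),
    uniq s -> (forall k, measurable (B k)) ->
    P (\bigcap_(k in [set` s]) (w k @^-1` B k)) =
    (\big[*%E/1%E]_(k <- s) P (w k @^-1` B k))%E.

Definition identically_distributed d (T : measurableType d) (P : probability T R)
    n (w : nat -> T -> n.-tuple R) : Prop :=
  forall k (B : set (n.-tuple R)), measurable B ->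
    P (w k @^-1` B) = P (w 0%N @^-1` B).

(* iterated Lebesgue integral over the box prod_{j<k} [a j, b j]
   (coordinates j >= k are taken from x) *)
Fixpoint box_int (a b : nat -> R) (k : nat) (g : (nat -> R) -> R)
    (x : nat -> R) : R :=
  match k with
  | 0 => g x
  | k'.+1 => Rintegral lebesgue_measure `[a k', b k']
      (fun t => box_int a b k' g (fun j => if j == k' then t else x j))
  end.

Definition box n (a b : nat -> R) : set (n.-tuple R) :=
  [set v | forall i : 'I_n, a i <= tnth v i <= b i].

Definition is_pdf d (T : measurableType d) (P : probability T R)
    n (X : T -> n.-tuple R) (f : n.-tuple R -> R) : Prop :=
  measurable_fun setT f /\ (forall v, 0 <= f v) /\
  forall a b : nat -> R, (forall j, a j <= b j) ->
    P (X @^-1` @box n a b) =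
    (box_int a b n (fun y => f [tuple y (val i) | i < n]) (fun _ => 0))%:E.

Definition Gseries d (T : measurableType d) n (gamma : R) (P AK : 'M[R]_n)
    (w : nat -> T -> n.-tuple R) (x : 'cV[R]_n) (om : T) : R :=
  let W k := tcol (w k om) in
  bil x P x
  + 2 * limn (fun N => \sum_(0 <= k < N)
             gamma ^+ k.+1 * bil (W k) P (AK ^+ k.+1 *m x))
  + limn (fun N => \sum_(0 <= k < N) gamma ^+ k.+1 * bil (W k) P (W k))
  + 2 * limn (fun N => \sum_(1 <= k < N)
             gamma ^+ k.+1 * bil (W k) P (\sum_(0 <= tau < k) AK ^+ (k - tau) *m W tau)).

Definition Gcdf d (T : measurableType d) (Pr : probability T R) n (gamma : R)
    (P AK : 'M[R]_n) (w : nat -> T -> n.-tuple R) (x : 'cV[R]_n) (z : R) : R :=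
  fine (Pr [set om | Gseries gamma P AK w x om <= z]).

End defs.

(* Main.v *)
Require Import Defs.
From HB Require Import structures.
From mathcomp Require Import all_boot all_order all_algebra.
From mathcomp Require Import all_classical all_reals all_analysis.
From mathcomp.real_closed Require Import mxtens.
From mathcomp Require Import measurable_realfun zify ring lra.
Set Implicit Arguments. Unset Strict Implicit. Unset Printing Implicit Defensive.
Import Order.TTheory GRing.Theory Num.Theory.
Import numFieldNormedType.Exports.
Local Open Scope classical_set_scope.
Local Open Scope ring_scope.

(** The two truncated returns differ by at most [D * Phi], where
    [D] is proportional to the perturbation of the closed loop and
    [Phi = \sum_k th ^ k (1 + |w_k|^2)]; hence the distribution functions differ
    by at most the probability of [|G - z| <= D * Phi].  This event has
    probability [O(D)].  In the first coordinates of two consecutive noises,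
    all else fixed, [G] is a positive definite quadratic polynomial whose
    quadratic part does not depend on the rest, so its sublevel annuli have area
    proportional to their thickness, whatever the centre.  Bounded densities
    turn this into a bound that grows polynomially with the size [r] of the
    pair; choosing the smallest among [2 n + 5] independent pairs (for noises in
    dimension [n + 1]) forces the other pairs to be at least as large, an event
    whose probability decays like a power of [r] by the second moment bound
    alone, and the sum over dyadic [r] converges.  Areas are replaced by counts
    of lattice points: the noise is rounded to a grid, all sums are finite, and
    Fatou's lemma for sets removes first the grid and then the truncation. *)

(** * Spectral bounds and the Lyapunov equation *)

(** Why two noises: along one real variable, the set where a quadratic stays within [h] of a level
    can have length of order [sqrt h], which would give only a square-root rate; a definite
    quadratic in the plane gives area of order [h]. The two variables are taken from different
    noises since the dimension may be 1, and from consecutive ones since the Lyapunov equation then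
    makes the form definite. Why size has a price: a bounded joint density gives no bounded density
    of the first coordinates alone, so the remaining coordinates are confined to a box of side of
    order [r]. They cost [r ^ (2 n)]; the lines of the grid cost one more [r], and [Phi] another
    one: [r ^ (2 n + 2)] in total. Why [2 n + 5] pairs: with second moments only, each weight
    [1 + |w_k|^2] may enter an expectation once. Markov's inequality therefore leaves out the chosen
    pair and also the pair whose weight is being averaged in [Phi]. At least [2 n + 3] pairs remain,
    each giving a factor [1 / r], and one such factor is left over for the dyadic sum. *)

Section norms.
Context {R : realType}.

Lemma vnorm2_ge0 n (v : 'cV[R]_n) : 0 <= vnorm2 v.
Proof. exact: sqrtr_ge0. Qed.

Lemma sqr_vnorm2 n (v : 'cV[R]_n) : vnorm2 v ^+ 2 = \sum_i v i 0 ^+ 2.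
Proof. by rewrite sqr_sqrtr// sumr_ge0// => i _; rewrite sqr_ge0. Qed.

Lemma vnorm2_eq0 n (v : 'cV[R]_n) : vnorm2 v = 0 -> v = 0.
Proof.
move=> v0; apply/matrixP => i j; rewrite ord1 mxE.
have : vnorm2 v ^+ 2 = 0 by rewrite v0 expr0n.
rewrite sqr_vnorm2 => /eqP; rewrite psumr_eq0; last by move=> k _; exact: sqr_ge0.
by move=> /allP/(_ i); rewrite mem_index_enum sqrf_eq0 => /(_ isT)/eqP.
Qed.

Lemma vnorm2Z n (a : R) (v : 'cV[R]_n) : vnorm2 (a *: v) = `|a| * vnorm2 v.
Proof.
apply/eqP; rewrite -(@eqrXn2 _ 2%N) ?mulr_ge0 ?vnorm2_ge0//.
rewrite exprMn !sqr_vnorm2 mulr_sumr; apply/eqP/eq_bigr => i _.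
by rewrite !mxE exprMn real_normK ?num_real.
Qed.

(** Cauchy-Schwarz. The squares of [y * a i - s * b i] add up to [y * (x * y - s ^+ 2)]; the factor
    [y] can be cancelled unless every [b i] vanishes. *)
Lemma sum_mul_sqr_le (I : finType) (a b : I -> R) :
  (\sum_i a i * b i) ^+ 2 <= (\sum_i a i ^+ 2) * (\sum_i b i ^+ 2).
Proof.
set x := \sum_i a i ^+ 2; set y := \sum_i b i ^+ 2; set s := \sum_i a i * b i.
have y0 : 0 <= y by rewrite sumr_ge0// => i _; exact: sqr_ge0.
have : 0 <= \sum_i (y * a i - s * b i) ^+ 2.
  by rewrite sumr_ge0// => i _; exact: sqr_ge0.
rewrite (eq_bigr (fun i => y ^+ 2 * a i ^+ 2 - 2 * y * s * (a i * b i)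
  + s ^+ 2 * b i ^+ 2)); last by move=> i _; ring.
rewrite big_split/= sumrB -!mulr_sumr -/x -/y -/s => H.
have {}H : 0 <= y * (x * y - s ^+ 2).
  by apply: le_trans H _; rewrite le_eqVlt; apply/orP; left; apply/eqP; ring.
move: y0; rewrite le_eqVlt => /predU1P[y0|y0]; last first.
  by move: H; rewrite pmulr_rge0// subr_ge0.
have b0 i : b i = 0.
  move/esym/eqP: y0; rewrite psumr_eq0; last by move=> k _; exact: sqr_ge0.
  by move=> /allP/(_ i); rewrite mem_index_enum sqrf_eq0 => /(_ isT)/eqP.
have -> : s = 0 by rewrite /s big1// => i _; rewrite b0 mulr0.
by rewrite expr0n/= -y0 mulr0.
Qed.

Lemma bilE n (u : 'cV[R]_n) (M : 'M[R]_n) (v : 'cV[R]_n) :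
  bil u M v = \sum_i u i 0 * (M *m v) i 0.
Proof. by rewrite /bil -mulmxA mxE; apply: eq_bigr => i _; rewrite mxE. Qed.

Lemma bilM n (u : 'cV[R]_n) (M N : 'M[R]_n) (v : 'cV[R]_n) :
  bil u (M *m N) v = bil u M (N *m v).
Proof. by rewrite /bil !mulmxA. Qed.

Lemma bilTM n (u : 'cV[R]_n) (M N : 'M[R]_n) (v : 'cV[R]_n) :
  bil u (M^T *m N) v = bil (M *m u) N v.
Proof. by rewrite /bil trmx_mul !mulmxA. Qed.

Lemma bilT n (u : 'cV[R]_n) (M : 'M[R]_n) (v : 'cV[R]_n) :
  bil u M^T v = bil v M u.
Proof.
rewrite /bil.
have -> : v^T *m M *m u = (u^T *m M^T *m v)^T by rewrite !trmx_mul !trmxK mulmxA.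
by rewrite [RHS]mxE.
Qed.

Lemma bilDm n (u : 'cV[R]_n) (M N : 'M[R]_n) (v : 'cV[R]_n) :
  bil u (M + N) v = bil u M v + bil u N v.
Proof. by rewrite /bil mulmxDr mulmxDl mxE. Qed.

Lemma bilBm n (u : 'cV[R]_n) (M N : 'M[R]_n) (v : 'cV[R]_n) :
  bil u (M - N) v = bil u M v - bil u N v.
Proof. by rewrite /bil mulmxBr mulmxBl mxE [in X in _ + X]mxE. Qed.

Lemma bilZm n (u : 'cV[R]_n) c (M : 'M[R]_n) (v : 'cV[R]_n) :
  bil u (c *: M) v = c * bil u M v.
Proof. by rewrite /bil -scalemxAr -scalemxAl mxE. Qed.

Lemma bilDl n (u u' : 'cV[R]_n) (M : 'M[R]_n) (v : 'cV[R]_n) :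
  bil (u + u') M v = bil u M v + bil u' M v.
Proof. by rewrite /bil linearD/= !mulmxDl mxE. Qed.

Lemma bilDr n (u : 'cV[R]_n) (M : 'M[R]_n) (v v' : 'cV[R]_n) :
  bil u M (v + v') = bil u M v + bil u M v'.
Proof. by rewrite /bil mulmxDr mxE. Qed.

Lemma bilBl n (u u' : 'cV[R]_n) (M : 'M[R]_n) (v : 'cV[R]_n) :
  bil (u - u') M v = bil u M v - bil u' M v.
Proof. by rewrite /bil linearB/= !mulmxBl mxE [in X in _ + X]mxE. Qed.

Lemma bilBr n (u : 'cV[R]_n) (M : 'M[R]_n) (v v' : 'cV[R]_n) :
  bil u M (v - v') = bil u M v - bil u M v'.
Proof. by rewrite /bil mulmxBr mxE [in X in _ + X]mxE. Qed.

Lemma bilZl n c (u : 'cV[R]_n) (M : 'M[R]_n) (v : 'cV[R]_n) :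
  bil (c *: u) M v = c * bil u M v.
Proof. by rewrite /bil linearZ/= -!scalemxAl mxE. Qed.

Lemma bilZr n c (u : 'cV[R]_n) (M : 'M[R]_n) (v : 'cV[R]_n) :
  bil u M (c *: v) = c * bil u M v.
Proof. by rewrite /bil -scalemxAr mxE. Qed.

Lemma bil0l n (M : 'M[R]_n) (v : 'cV[R]_n) : bil 0 M v = 0.
Proof. by rewrite -(scale0r v) bilZl mul0r. Qed.

Lemma bil0r n (u : 'cV[R]_n) (M : 'M[R]_n) : bil u M 0 = 0.
Proof. by rewrite -(scale0r u) bilZr mul0r. Qed.

Lemma bil_sumr n (u : 'cV[R]_n) (M : 'M[R]_n) (I : Type) (r : seq I)
    (Pr : pred I) (F : I -> 'cV[R]_n) :
  bil u M (\sum_(i <- r | Pr i) F i) = \sum_(i <- r | Pr i) bil u M (F i).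
Proof.
by apply: (big_morph (bil u M)) => [v v'|]; [exact: bilDr|exact: bil0r].
Qed.

(* [mxbound c M] says that the spectral norm of [M] is at most [c]. *)
Definition mxbound n (c : R) (M : 'M[R]_n) :=
  forall u v, `|bil u M v| <= c * (vnorm2 u * vnorm2 v).

(** From left to right by Cauchy-Schwarz. Conversely, the form is tested on [u = M *m v], and one
    factor [vnorm2 (M *m v)] is cancelled. *)
Lemma mxboundP {n c} {M : 'M[R]_n} : 0 <= c ->
  (forall v, vnorm2 (M *m v) <= c * vnorm2 v) <-> mxbound c M.
Proof.
move=> c0; split => [h u v|h v].
  rewrite bilE mulrCA; apply: (@le_trans _ _ (vnorm2 u * vnorm2 (M *m v))).
    rewrite -(@ler_pXn2r _ 2%N) ?nnegrE ?mulr_ge0 ?vnorm2_ge0//.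
    by rewrite real_normK ?num_real// exprMn !sqr_vnorm2; exact: sum_mul_sqr_le.
  by rewrite ler_wpM2l ?vnorm2_ge0.
have := h (M *m v) v.
have -> : bil (M *m v) M v = vnorm2 (M *m v) ^+ 2.
  by rewrite bilE sqr_vnorm2; apply: eq_bigr => i _; rewrite expr2.
have := vnorm2_ge0 (M *m v); rewrite le_eqVlt => /predU1P[<-|M0].
  by rewrite mulr_ge0 ?vnorm2_ge0.
by rewrite ger0_norm ?sqr_ge0// expr2 mulrCA ler_pM2l.
Qed.

Lemma mxboundD n c d (M N : 'M[R]_n) :
  mxbound c M -> mxbound d N -> mxbound (c + d) (M + N).
Proof.
move=> hM hN u v; rewrite bilDm mulrDl.
by apply: le_trans (ler_normD _ _) _; exact: lerD.
Qed.

Lemma mxboundM n c d (M N : 'M[R]_n) : 0 <= c -> 0 <= d ->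
  mxbound c M -> mxbound d N -> mxbound (c * d) (M *m N).
Proof.
move=> c0 d0 hM /(mxboundP d0) hN; apply/mxboundP; first exact: mulr_ge0.
move=> v; rewrite -mulmxA -mulrA.
move/(mxboundP c0) : hM => /(_ (N *m v)) hM; apply: le_trans hM _.
exact: ler_wpM2l.
Qed.

Lemma mxboundW n c d (M : 'M[R]_n) : c <= d -> mxbound c M -> mxbound d M.
Proof.
move=> cd hM u v; apply: le_trans (hM u v) _.
by rewrite ler_wpM2r ?mulr_ge0 ?vnorm2_ge0.
Qed.

Lemma mxboundX n (A : 'M[R]_n) k : mxbound 1 A -> mxbound 1 (A ^+ k).
Proof.
move=> hA; elim: k => [|k IH].
  by apply/mxboundP => // v; rewrite expr0 mul1mx mul1r.
by rewrite exprS -[1](mulr1 1); exact: mxboundM.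
Qed.

Lemma mxbound0_eq0 n (M : 'M[R]_n) : mxbound 0 M -> M = 0.
Proof.
move=> /mxboundP h; apply/matrixP => i j; rewrite mxE.
have : M *m (delta_mx j 0 : 'cV[R]_n) = 0.
  apply: vnorm2_eq0; apply/eqP; rewrite eq_le vnorm2_ge0 andbT.
  by have := h (lexx _) (delta_mx j 0); rewrite mul0r.
by move=> /matrixP/(_ i 0); rewrite -colE !mxE.
Qed.

Lemma vnorm2_mulmx_frob n (M : 'M[R]_n) v :
  vnorm2 (M *m v) <= frobnorm M * vnorm2 v.
Proof.
rewrite -(@ler_pXn2r _ 2%N) ?nnegrE ?mulr_ge0 ?vnorm2_ge0 ?sqrtr_ge0//.
rewrite exprMn !sqr_vnorm2 sqr_sqrtr; last first.
  by apply: sumr_ge0 => i _; apply: sumr_ge0 => j _; exact: sqr_ge0.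
rewrite mulr_suml; apply: ler_sum => i _; rewrite mxE.
exact: sum_mul_sqr_le.
Qed.

(** In dimension 0 there is no unit vector; the supremum is then 0 by convention. *)
Lemma specnorm_ge0 n (M : 'M[R]_n) : 0 <= specnorm M.
Proof.
rewrite /specnorm; set E := image _ _.
have [[[y Ey] Eub]|/sup_out ->//] := pselect (has_sup E).
apply: (@le_trans _ _ y); first by case: Ey => v _ <-; exact: vnorm2_ge0.
exact: ub_le_sup.
Qed.

Lemma mxbound_specnorm n (M : 'M[R]_n) : mxbound (specnorm M) M.
Proof.
apply/mxboundP; first exact: specnorm_ge0.
move=> v; have := vnorm2_ge0 v; rewrite le_eqVlt => /predU1P[/esym v0|v0].
  by rewrite v0 (vnorm2_eq0 v0) mulmx0 -(vnorm2_eq0 v0) v0 mulr0.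
rewrite -ler_pdivrMr//.
have -> : vnorm2 (M *m v) / vnorm2 v = vnorm2 (M *m ((vnorm2 v)^-1 *: v)).
  by rewrite -scalemxAr vnorm2Z ger0_norm 1?mulrC// invr_ge0 vnorm2_ge0.
apply: sup_upper_bound; last first.
  exists ((vnorm2 v)^-1 *: v) => //=.
  by rewrite vnorm2Z ger0_norm ?mulVf ?gt_eqF// invr_ge0 vnorm2_ge0.
split.
  exists (vnorm2 (M *m ((vnorm2 v)^-1 *: v))); exists ((vnorm2 v)^-1 *: v) => //=.
  by rewrite vnorm2Z ger0_norm ?mulVf ?gt_eqF// invr_ge0 vnorm2_ge0.
(* The Frobenius norm shows that the set is bounded above, without which [sup] would be a default
   value. *)
exists (frobnorm M) => _ [u /= u1 <-].
by have := vnorm2_mulmx_frob M u; rewrite u1 mulr1.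
Qed.

Lemma specnorm_le n c (M : 'M[R]_n) : 0 <= c -> mxbound c M -> specnorm M <= c.
Proof.
move=> c0 /(mxboundP c0) hM; rewrite /specnorm.
have [->|/set0P S0] := eqVneq [set vnorm2 (M *m v) | v in
  [set v : 'cV[R]_n | vnorm2 v = 1]] set0; first by rewrite sup0.
by apply: ge_sup => // _ [v /= v1 <-]; rewrite -[c]mulr1 -v1.
Qed.

(** Since [A] does not increase norms, the spectral norm [s] of [X] satisfies [s <= y + g * s]. *)
Lemma lyapunov_mxbound n g y (A X Y : 'M[R]_n) : 0 <= g < 1 -> 0 <= y ->
  mxbound 1 A -> mxbound y Y -> X = Y + g *: (A^T *m X *m A) ->
  mxbound (y / (1 - g)) X.
Proof.
move=> /andP[g0 g1] y0 /mxboundP hA hY XE.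
apply: (@mxboundW _ (specnorm X)); last exact: mxbound_specnorm.
have S0 := specnorm_ge0 X.
rewrite ler_pdivlMr ?subr_gt0// mulrBr mulr1 lerBlDr.
apply: specnorm_le; first by rewrite addr_ge0// mulr_ge0.
move=> u v; rewrite [in bil _ _ _]XE bilDm bilZm -mulmxA bilTM bilM mulrDl.
apply: le_trans (ler_normD _ _) _; apply: lerD; first exact: hY.
rewrite normrM (ger0_norm g0) (mulrC _ g) -(mulrA g) ler_wpM2l//.
apply: le_trans (mxbound_specnorm X (A *m u) (A *m v)) _.
rewrite ler_wpM2l// ler_pM ?vnorm2_ge0//.
  by have := hA ler01 u; rewrite mul1r.
by have := hA ler01 v; rewrite mul1r.
Qed.

End norms.

(** * Lattice points in planar elliptic annuli *)

Section grid_counting.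
Context {R : realType} (D : nat) (eta L : R).
Hypothesis eta0 : 0 < eta.

Definition gpos (i : 'I_D) : R := eta * (i : nat)%:R - L.

(** The set lies between its least and its greatest index, whose positions are at most [d] apart. *)
Lemma card_grid (A : {set 'I_D}) (d : R) : 0 <= d ->
  (forall i j, i \in A -> j \in A -> (i <= j)%N -> gpos j - gpos i <= d) ->
  #|A|%:R <= 1 + d / eta.
Proof.
move=> d0 hA; have [->|] := eqVneq A finset.set0.
  by rewrite cards0 addr_ge0// divr_ge0// ltW.
move=> /set0Pn[i Ai].
case: (@arg_minnP _ i (mem A) (fun i => i : nat) Ai) => i0 /= Ai0 min0.
case: (@arg_maxnP _ i (mem A) (fun i => i : nat) Ai) => i1 /= Ai1 max1.
have i01 : (i0 <= i1)%N by exact: min0.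
have /le_trans -> // : (#|A|%:R : R) <= (i1 - i0).+1%:R.
  rewrite ler_nat -(size_iota i0 (i1 - i0).+1) cardE -(size_map val).
  apply: uniq_leq_size; first by rewrite map_inj_uniq ?enum_uniq//; exact: val_inj.
  move=> y /mapP[k]; rewrite mem_enum => Ak ->{y}.
  by rewrite mem_iota min0//= addnS ltnS subnKC//; exact: max1.
rewrite -natr1 addrC lerD2l ler_pdivlMr// natrB//.
have := hA _ _ Ai0 Ai1 i01; rewrite /gpos => h; apply: le_trans h.
by rewrite le_eqVlt; apply/orP; left; apply/eqP; ring.
Qed.

Lemma card_grid_itv (r : R) : 0 <= r ->
  #|[set i | `|gpos i| <= r]%SET|%:R <= 1 + 2 * r / eta.
Proof.
move=> r0; apply: card_grid; first by rewrite mulr_ge0.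
move=> i j; rewrite !inE !ler_norml => /andP[a b] /andP[c d] _; lra.
Qed.

Lemma card_fibers (I J : finType) (S : {set I * J}) (k : R) : 0 <= k ->
  (forall j, #|[set i | (i, j) \in S]%SET|%:R <= k) ->
  #|S|%:R <= #|[set j | [exists i, (i, j) \in S]]%SET|%:R * k.
Proof.
move=> k0 hk; rewrite -sum1_card (partition_big snd
  (mem [set j | [exists i, (i, j) \in S]]%SET)) /=; last first.
  by move=> [i j] Sij; rewrite inE; apply/existsP; exists i.
rewrite natr_sum -sum1_card natr_sum mulr_suml; apply: ler_sum => j _.
rewrite mul1r sum1_card; apply: le_trans (hk j).
rewrite ler_nat.
apply: (@leq_trans #|((fun i => (i, j)) @: [set i | (i, j) \in S])%SET|).
  apply: subset_leq_card; apply/fintype.subsetP => -[i j'].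
  rewrite unfold_in/= => /andP[Sij /eqP jE]; apply/imsetP; exists i => //.
    by rewrite inE -jE.
  by rewrite -jE.
exact: leq_imset_card.
Qed.

Definition quad (a b k l1 l2 e s t : R) :=
  a * s ^+ 2 + 2 * b * s * t + k * t ^+ 2 + l1 * s + l2 * t + e.

(** On a line [t] is fixed and the derivative in [s] is affine, so the increment of [quad] between
    two points is exactly their distance times the mean of the two derivatives. Where the derivative
    keeps its sign and is at least [mu] in absolute value, an increment of at most [2 * h] forces a
    distance of at most [2 * h / mu]. The leading 2 counts the two signs. *)
Lemma card_quad_fiber (a b k l1 l2 e h mu t : R) (A : {set 'I_D}) :
  0 < mu -> 0 <= h ->
  (forall i, i \in A -> `|quad a b k l1 l2 e (gpos i) t| <= h) ->
  (forall i, i \in A -> mu <= `|2 * (a * gpos i + b * t) + l1|) ->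
  #|A|%:R <= 2 * (1 + 2 * h / mu / eta).
Proof.
move=> mu0 h0 hq hD.
have side (B : {set 'I_D}) (c : bool) : (forall i, i \in B -> i \in A /\
    (0 <= (-1) ^+ c * (2 * (a * gpos i + b * t) + l1))) ->
    #|B|%:R <= 1 + 2 * h / mu / eta.
  move=> hB; apply: card_grid; first by rewrite divr_ge0 ?(ltW mu0) ?mulr_ge0.
  move=> i j Bi Bj ij; rewrite ler_pdivlMr//.
  have [Ai si] := hB _ Bi; have [Aj sj] := hB _ Bj.
  have := hq _ Ai; have := hq _ Aj; rewrite !ler_norml.
  move=> /andP[q1 q2] /andP[q3 q4].
  have dij : 0 <= gpos j - gpos i.
    have -> : gpos j - gpos i = eta * ((j : nat)%:R - (i : nat)%:R) by rewrite /gpos; ring.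
    by rewrite mulr_ge0 ?(ltW eta0)// subr_ge0 ler_nat.
  have : mu <= (-1) ^+ c * (2 * (a * gpos i + b * t) + l1).
    by have := hD _ Ai; rewrite -[`|_|](ger0_norm (normr_ge0 _)) -(ger0_norm si)
      normrM normrX normrN1 expr1n mul1r normr_id.
  have : mu <= (-1) ^+ c * (2 * (a * gpos j + b * t) + l1).
    by have := hD _ Aj; rewrite -[`|_|](ger0_norm (normr_ge0 _)) -(ger0_norm sj)
      normrM normrX normrN1 expr1n mul1r normr_id.
  move=> mj mi.
  have {mi mj}mij : 2 * mu <= (-1) ^+ c * ((2 * (a * gpos i + b * t) + l1)
     + (2 * (a * gpos j + b * t) + l1)) by rewrite mulrDr; lra.
  have /le_trans : (gpos j - gpos i) * (2 * mu) <= (gpos j - gpos i) *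
     ((-1) ^+ c * ((2 * (a * gpos i + b * t) + l1)
     + (2 * (a * gpos j + b * t) + l1))) by exact: ler_wpM2l.
  have -> : (gpos j - gpos i) *
     ((-1) ^+ c * ((2 * (a * gpos i + b * t) + l1)
     + (2 * (a * gpos j + b * t) + l1))) = (-1) ^+ c * (2 *
      (quad a b k l1 l2 e (gpos j) t - quad a b k l1 l2 e (gpos i) t)).
    by rewrite /quad; ring.
  have sg : (-1) ^+ c * (2 * (quad a b k l1 l2 e (gpos j) t
     - quad a b k l1 l2 e (gpos i) t)) <= 4 * h.
    by case: (c); rewrite ?expr1 ?expr0; lra.
  by move=> /(_ _ sg); lra.
pose B0 := [set i in A | 0 <= 2 * (a * gpos i + b * t) + l1]%SET.
pose B1 := [set i in A | 2 * (a * gpos i + b * t) + l1 <= 0]%SET.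
have AE : A \subset (B0 :|: B1)%SET.
  apply/fintype.subsetP => i Ai; rewrite !inE Ai/=.
  by case: (lerP 0) => // /ltW.
have := leq_trans (subset_leq_card AE) (leq_card_setU _ _).
rewrite -(ler_nat R) natrD => /le_trans; apply.
rewrite mulrDl mul1r lerD//.
  apply: (side _ false) => i; rewrite inE => /andP[Ai ?]; split => //.
  by rewrite expr0 mul1r.
apply: (side _ true) => i; rewrite inE => /andP[Ai ?]; split => //.
by rewrite expr1 mulN1r oppr_ge0.
Qed.

(** The lines met by [S] are counted in two ways: by [r], from the size of [t], and by [W], from the
    size of the gradient. In the product with the count on one line, the first estimate is used for
    the constant part and the second for the part [h / mu]. With [W] proportional to [mu], the
    steepness then cancels, which makes the bound independent of the size of the ellipse. *)
Lemma card_quad_sector (a b k l1 l2 e h r mu W : R) (S : {set 'I_D * 'I_D}) :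
  0 < a -> 0 < k -> 0 < a * k - b ^+ 2 -> 0 < mu -> 0 <= h -> 0 <= r -> 0 <= W ->
  (forall p, p \in S ->
    [/\ `|quad a b k l1 l2 e (gpos p.1) (gpos p.2)| <= h,
        `|gpos p.2| <= r,
        mu <= `|2 * (a * gpos p.1 + b * gpos p.2) + l1|,
        `|2 * (a * gpos p.1 + b * gpos p.2) + l1| <= W &
        `|2 * (b * gpos p.1 + k * gpos p.2) + l2| <= W]) ->
  #|S|%:R <= 2 * (1 + 2 * r / eta) +
     (1 + 2 * (a + k) * W / (a * k - b ^+ 2) / eta) * (4 * h / mu / eta).
Proof.
move=> a0 k0 det0 mu0 h0 r0 W0 hS.
have bak : `|b| <= a + k.
  rewrite -(@ler_pXn2r _ 2%N) ?nnegrE// ?real_normK ?num_real//; last first.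
    by rewrite addr_ge0 ?(ltW a0) ?(ltW k0).
  have : 0 < a * k by exact: mulr_gt0.
  have := sqr_ge0 a; have := sqr_ge0 k; rewrite sqrrD; lra.
have h1 : 0 <= 2 * h / mu / eta.
  by rewrite !divr_ge0 ?mulr_ge0 ?(ltW mu0) ?(ltW eta0).
set J := [set j | [exists i, (i, j) \in S]]%SET.
have SJ : #|S|%:R <= #|J|%:R * (2 * (1 + 2 * h / mu / eta)).
  apply: card_fibers; first by rewrite mulr_ge0// addr_ge0.
  move=> j; apply: (@card_quad_fiber a b k l1 l2 e h mu (gpos j)) => //.
    by move=> i; rewrite inE => /hS[].
  by move=> i; rewrite inE => /hS[].
have J1 : #|J|%:R <= 1 + 2 * r / eta.
  apply: card_grid; first by rewrite mulr_ge0.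
  move=> i j; rewrite !inE => /existsP[x /hS[_ + _ _ _]] /existsP[y /hS[_ + _ _ _]].
  rewrite /= !ler_norml => /andP[? ?] /andP[? ?] _; lra.
have J2 : #|J|%:R <= 1 + 2 * (a + k) * W / (a * k - b ^+ 2) / eta.
  apply: card_grid; first by rewrite divr_ge0 ?(ltW det0)// !mulr_ge0 ?addr_ge0 ?(ltW a0) ?(ltW k0).
  move=> i j; rewrite !inE => /existsP[x /hS[_ _ _]] /=.
  move=> xi1 xi2 /existsP[y /hS[_ _ _]] /= yj1 yj2 _.
  rewrite ler_pdivlMr//.
  set u1 := 2 * (a * gpos x + _) + _ in xi1.
  set u2 := 2 * (b * gpos x + _) + _ in xi2.
  set v1 := 2 * (a * gpos y + _) + _ in yj1.
  set v2 := 2 * (b * gpos y + _) + _ in yj2.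
  (* Cramer's rule for the linear part of the map from a point to its gradient. *)
  have E : 2 * ((gpos j - gpos i) * (a * k - b ^+ 2)) =
      a * (v2 - u2) - b * (v1 - u1) by rewrite /u1 /u2 /v1 /v2; ring.
  have e1 : a * (v2 - u2) <= a * (2 * W).
    rewrite ler_pM2l//; move: xi2 yj2.
    by rewrite !ler_norml => /andP[? ?] /andP[? ?]; lra.
  have e2 : - (b * (v1 - u1)) <= (a + k) * (2 * W).
    apply: le_trans (ler_norm _) _; rewrite normrN normrM.
    apply: ler_pM => //; move: xi1 yj1.
    by rewrite !ler_norml => /andP[? ?] /andP[? ?]; lra.
  have e3 : 0 <= k * (2 * W) by rewrite !mulr_ge0 ?(ltW k0).
  have : a * (2 * W) + (a + k) * (2 * W) = 2 * ((a + k) * (2 * W)) - k * (2 * W).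
    by ring.
  by move=> e4; lra.
apply: le_trans SJ _; rewrite mulrDr mulr1 mulrDr lerD//; first by rewrite mulrC ler_pM2l.
have -> : 4 * h / mu / eta = 2 * (2 * h / mu / eta) by rewrite !mulrA -natrM.
by rewrite ler_wpM2r// mulr_ge0.
Qed.

End grid_counting.

(* [u] and [v] are the partial derivatives of [quad]; up to an additive constant,
   [k u ^ 2 - 2 b u v + a v ^ 2] is [4 (a k - b ^ 2)] times [quad]. *)
Lemma quad_grad {R : realType} (a b k l1 l2 e s t : R) :
  let u := 2 * (a * s + b * t) + l1 in let v := 2 * (b * s + k * t) + l2 in
  k * u ^+ 2 - 2 * b * u * v + a * v ^+ 2 =
  4 * (a * k - b ^+ 2) * quad a b k l1 l2 e s t
  + (k * l1 ^+ 2 - 2 * b * l1 * l2 + a * l2 ^+ 2 - 4 * (a * k - b ^+ 2) * e).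
Proof. by rewrite /quad; ring. Qed.

(** [F] has trace [a + k] and determinant [a * k - b ^+ 2], so its eigenvalues lie between
    determinant / trace and trace; both bounds are proved by sums of squares. *)
Lemma det_form_bounds {R : realType} (a b k u v : R) :
  0 < a -> 0 < k -> 0 < a * k - b ^+ 2 ->
  let F := k * u ^+ 2 - 2 * b * u * v + a * v ^+ 2 in
  (a * k - b ^+ 2) * (u ^+ 2 + v ^+ 2) <= (a + k) * F /\
  F <= (a + k) * (u ^+ 2 + v ^+ 2).
Proof.
move=> a0 k0 det0 F; split.
  rewrite -subr_ge0 (_ : _ - _ = (k * u - b * v) ^+ 2 + (b * u - a * v) ^+ 2).
    by rewrite addr_ge0 ?sqr_ge0.
  by rewrite /F; ring.
rewrite -(ler_pM2l a0) -subr_ge0.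
rewrite (_ : _ - _ = (a * u + b * v) ^+ 2 + (a * k - b ^+ 2) * v ^+ 2).
  by rewrite addr_ge0 ?sqr_ge0// mulr_ge0 ?sqr_ge0// ltW.
by rewrite /F; ring.
Qed.

(** The neighbourhood of the centre, where no partial derivative need be large. The gradient is an
    invertible affine function of the point, so a gradient of order [sqrt h] confines the points to
    a square of side of order [sqrt h]. Since [eta <= sqrt h], such a square contains at most of the
    order of [h / eta ^+ 2] grid points. *)
Lemma card_quad_small {R : realType} (D : nat) (eta L : R) (a b k l1 l2 e h : R)
    (S : {set 'I_D * 'I_D}) :
  let T := a + k in let det := a * k - b ^+ 2 in
  0 < a -> 0 < k -> 0 < det -> 0 < eta -> eta ^+ 2 <= h ->
  (forall p, p \in S ->
     (2 * (a * gpos eta L p.1 + b * gpos eta L p.2) + l1) ^+ 2 +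
     (2 * (b * gpos eta L p.1 + k * gpos eta L p.2) + l2) ^+ 2 <= 12 * T * h) ->
  #|S|%:R <= (1 + 2 * T * Num.sqrt (12 * T) / det) ^+ 2 * h / eta ^+ 2.
Proof.
move=> T det a0 k0 det0 eta0 etah hS.
have T0 : 0 < T by exact: addr_gt0.
have h0 : 0 <= h by apply: le_trans etah; exact: sqr_ge0.
have bT : `|b| <= T.
  rewrite -(@ler_pXn2r _ 2%N) ?nnegrE// ?real_normK ?num_real//; last exact: ltW.
  have : 0 < a * k by exact: mulr_gt0.
  have := sqr_ge0 a; have := sqr_ge0 k; rewrite /T sqrrD; move: det0; rewrite /det; lra.
pose w := Num.sqrt (12 * T) * Num.sqrt h.
have w0 : 0 <= w by rewrite mulr_ge0// sqrtr_ge0.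
have wE : w ^+ 2 = 12 * T * h by rewrite exprMn !sqr_sqrtr// mulr_ge0// ltW.
have absw x y : x ^+ 2 + y ^+ 2 <= 12 * T * h -> `|x| <= w /\ `|y| <= w.
  rewrite -wE => xy; split; rewrite -(@ler_pXn2r _ 2%N) ?nnegrE// real_normK ?num_real//.
    by have := sqr_ge0 y; lra.
  by have := sqr_ge0 x; lra.
pose d := 2 * T * w / det.
have d0 : 0 <= d by rewrite divr_ge0 ?(ltW det0)// !mulr_ge0// ltW.
have diff x y x' y' :
    (2 * (a * x + b * y) + l1) ^+ 2 + (2 * (b * x + k * y) + l2) ^+ 2 <= 12 * T * h ->
    (2 * (a * x' + b * y') + l1) ^+ 2 + (2 * (b * x' + k * y') + l2) ^+ 2 <= 12 * T * h ->
    x' - x <= d /\ y' - y <= d.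
  move=> /absw[u1 v1] /absw[u2 v2].
  set u := 2 * (a * x + _) + _ in u1; set v := 2 * (b * x + _) + _ in v1.
  set u' := 2 * (a * x' + _) + _ in u2; set v' := 2 * (b * x' + _) + _ in v2.
  have du : `|u' - u| <= 2 * w.
    by apply: le_trans (ler_normB _ _) _; lra.
  have dv : `|v' - v| <= 2 * w.
    by apply: le_trans (ler_normB _ _) _; lra.
  have bound c x1 x2 : 0 <= c -> c <= T -> `|x1| <= 2 * w -> `|x2| <= 2 * w ->
      c * x1 - b * x2 <= 2 * (2 * T * w).
    move=> c0 cT hx1 hx2.
    have p1 : c * x1 <= T * (2 * w).
      apply: le_trans (ler_norm _) _; rewrite normrM (ger0_norm c0).
      by apply: ler_pM.
    have p2 : - (b * x2) <= T * (2 * w).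
      apply: le_trans (ler_norm _) _; rewrite normrN normrM.
      by apply: ler_pM.
    have -> : 2 * (2 * T * w) = T * (2 * w) + T * (2 * w) by ring.
    exact: lerD.
  rewrite !ler_pdivlMr//; split.
    have E : 2 * ((x' - x) * det) = k * (u' - u) - b * (v' - v).
      by rewrite /u /u' /v /v' /det; ring.
    have := bound k _ _ (ltW k0) _ du dv.
    by rewrite -E ler_pM2l// /T lerDr (ltW a0); exact.
  have E : 2 * ((y' - y) * det) = a * (v' - v) - b * (u' - u).
    by rewrite /u /u' /v /v' /det; ring.
  have := bound a _ _ (ltW a0) _ dv du.
  by rewrite -E ler_pM2l// /T lerDl (ltW k0); exact.
have k1 : 0 <= 1 + d / eta by rewrite addr_ge0// divr_ge0// ltW.
have cS : #|S|%:R <= (1 + d / eta) * (1 + d / eta).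
  apply: le_trans (card_fibers k1 _) _ => [j|].
    apply: (card_grid (L := L)) => // i i'; rewrite !inE => /hS p1 /hS p2 _.
    by have [] := diff _ _ _ _ p1 p2.
  rewrite ler_pM2r; last by rewrite ltr_wpDr// divr_ge0// ltW.
  apply: (card_grid (L := L)) => // i i'; rewrite !inE.
  move=> /existsP[x /hS p1] /existsP[y /hS p2] _.
  by have [] := diff _ _ _ _ p1 p2.
apply: le_trans cS _.
have sh : 1 <= Num.sqrt h / eta.
  rewrite ler_pdivlMr// mul1r -(@ler_pXn2r _ 2%N) ?nnegrE ?sqrtr_ge0 ?(ltW eta0)//.
  by rewrite sqr_sqrtr.
have -> : (1 + 2 * T * Num.sqrt (12 * T) / det) ^+ 2 * h / eta ^+ 2 =
   ((1 + 2 * T * Num.sqrt (12 * T) / det) * (Num.sqrt h / eta)) ^+ 2.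
  by rewrite exprMn expr_div_n sqr_sqrtr// mulrA.
rewrite -expr2 ler_pXn2r ?nnegrE//; last first.
  rewrite mulr_ge0 ?addr_ge0 ?divr_ge0 ?sqrtr_ge0 ?(ltW det0) ?(ltW eta0)//.
  by rewrite !mulr_ge0 ?sqrtr_ge0// ltW.
rewrite mulrDl mul1r lerD// /d /w le_eqVlt; apply/orP; left; apply/eqP; ring.
Qed.

(** By [quad_grad], the form [F] of the gradient stays within [4 * det * h] of a number [Z] that
    depends on the polynomial only. If [Z] is of order [h], the points are near the centre.
    Otherwise the gradient has norm of order [sqrt Z] on all of [S], and [S] is split according to
    which partial derivative is large. *)
Lemma card_quad {R : realType} (a b k : R) :
  0 < a -> 0 < k -> 0 < a * k - b ^+ 2 ->
  exists2 C : R, 0 <= C & forall (D : nat) (eta L l1 l2 e h r : R)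
    (S : {set 'I_D * 'I_D}),
  0 < eta -> eta <= 1 -> eta <= h -> 1 <= r ->
  (forall p, p \in S ->
    [/\ `|quad a b k l1 l2 e (gpos eta L p.1) (gpos eta L p.2)| <= h,
        `|gpos eta L p.1| <= r & `|gpos eta L p.2| <= r]) ->
  #|S|%:R <= C * r * h / eta ^+ 2.
Proof.
move=> a0 k0 det0; set det := a * k - b ^+ 2 in det0 *; set T := a + k.
have T0 : 0 < T by exact: addr_gt0.
pose C1 := (1 + 2 * T * Num.sqrt (12 * T) / det) ^+ 2.
(* [c3] is made for [4 * eta <= c3 * mu], and [w0] is the ratio of the upper to the lower bound for
   the partial derivatives, [mu] being defined below. *)
pose c3 := Num.sqrt (8 * T / det).
pose w0 := Num.sqrt (6 * T ^+ 2 / det).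
have c30 : 0 <= c3 by exact: sqrtr_ge0.
have w00 : 0 <= w0 by exact: sqrtr_ge0.
pose C2 := 6 + c3 + 8 * T * w0 / det.
have C20 : 0 <= C2.
  by rewrite !addr_ge0// divr_ge0 ?(ltW det0)// !mulr_ge0// ltW.
have C10 : 0 <= C1 by exact: sqr_ge0.
exists (C1 + 2 * C2); first by rewrite addr_ge0// mulr_ge0.
move=> D eta L l1 l2 e h r S eta0 eta1 etah r1 hS.
have h0 : 0 < h by exact: lt_le_trans etah.
have etah2 : eta ^+ 2 <= h.
  by apply: le_trans etah; rewrite expr2 ler_piMl// ltW.
pose Z := k * l1 ^+ 2 - 2 * b * l1 * l2 + a * l2 ^+ 2 - 4 * det * e.
pose u (p : 'I_D * 'I_D) := 2 * (a * gpos eta L p.1 + b * gpos eta L p.2) + l1.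
pose v (p : 'I_D * 'I_D) := 2 * (b * gpos eta L p.1 + k * gpos eta L p.2) + l2.
have hF p : p \in S ->
    det * (u p ^+ 2 + v p ^+ 2) <= T * (Z + 4 * det * h) /\
    Z - 4 * det * h <= T * (u p ^+ 2 + v p ^+ 2).
  move=> /hS[q1 _ _]; have [f1 f2] := det_form_bounds (u p) (v p) a0 k0 det0.
  have E := quad_grad a b k l1 l2 e (gpos eta L p.1) (gpos eta L p.2).
  rewrite /= -/(u p) -/(v p) -/det -/Z in E.
  have dq : `|4 * det * quad a b k l1 l2 e (gpos eta L p.1) (gpos eta L p.2)|
      <= 4 * det * h.
    by rewrite normrM ger0_norm ?ler_wpM2l// mulr_ge0// ltW.
  move: dq; rewrite ler_norml => /andP[d1 d2].
  split; last by apply: le_trans f2; rewrite E; lra.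
  by apply: le_trans f1 _; rewrite ler_pM2l// E; lra.
have RH : 0 <= r * h / eta ^+ 2.
  by rewrite divr_ge0 ?sqr_ge0// mulr_ge0 ?(ltW h0)// (le_trans _ r1).
have hr : h / eta ^+ 2 <= r * h / eta ^+ 2.
  by rewrite -mulrA ler_peMl// divr_ge0 ?sqr_ge0// ltW.
rewrite -!mulrA (mulrA r).
have [Zs|Zl] := ltP Z (8 * det * h).
  have := @card_quad_small R D eta L a b k l1 l2 e h S a0 k0 det0 eta0 etah2.
  rewrite /= -/T -/det -/C1 => /(_ _)/le_trans; apply.
    move=> p /hF[f1 _]; rewrite -/(u p) -/(v p) -(ler_pM2l det0).
    apply: le_trans f1 _.
    have -> : det * (12 * T * h) = T * (12 * det * h) by ring.
    by rewrite ler_pM2l//; lra.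
  rewrite -mulrA; apply: (@le_trans _ _ (C1 * (r * h / eta ^+ 2))).
    by rewrite ler_wpM2l.
  by rewrite ler_wpM2r// lerDl mulr_ge0.
have Z0 : 0 < Z by apply: lt_le_trans Zl; rewrite !mulr_gt0.
(* Here [8 * det * h <= Z], so [F] lies between [Z / 2] and [3 / 2 * Z]. If both partial derivatives
   were below [mu], then [F] would be below [2 * T * mu ^+ 2 = Z / 2]. *)
pose mu := Num.sqrt (Z / (4 * T)).
have mu0 : 0 < mu by rewrite sqrtr_gt0 divr_gt0// mulr_gt0.
have muE : mu ^+ 2 = Z / (4 * T) by rewrite sqr_sqrtr// divr_ge0 ?mulr_ge0 ?ltW.
have WE : (w0 * mu) ^+ 2 = 3 * T * Z / (2 * det).
  rewrite exprMn muE sqr_sqrtr; last by rewrite divr_ge0 ?(ltW det0)// mulr_ge0// sqr_ge0.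
  by field; rewrite !gt_eqF.
have W0 : 0 <= w0 * mu by rewrite mulr_ge0// ltW.
have uvW p : p \in S -> `|u p| <= w0 * mu /\ `|v p| <= w0 * mu.
  move=> /hF[f1 _].
  have {}f1 : u p ^+ 2 + v p ^+ 2 <= (w0 * mu) ^+ 2.
    rewrite WE ler_pdivlMr ?mulr_gt0//.
    have : T * (Z + 4 * det * h) <= T * (3 / 2 * Z) by rewrite ler_pM2l//; lra.
    by move=> ?; nra.
  split; rewrite -(@ler_pXn2r _ 2%N) ?nnegrE// real_normK ?num_real//;
    by apply: le_trans f1; rewrite ?lerDl ?lerDr sqr_ge0.
have uvmu p : p \in S -> mu <= `|u p| \/ mu <= `|v p|.
  move=> /hF[_ f2]; have [?|um] := leP mu `|u p|; [by left|right].
  rewrite leNgt; apply/negP => vm.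
  have sq (x : R) : `|x| < mu -> x ^+ 2 < mu ^+ 2.
    by move=> xm; rewrite -(real_normK (num_real x)) ltr_pXn2r ?nnegrE ?(ltW mu0).
  have E : T * mu ^+ 2 = Z / 4 by rewrite muE; field; rewrite gt_eqF.
  have : T * (u p ^+ 2 + v p ^+ 2) < T * (mu ^+ 2 + mu ^+ 2).
    by rewrite ltr_pM2l// ltrD// sq.
  have -> : T * (mu ^+ 2 + mu ^+ 2) = Z / 2 by rewrite mulrDr E; lra.
  by lra.
(* Stated for any coefficients with the same determinant and trace, so that it applies again after
   the two coordinates are exchanged. *)
have sector (a' b' k' l1' l2' : R) (S' : {set 'I_D * 'I_D}) :
    0 < a' -> 0 < k' -> a' * k' - b' ^+ 2 = det -> a' + k' = T ->
  (forall p, p \in S' ->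
    [/\ `|quad a' b' k' l1' l2' e (gpos eta L p.1) (gpos eta L p.2)| <= h,
        `|gpos eta L p.2| <= r,
        mu <= `|2 * (a' * gpos eta L p.1 + b' * gpos eta L p.2) + l1'|,
        `|2 * (a' * gpos eta L p.1 + b' * gpos eta L p.2) + l1'| <= w0 * mu &
        `|2 * (b' * gpos eta L p.1 + k' * gpos eta L p.2) + l2'| <= w0 * mu]) ->
  #|S'|%:R <= C2 * (r * h / eta ^+ 2).
  move=> a'0 k'0 detE TE hS'.
  have := @card_quad_sector R D eta L eta0 a' b' k' l1' l2' e h r mu (w0 * mu) S'.
  rewrite detE TE => /(_ a'0 k'0 det0 mu0 (ltW h0) (le_trans ler01 r1) W0 hS').
  move=> /le_trans; apply.
  have -> : C2 * (r * h / eta ^+ 2) = 6 * (r * h / eta ^+ 2) +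
      (c3 * (r * h / eta ^+ 2) + 8 * T * w0 / det * (r * h / eta ^+ 2)).
    by rewrite /C2; ring.
  have -> : (1 + 2 * T * (w0 * mu) / det / eta) * (4 * h / mu / eta) =
      4 * h / mu / eta + 2 * T * (w0 * mu) / det / eta * (4 * h / mu / eta) by ring.
  rewrite lerD//.
    (* A line may carry a point however thin the annulus is; [eta <= h] absorbs this, and it is the
       origin of the factor [r]. *)
    have -> : r * h / eta ^+ 2 = r / eta * (h / eta) by field; rewrite gt_eqF.
    have re : 1 <= r / eta by rewrite ler_pdivlMr// mul1r (le_trans eta1).
    have he : 1 <= h / eta by rewrite ler_pdivlMr// mul1r.
    have : r / eta <= r / eta * (h / eta).
      by rewrite ler_peMr// (le_trans ler01).
    by lra.
  rewrite lerD//.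
    apply: (@le_trans _ _ (c3 * (h / eta ^+ 2))); last by rewrite ler_wpM2l.
    have -> : c3 * (h / eta ^+ 2) = c3 * (h / eta) / eta.
      by field; rewrite gt_eqF.
    rewrite ler_wpM2r ?invr_ge0 ?(ltW eta0)//.
    have -> : c3 * (h / eta) = h * (c3 / eta) by ring.
    rewrite (mulrC 4) -mulrA ler_pM2l// ler_pdivrMr// mulrAC ler_pdivlMr//.
    rewrite -(@ler_pXn2r _ 2%N) ?nnegrE ?mulr_ge0 ?(ltW eta0) ?(ltW mu0)//.
    rewrite !exprMn muE sqr_sqrtr; last by rewrite divr_ge0 ?mulr_ge0 ?ltW.
    have -> : 8 * T / det * (Z / (4 * T)) = 2 * Z / det.
      by field; rewrite !gt_eqF.
    rewrite ler_pdivlMr//.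
    have : det * eta ^+ 2 <= det * h by rewrite ler_pM2l.
    by lra.
  have -> : 2 * T * (w0 * mu) / det / eta * (4 * h / mu / eta) =
      8 * T * w0 / det * (h / eta ^+ 2) by field; rewrite !gt_eqF.
  by rewrite ler_wpM2l// divr_ge0 ?(ltW det0)// !mulr_ge0// ltW.
pose S1 := [set p in S | mu <= `|u p|]%SET.
pose S2 := [set p in S | mu <= `|v p|]%SET.
have SU : S \subset (S1 :|: S2)%SET.
  apply/fintype.subsetP => p Sp; rewrite !inE Sp/=; apply/orP; exact: uvmu.
have SU2 : (#|S|%:R : R) <= #|S1|%:R + #|S2|%:R.
  by rewrite -natrD ler_nat (leq_trans (subset_leq_card SU))// leq_card_setU.
apply: le_trans SU2 _.
apply: (@le_trans _ _ (C2 * (r * h / eta ^+ 2) + C2 * (r * h / eta ^+ 2))); last first.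
  by rewrite -mulrDl ler_wpM2r//; lra.
apply: lerD.
  apply: (sector a b k l1 l2) => // p; rewrite inE => /andP[Sp ?].
  by have [? ? ?] := hS _ Sp; have [? ?] := uvW _ Sp.
have swap_inj : injective (fun p : 'I_D * 'I_D => (p.2, p.1)).
  by move=> [? ?] [? ?] [-> ->].
rewrite -(card_imset S2 swap_inj).
apply: (sector k b a l2 l1) => //; first by rewrite /det mulrC.
  by rewrite /T addrC.
move=> y /imsetP[p]; rewrite inE => /andP[Sp mv] ->{y}.
have [q1 q2 q3] := hS _ Sp; have [w1 w2] := uvW _ Sp.
split => //=.
- by move: q1; rewrite /quad; congr (`|_| <= _); ring.
- by rewrite (addrC (k * _)).
- by rewrite (addrC (k * _)).
- by rewrite (addrC (b * _)).
Qed.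

(** * The small-ball bound for lattice noise *)

Section resampling.
Context {R : realType} {I X : finType}.

Definition upd (y : {ffun I -> X}) (k : I) (g : X) : {ffun I -> X} :=
  [ffun i => if i == k then g else y i].

Lemma updE y k g i : upd y k g i = if i == k then g else y i.
Proof. by rewrite ffunE. Qed.

(** The functions with [y k = d] represent the assignments of all coordinates but [k]; the value [d]
    is a mere placeholder. *)
Lemma sum_ffun_split (k : I) (d : X) (H : {ffun I -> X} -> R) :
  \sum_y H y = \sum_(y : {ffun I -> X} | y k == d) \sum_g H (upd y k g).
Proof.
rewrite exchange_big/= (partition_big (fun y : {ffun I -> X} => y k) xpredT)//=.
apply: eq_bigr => g _.
rewrite (reindex_onto (fun y : {ffun I -> X} => upd y k g) (fun y : {ffun I -> X} => upd y k d))/=; last first.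
  move=> y /eqP yg; apply/ffunP => i; rewrite !updE.
  by case: eqP => // ->.
apply: eq_bigl => y; rewrite updE eqxx eqxx/=.
apply/eqP/eqP => [<-|yd]; first by rewrite updE eqxx.
apply/ffunP => i; rewrite !updE; case: eqP => // ->; by rewrite yd.
Qed.

Lemma sum_ffun_split2 (k0 k1 : I) (d : X) (H : {ffun I -> X} -> R) : k0 != k1 ->
  \sum_y H y = \sum_(y : {ffun I -> X} | (y k0 == d) && (y k1 == d))
    \sum_g0 \sum_g1 H (upd (upd y k1 g1) k0 g0).
Proof.
move=> k01; rewrite (sum_ffun_split k0 d) big_mkcond/= (sum_ffun_split k1 d).
rewrite [in RHS](eq_bigl (fun y : {ffun I -> X} => (y k1 == d) && (y k0 == d))); last first.
  by move=> y; rewrite andbC.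
rewrite big_mkcondr/=; apply: eq_bigr => y _.
under eq_bigr => g1 _ do rewrite updE (negbTE k01).
case: ifP => _; last by rewrite big1.
by rewrite exchange_big.
Qed.

Lemma sum_prod_ffun (F : I -> X -> R) :
  \sum_(y : {ffun I -> X}) \prod_k F k (y k) = \prod_k \sum_g F k g.
Proof. by rewrite bigA_distr_bigA. Qed.

End resampling.

(** * Pairs of grid points in higher dimension *)

Section pair_counting.
Context {R : realType} (D : nat) (eta L : R).
Hypotheses (eta0 : 0 < eta) (eta1 : eta <= 1).

Notation pos := (@gpos R D eta L).

Lemma card_grid_slab n (c : 'I_D) (r : R) : 1 <= r ->
  \sum_(g : {ffun 'I_n.+1 -> 'I_D} | g ord0 == c)
     ([forall x, (x != ord0) ==> (`|pos (g x)| <= r)%R])%:R <= (3 * r / eta) ^+ n.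
Proof.
move=> r1; have r0 : 0 <= r by exact: le_trans r1.
pose F (x : 'I_n.+1) (s : 'I_D) : R :=
  if x == ord0 then (s == c)%:R else (`|pos s| <= r)%R%:R.
have F0 x s : 0 <= F x s by rewrite /F; case: eqP.
rewrite big_mkcond/=.
apply: (@le_trans _ _ (\sum_(g : {ffun 'I_n.+1 -> 'I_D}) \prod_x F x (g x))).
  apply: ler_sum => g _.
  have P0 : 0 <= \prod_x F x (g x) by apply: prodr_ge0 => x _; exact: F0.
  case: eqP => [g0|_] //.
  have [/forallP h|_] := boolP [forall x, (x != ord0) ==> (`|pos (g x)| <= r)%R] => //.
  rewrite big1// => x _; rewrite /F; case: eqP => [->|/eqP x0]; first by rewrite g0 eqxx.
  by have := h x; rewrite x0 /= => ->.
rewrite sum_prod_ffun big_ord_recl.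
rewrite [X in X * _](_ : _ = 1); last first.
  rewrite (bigD1 c)//= /F/= eqxx big1 ?addr0// => s; by move/negbTE => ->.
rewrite mul1r -[X in _ <= _ ^+ X]card_ord -prodr_const.
apply: ler_prod => x _; rewrite sumr_ge0//= /F/=.
rewrite -natr_sum -big_mkcond/= sum1_card.
have := @card_grid_itv R D eta L eta0 r r0.
rewrite cardsE => /le_trans; apply.
have : 1 <= r / eta by rewrite ler_pdivlMr// mul1r (le_trans eta1).
lra.
Qed.

(** Only the first coordinates are counted finely, by [K]. Each of the other [2 * n] coordinates
    ranges over at most [1 + 2 * r / eta <= 3 * r / eta] grid values. *)
Lemma sum_pairs_le n (c : 'I_D) (E : rel {ffun 'I_n.+1 -> 'I_D}) (r K : R) :
  1 <= r -> 0 <= K ->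
  (forall g0 g1, E g0 g1 -> forall x, `|pos (g0 x)| <= r /\ `|pos (g1 x)| <= r) ->
  (forall g0 g1, \sum_s \sum_s' (E (upd g0 ord0 s) (upd g1 ord0 s'))%:R <= K) ->
  \sum_g0 \sum_g1 (E g0 g1)%:R <= (3 * r / eta) ^+ n * (3 * r / eta) ^+ n * K.
Proof.
move=> r1 K0 Er EK.
pose slab (g : {ffun 'I_n.+1 -> 'I_D}) :=
  [forall x, (x != ord0) ==> (`|pos (g x)| <= r)%R].
rewrite (sum_ffun_split ord0 c).
apply: (@le_trans _ _ (\sum_(g0 : {ffun 'I_n.+1 -> 'I_D} | g0 ord0 == c)
    \sum_(g1 : {ffun 'I_n.+1 -> 'I_D} | g1 ord0 == c)
    (slab g0)%:R * (slab g1)%:R * K)); last first.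
  under eq_bigr => g0 _ do (rewrite -mulr_suml -mulr_sumr).
  rewrite -mulr_suml ler_wpM2r// -mulr_suml.
  by apply: ler_pM; rewrite ?sumr_ge0// card_grid_slab.
apply: ler_sum => g0 _.
under eq_bigr => s _ do rewrite (sum_ffun_split ord0 c).
rewrite exchange_big/=; apply: ler_sum => g1 _.
have [s0|s0] := boolP (slab g0); last first.
  rewrite big1 ?mul0r// => s _; rewrite big1// => s' _.
  apply/eqP; rewrite pnatr_eq0 eqb0; apply: contra s0 => /Er h.
  apply/forallP => x; apply/implyP => x0; have [+ _] := h x.
  by rewrite updE (negbTE x0).
have [s1|s1] := boolP (slab g1); last first.
  rewrite big1 ?mulr0 ?mul0r// => s _; rewrite big1// => s' _.
  apply/eqP; rewrite pnatr_eq0 eqb0; apply: contra s1 => /Er h.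
  apply/forallP => x; apply/implyP => x0; have [_] := h x.
  by rewrite updE (negbTE x0).
by rewrite !mul1r.
Qed.

Lemma sum_quad_le (C : R) (a b k l1 l2 e h r : R) (E : rel 'I_D) :
  (forall S : {set 'I_D * 'I_D}, (forall p, p \in S ->
    [/\ `|quad a b k l1 l2 e (pos p.1) (pos p.2)| <= h,
        `|pos p.1| <= r & `|pos p.2| <= r]) ->
    #|S|%:R <= C * r * h / eta ^+ 2) ->
  (forall s s', E s s' -> [/\ `|quad a b k l1 l2 e (pos s) (pos s')| <= h,
        `|pos s| <= r & `|pos s'| <= r]) ->
  \sum_s \sum_s' (E s s')%:R <= C * r * h / eta ^+ 2.
Proof.
move=> hC hE; rewrite pair_big/= -natr_sum.
rewrite -big_mkcond/= sum1_card -cardsE; apply: hC => p.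
by rewrite inE => /hE.
Qed.

End pair_counting.

Lemma sum_geom_le {R : realFieldType} (th : R) N : 0 <= th -> th < 1 ->
  \sum_(k < N) th ^+ k <= (1 - th)^-1.
Proof.
move=> th0 th1; rewrite -[X in _ <= X]mul1r ler_pdivlMr ?subr_gt0//.
rewrite -{2}(expr1n R N) mulrC; have := subrXX 1 th N.
under eq_bigr => i _ do rewrite expr1n mul1r.
by rewrite expr1n => <-; rewrite gerBl exprn_ge0.
Qed.

(** * The small-ball estimate for independent noise on a finite grid *)

Section discrete.
Context {R : realType} (n m : nat) (qa qb qk : nat -> R) (M B th : R).
Hypotheses (M0 : 0 <= M) (B1 : 1 <= B) (th0 : 0 <= th) (th1 : th < 1).

Section grid.
Context (N D : nat) (eta L t z : R).
Hypotheses (mN : (m.*2 <= N)%N) (eta0 : 0 < eta) (eta1 : eta <= 1) (etat : eta <= t).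
Notation point := {ffun 'I_n.+1 -> 'I_D}.
Context (p : 'I_N -> point -> R) (G : {ffun 'I_N -> point} -> R).

Definition wgt (g : point) : R := 1 + \sum_x gpos eta L (g x) ^+ 2.
Definition Phi (y : {ffun 'I_N -> point}) : R := \sum_(k < N) th ^+ k * wgt (y k).
(** Pair [i] consists of the noises [2 * i] and [2 * i + 1]. A product of weights factorizes under
    independence and, all weights being at least 1, still dominates each of its factors. *)
Definition blockw (i : nat) (y : {ffun 'I_N -> point}) : R :=
  \prod_(l < N | l./2 == i) wgt (y l).

(** The masses may add up to less than 1, because the grid covers a bounded window only; [pM] is the
    bound of the density times the volume of a cell. *)
Hypotheses (p0 : forall k g, 0 <= p k g) (p1 : forall k, \sum_g p k g <= 1)
  (pB : forall k, \sum_g p k g * wgt g <= B)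
  (pM : forall k g, p k g <= M * eta ^+ n.+1).
Hypothesis Gquad : forall (i : nat) (k0 k1 : 'I_N), (i < m)%N ->
  k0 = i.*2 :> nat -> k1 = i.*2.+1 :> nat -> forall y (g0 g1 : point),
  exists l1 l2 e, forall s s',
  G (upd (upd y k1 (upd g1 ord0 s')) k0 (upd g0 ord0 s)) =
  quad (qa i) (qb i) (qk i) l1 l2 e (gpos eta L s) (gpos eta L s').

Let t0 : 0 < t := lt_le_trans eta0 etat.
Let B0 : 0 < B := lt_le_trans ltr01 B1.

Lemma wgt_ge1 g : 1 <= wgt g.
Proof. by rewrite /wgt lerDl sumr_ge0// => x _; exact: sqr_ge0. Qed.

Lemma wgt_ge0 g : 0 <= wgt g. Proof. exact: le_trans (wgt_ge1 g). Qed.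

Lemma gpos_le_wgt (g : point) x u : wgt g <= u -> `|gpos eta L (g x)| <= u.
Proof.
move=> gu; have g1 := wgt_ge1 g; have u0 : 0 <= u by lra.
rewrite -(@ler_pXn2r _ 2%N) ?nnegrE// real_normK ?num_real//.
apply: (@le_trans _ _ u); last by rewrite expr2 ler_peMr//; lra.
apply: le_trans gu; rewrite /wgt (bigD1 x)//= addrCA lerDl.
by rewrite addr_ge0// sumr_ge0// => k _; exact: sqr_ge0.
Qed.

Lemma blockw_ge1 i y : 1 <= blockw i y.
Proof.
rewrite /blockw; elim/big_ind: _ => // [a b a1 b1|l _]; last exact: wgt_ge1.
by rewrite -[1]mul1r ler_pM.
Qed.

Lemma wgt_le_blockw (y : {ffun 'I_N -> point}) l : wgt (y l) <= blockw l./2 y.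
Proof.
rewrite /blockw (bigD1 l)//= ler_peMr ?wgt_ge0//.
elim/big_ind: _ => // [a b a1 b1|k _]; last exact: wgt_ge1.
by rewrite -[1]mul1r ler_pM.
Qed.

Section block.
Context (i : 'I_m) (u : R).
Hypothesis u1 : 1 <= u.
Let u0 : 0 < u := lt_le_trans ltr01 u1.

Definition others_large y :=
  [forall i' : 'I_m, (i' != i) ==> (u <= blockw i' y)].
(** [Phi] with the weights of pair [i] replaced by 1. It does not depend on that pair, and
    [Phi <= r * Phi_off] as soon as [1 <= r] and both weights are at most [r]. *)
Definition Phi_off (y : {ffun 'I_N -> point}) : R :=
  \sum_(k < N) th ^+ k * (if k./2 == i then 1 else wgt (y k)).
Definition prob_off (y : {ffun 'I_N -> point}) : R :=
  \prod_(l < N) (if l./2 == i then 1 else p l (y l)).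

Lemma Phi_off_ge0 y : 0 <= Phi_off y.
Proof.
apply: sumr_ge0 => k _; rewrite mulr_ge0 ?exprn_ge0//.
by case: eqP => // _; exact: wgt_ge0.
Qed.

Lemma prob_off_ge0 y : 0 <= prob_off y.
Proof. by apply: prodr_ge0 => l _; case: eqP. Qed.

(** Markov's inequality in product form: each large pair contributes a factor [blockw / u], at least
    1. The pair containing [k] is left out, because the weight of [k] will be multiplied in from
    [Phi_off] and its square need not be integrable. At least [m - 2] pairs remain, and [1 <= u]
    allows weakening the exponent to exactly that number. *)
Lemma others_large_le (k : 'I_N) y : (others_large y)%:R <= (u ^+ (m - 2))^-1 *
  \prod_(l < N) \prod_(i' : 'I_m | [&& i' != i, (i' : nat) != k./2 & l./2 == i']) wgt (y l).
Proof.
have P1 : 1 <= \prod_(l < N) \prod_(i' : 'I_m | [&& i' != i, (i' : nat) != k./2 & l./2 == i'])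
    wgt (y l).
  elim/big_ind: _ => // [a b a1 b1|l _]; first by rewrite -[1]mul1r ler_pM.
  elim/big_ind: _ => // [a b a1 b1|i' _]; first by rewrite -[1]mul1r ler_pM.
  exact: wgt_ge1.
have [/forallP h|_] := boolP (others_large y); last first.
  by rewrite mulr_ge0 ?invr_ge0 ?exprn_ge0 ?(ltW u0)// (le_trans ler01).
rewrite mulrC ler_pdivlMr ?exprn_gt0// mul1r.
rewrite (exchange_big_dep (fun i' : 'I_m => (i' != i) && ((i' : nat) != k./2)))/=; last first.
  by move=> l i' _ /and3P[-> ->].
apply: (@le_trans _ _ (\prod_(i' : 'I_m | (i' != i) && ((i' : nat) != k./2)) u)); last first.
  apply: ler_prod => i' /andP[ii' ik]; rewrite (ltW u0)/=.
  have := h i'; rewrite ii' /= => /le_trans; apply.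
  rewrite /blockw le_eqVlt; apply/orP; left; apply/eqP; apply: eq_bigl => l.
  by rewrite ik.
rewrite prodr_const ler_weXn2l//.
have : (#|'I_m| <= #|[pred i' : 'I_m | (i' != i) && ((i' : nat) != k./2)]| + 2)%N.
  rewrite -(cardC [pred i' : 'I_m | (i' != i) && ((i' : nat) != k./2)]) leq_add2l.
  have [km|km] := ltnP k./2 m.
    apply: (@leq_trans #|[set i; Ordinal km]%SET|).
      apply: subset_leq_card; apply/fintype.subsetP => x.
      by rewrite !inE negb_and !negbK.
    by rewrite cards2; case: eqP.
  apply: (@leq_trans #|[set i]%SET|); last by rewrite cards1.
  apply: subset_leq_card; apply/fintype.subsetP => x.
  rewrite !inE negb_and !negbK => /orP[//|/eqP xk].
  by have := ltn_ord x; rewrite xk ltnNge km.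
by rewrite card_ord leq_subLR addnC.
Qed.

(** The sum freezes pair [i] at the placeholder [d] and so is an expectation over the other noises.
    For each term [k] of [Phi_off], the Markov bound makes the summand a product over coordinates in
    which no weight is repeated. *)
Lemma expect_off_le (d : point) :
  \sum_(y : {ffun 'I_N -> point} | [forall l : 'I_N, (l./2 == i) ==> (y l == d)])
     (others_large y)%:R * prob_off y * Phi_off y <=
  (1 - th)^-1 * B ^+ m.*2.+1 / u ^+ (m - 2).
Proof.
rewrite /Phi_off; under eq_bigr => y _ do rewrite mulr_sumr.
rewrite exchange_big/=.
rewrite -mulrA; apply: le_trans (ler_wpM2r _ (sum_geom_le N th0 th1)); last first.
  by rewrite divr_ge0 ?exprn_ge0 ?(ltW u0) ?(ltW B0).
rewrite mulr_suml; apply: ler_sum => k _.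
under eq_bigr => y _ do rewrite mulrCA.
rewrite -mulr_sumr ler_wpM2l ?exprn_ge0//.
(* What coordinate [l] contributes to the Markov product: its weight if its pair is among those
   used, otherwise an empty product. *)
pose f (l : 'I_N) (g : point) : R :=
  \prod_(i' : 'I_m | [&& i' != i, (i' : nat) != k./2 & l./2 == i']) wgt g.
pose F (l : 'I_N) (g : point) : R := if l./2 == i then (g == d)%:R else
  p l g * f l g * (if l == k then wgt g else 1).
have f0 l g : 0 <= f l g by apply: prodr_ge0 => i' _; exact: wgt_ge0.
have F0 l g : 0 <= F l g.
  rewrite /F; case: ifP => // _; rewrite !mulr_ge0//.
  by case: eqP => // _; exact: wgt_ge0.
apply: (@le_trans _ _ ((u ^+ (m - 2))^-1 * \sum_(y : {ffun 'I_N -> point}) \prod_l F l (y l))).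
  rewrite mulr_sumr big_mkcond/=; apply: ler_sum => y _.
  case: ifP => [/forallP yd|_]; last first.
    by rewrite mulr_ge0 ?invr_ge0 ?exprn_ge0 ?(ltW u0)// prodr_ge0.
  have -> : \prod_l F l (y l) = (\prod_l f l (y l)) * (prob_off y *
      (if k./2 == i then 1 else wgt (y k))).
    have -> : (if k./2 == i then 1 else wgt (y k)) =
        \prod_(l < N) (if (l == k) && (l./2 != i) then wgt (y l) else 1).
      rewrite (bigD1 k)//= eqxx/= big1 ?mulr1; first by case: eqP.
      by move=> l /negbTE ->.
    rewrite /prob_off -!big_split/=; apply: eq_bigr => l _.
    have := yd l; rewrite /F; case: eqP => /= [li /eqP ->|li _].
      rewrite andbF eqxx !mulr1 /f big_pred0// => i'.
      by rewrite li; apply/negbTE; rewrite !negb_and !negbK; case: (eqVneq i' i) => //= ii';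
         rewrite [X in _ || X](_ : _ = true) ?orbT//; apply: contra ii' => /eqP/val_inj ->.
    by rewrite andbT; ring.
  rewrite -mulrA [X in _ <= X]mulrA.
  apply: ler_wpM2r; last exact: others_large_le.
  by rewrite mulr_ge0 ?prob_off_ge0//; case: eqP => // _; exact: wgt_ge0.
rewrite mulrC sum_prod_ffun ler_wpM2r ?invr_ge0 ?exprn_ge0 ?(ltW u0)//.
(* Only the [2 * m] coordinates inside the pairs and the coordinate [k] can carry a weight, whence
   the exponent [2 * m + 1] of [B]. *)
apply: (@le_trans _ _ (\prod_(l < N) (if (l < m.*2)%N || (l == k) then B else 1))).
  apply: ler_prod => l _; rewrite sumr_ge0//=.
  have cB (x : R) c : x <= 1 -> x <= if c then B else 1.
    by move=> x1; case: c => //; exact: le_trans x1 B1.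
  rewrite /F; case: eqP => li.
    by apply: cB; rewrite (bigD1 d)//= eqxx big1 ?addr0// => g /negbTE ->.
  have lm2 : (l < m.*2)%N = (l./2 < m)%N by rewrite -ltn_half_double.
  have fE g : f l g = if [&& (l./2 < m)%N & l./2 != k./2] then wgt g else 1.
    rewrite /f; case: ifP => [/andP[lm lk]|lmk].
      rewrite (big_pred1 (Ordinal lm))// => i'.
      apply/and3P/eqP => [[_ _ /eqP li']|->]; first exact: val_inj.
      by split => //=; apply/eqP => /(congr1 val).
    rewrite big_pred0// => i'; apply/negP => /and3P[_ ik /eqP li'].
    by move: lmk; rewrite li' ik ltn_ord.
  under eq_bigr => g _ do rewrite fE.
  have [-> /=|lk] := eqVneq l k.
    rewrite orbT; under eq_bigr => g _ do rewrite eqxx andbF mulr1.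
    exact: pB.
  under eq_bigr => g _ do rewrite mulr1.
  rewrite orbF lm2; case: (ltnP l./2 m) => /= lm; last first.
    by under eq_bigr => g _ do rewrite mulr1.
  case: eqP => _ /=; last exact: pB.
  under eq_bigr => g _ do rewrite mulr1.
  exact: le_trans (p1 _) B1.
rewrite -big_mkcond/= prodr_const ler_weXn2l//.
have /leq_trans -> // : (#|[pred l : 'I_N | (l < m.*2)%N || (l == k)]| <=
    #|[pred l : 'I_N | (l < m.*2)%N]| + #|pred1 k|)%N.
  by rewrite -cardUI leq_addr.
rewrite card1 addn1 ltnS -(size_iota 0 m.*2) cardE -(size_map val).
apply: uniq_leq_size; first by rewrite map_inj_uniq ?enum_uniq//; exact: val_inj.
by move=> x /mapP[l]; rewrite mem_enum inE size_iota => lm ->{x}; rewrite mem_iota add0n.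
Qed.

Definition level (y : {ffun 'I_N -> point}) : bool :=
  [&& `|G y - z| <= t * Phi y, blockw i y <= 2 * u & others_large y].

Let r := 2 * u.
Let r1 : 1 <= r. Proof. by have := u1; rewrite /r; lra. Qed.
Let r0 : 0 <= r. Proof. by have := u1; rewrite /r; lra. Qed.

Section pair.
Context (k0 k1 : 'I_N).
Hypotheses (k0E : k0 = i.*2 :> nat) (k1E : k1 = i.*2.+1 :> nat).

Let k01 : k0 != k1.
Proof. by rewrite -val_eqE/= k0E k1E neq_ltn ltnSn. Qed.

Let k0h : k0./2 = i. Proof. by rewrite k0E doubleK. Qed.
Let k1h : k1./2 = i. Proof. by rewrite k1E /= uphalf_double. Qed.

Let half_eq (l : 'I_N) : (l./2 == i) = (l == k0) || (l == k1).
Proof.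
rewrite -!val_eqE/= k0E k1E; apply/eqP/orP => [<-|[/eqP ->|/eqP ->]].
- by have := odd_double_half l; case: (odd l) => /= lE; [right|left];
    apply/eqP; exact/esym.
- by rewrite doubleK.
- by rewrite /= uphalf_double.
Qed.

Let upd2 (y : {ffun 'I_N -> point}) g0 g1 := upd (upd y k1 g1) k0 g0.

Let upd2E y g0 g1 l : upd2 y g0 g1 l =
  if l == k0 then g0 else if l == k1 then g1 else y l.
Proof. by rewrite !updE. Qed.

Let upd2_off y g0 g1 (l : 'I_N) : l./2 != i -> upd2 y g0 g1 l = y l.
Proof. by rewrite upd2E half_eq negb_or => /andP[/negbTE -> /negbTE ->]. Qed.

Let prob_off_upd y g0 g1 : prob_off (upd2 y g0 g1) = prob_off y.
Proof. by apply: eq_bigr => l _; case: ifPn => // /upd2_off ->. Qed.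

Let others_upd y g0 g1 : others_large (upd2 y g0 g1) = others_large y.
Proof.
apply: eq_forallb => i'; case: eqP => //= /eqP ii'.
congr (_ <= _); apply: eq_bigr => l /eqP li'; rewrite upd2_off// li'.
by apply: contra ii' => /eqP/val_inj ->.
Qed.

Let Phi_upd y g0 g1 : wgt g0 <= r -> wgt g1 <= r ->
  Phi (upd2 y g0 g1) <= r * Phi_off y.
Proof.
move=> g0r g1r; rewrite /Phi /Phi_off mulr_sumr; apply: ler_sum => l _.
rewrite mulrCA ler_wpM2l ?exprn_ge0// upd2E half_eq.
case: eqP => /= _; first by rewrite mulr1.
case: eqP => /= _; first by rewrite mulr1.
by rewrite ler_peMl// wgt_ge0.
Qed.

(** The threshold [t * (r * Phi_off y)] involves neither [g0] nor [g1], so with the other noises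
    fixed the first coordinates range over an elliptic annulus. *)
Let near y (g0 g1 : point) :=
  [&& `|G (upd2 y g0 g1) - z| <= t * (r * Phi_off y), wgt g0 <= r & wgt g1 <= r].

Let level_upd y g0 g1 :
  level (upd2 y g0 g1) -> near y g0 g1 && others_large y.
Proof.
rewrite /level /near => /and3P[Gz ir oy].
have g0r : wgt g0 <= r.
  by apply: le_trans ir; have := wgt_le_blockw (upd2 y g0 g1) k0; rewrite k0h upd2E eqxx.
have g1r : wgt g1 <= r.
  apply: le_trans ir; have := wgt_le_blockw (upd2 y g0 g1) k1.
  by rewrite k1h upd2E eq_sym (negbTE k01) eqxx.
rewrite g0r g1r -(others_upd y g0 g1) oy !andbT.
by apply: le_trans Gz _; rewrite ler_pM2l// Phi_upd.
Qed.

Let prod_le (y : {ffun 'I_N -> point}) : \prod_l p l (y l) <= (M * eta ^+ n.+1) ^+ 2 * prob_off y.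
Proof.
rewrite (bigD1 k0)//= (bigD1 k1) 1?eq_sym//= /prob_off.
rewrite [in X in _ <= X](bigD1 k0)//= [in X in _ <= X](bigD1 k1) 1?eq_sym//=.
rewrite k0h k1h eqxx !mul1r expr2 -mulrA.
rewrite [in X in _ <= X](eq_bigr (fun l => p l (y l))); last first.
  by move=> l /andP[/negbTE lk0 /negbTE lk1]; rewrite half_eq lk0 lk1.
by rewrite !ler_pM ?mulr_ge0// prodr_ge0.
Qed.

Lemma level_pair_le (C : R) (d : point) :
  (forall (D : nat) (eta L l1 l2 e h r : R) (S : {set 'I_D * 'I_D}),
    0 < eta -> eta <= 1 -> eta <= h -> 1 <= r ->
    (forall p, p \in S ->
      [/\ `|quad (qa i) (qb i) (qk i) l1 l2 e (gpos eta L p.1) (gpos eta L p.2)| <= h,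
        `|gpos eta L p.1| <= r & `|gpos eta L p.2| <= r]) ->
    #|S|%:R <= C * r * h / eta ^+ 2) -> 0 <= C ->
  \sum_(y | level y) \prod_l p l (y l) <=
  M ^+ 2 * 9 ^+ n * C * r ^+ (2 * n + 2) * t *
   ((1 - th)^-1 * B ^+ m.*2.+1 / u ^+ (m - 2)).
Proof.
move=> hC C0.
have K0 : 0 <= (M * eta ^+ n.+1) ^+ 2 by exact: sqr_ge0.
apply: (@le_trans _ _ ((M * eta ^+ n.+1) ^+ 2 * \sum_y (level y)%:R * prob_off y)).
  rewrite mulr_sumr big_mkcond/=; apply: ler_sum => y _.
  by case: ifP => _; rewrite ?mul1r ?prod_le// mul0r mulr0.
rewrite (sum_ffun_split2 d _ k01).
rewrite (eq_bigl (fun y : {ffun 'I_N -> point} =>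
    [forall l : 'I_N, (l./2 == i) ==> (y l == d)])); last first.
  move=> y; apply/andP/forallP => [[y0 y1] l|h].
    by rewrite half_eq; apply/implyP => /orP[] /eqP ->.
  by split; [have := h k0|have := h k1]; rewrite half_eq eqxx ?orbT.
pose cnt := (3 * r / eta) ^+ n * (3 * r / eta) ^+ n * (C * r * (t * r) / eta ^+ 2).
(* The mesh disappears: the two densities bring [eta ^+ (2 * n + 2)], the slabs cancel
   [eta ^+ (2 * n)] and the planar count [eta ^+ 2]. The powers of [r] are [2 * n] from the slabs, 1
   from the planar count and 1 from the threshold. *)
have alg x : (M * eta ^+ n.+1) ^+ 2 * ((3 * x / eta) ^+ n * (3 * x / eta) ^+ n *
    (C * x * (t * x) / eta ^+ 2)) = M ^+ 2 * 9 ^+ n * C * x ^+ (2 * n + 2) * t.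
  have -> : (9 : R) = 3 * 3 by rewrite -natrM.
  rewrite mul2n -addnn (exprS eta n) !exprD expr_div_n !exprMn.
  have en : eta ^+ n != 0 by rewrite expf_neq0// gt_eqF.
  by field; rewrite en gt_eqF.
have q0 : 0 <= 3 * r / eta by rewrite divr_ge0 ?(ltW eta0)// mulr_ge0.
have cnt0 : 0 <= cnt.
  apply: mulr_ge0; first by rewrite mulr_ge0 ?exprn_ge0.
  by apply: divr_ge0; [exact: mulr_ge0 (mulr_ge0 _ _) (mulr_ge0 (ltW t0) _)|exact: sqr_ge0].
apply: (@le_trans _ _ ((M * eta ^+ n.+1) ^+ 2 * (cnt *
   ((1 - th)^-1 * B ^+ m.*2.+1 / u ^+ (m - 2))))); last first.
  rewrite mulrA ler_wpM2r//.
    by rewrite divr_ge0 ?mulr_ge0 ?invr_ge0 ?subr_ge0 ?exprn_ge0 ?(ltW th1) ?(ltW B0) ?(ltW u0).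
  rewrite le_eqVlt; apply/orP; left; apply/eqP; rewrite /cnt.
  exact: alg.
rewrite ler_wpM2l//; apply: le_trans (ler_wpM2l cnt0 (expect_off_le d)).
rewrite mulr_sumr; apply: ler_sum => y _.
apply: (@le_trans _ _ (\sum_g0 \sum_g1 (near y g0 g1)%:R *
    ((others_large y)%:R * prob_off y))).
  apply: ler_sum => g0 _; apply: ler_sum => g1 _; rewrite prob_off_upd mulrA.
  rewrite ler_wpM2r ?prob_off_ge0// -natrM mulnb ler_nat.
  by have := @level_upd y g0 g1; case: level => // ->.
under eq_bigr do rewrite -mulr_suml.
rewrite -mulr_suml [X in _ <= X](_ : _ = cnt * Phi_off y *
  ((others_large y)%:R * prob_off y)); last by ring.
rewrite ler_wpM2r ?mulr_ge0 ?prob_off_ge0//.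
have -> : cnt * Phi_off y = (3 * r / eta) ^+ n * (3 * r / eta) ^+ n *
   (C * r * (t * (r * Phi_off y)) / eta ^+ 2) by rewrite /cnt; ring.
have near_r g0 g1 : near y g0 g1 ->
    forall x, `|gpos eta L (g0 x)| <= r /\ `|gpos eta L (g1 x)| <= r.
  by move=> /and3P[_ g0r g1r] x; split; exact: gpos_le_wgt.
have PH1 : 1 <= Phi_off y.
  rewrite /Phi_off (bigD1 (Ordinal (leq_ltn_trans (leq0n k0) (ltn_ord k0))))//=.
  rewrite expr0 mul1r ler_wpDr//.
    apply: sumr_ge0 => k _; rewrite mulr_ge0 ?exprn_ge0//.
    by case: eqP => // _; exact: wgt_ge0.
  by case: eqP => // _; exact: wgt_ge1.
(* The planar count needs a thickness of at least the mesh; it holds because [r] and [Phi_off y] are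
   at least 1. *)
have th' : eta <= t * (r * Phi_off y).
  apply: le_trans etat _; rewrite ler_peMr ?(ltW t0)// -[1]mul1r ler_pM//.
apply: (sum_pairs_le eta0 eta1 (d ord0) r1 _ near_r) => [|g0 g1].
  apply: divr_ge0; last exact: sqr_ge0.
  exact: mulr_ge0 (mulr_ge0 C0 r0) (mulr_ge0 (ltW t0) (mulr_ge0 r0 (Phi_off_ge0 y))).
have [l1 [l2 [e Ge]]] := Gquad (ltn_ord i) k0E k1E y g0 g1.
apply: (@sum_quad_le R D eta L C (qa i) (qb i) (qk i) l1 l2 (e - z)).
  move=> S hS; apply: (hC _ _ L l1 l2 (e - z)) => //.
move=> s s' ny; have [sr s'r] := near_r _ _ ny ord0.
move: sr s'r; rewrite !updE eqxx => sr s'r; split => //.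
move: ny => /and3P[+ _ _]; rewrite /upd2 Ge.
by congr (`|_| <= _); rewrite /quad; ring.
Qed.

End pair.
End block.

Lemma level_cover (y : {ffun 'I_N -> point}) (J : nat) : (0 < m)%N ->
  (forall i : 'I_m, blockw i y < 2 ^+ J) -> `|G y - z| <= t * Phi y ->
  exists (i : 'I_m) (j : 'I_J), level i (2 ^+ j) y.
Proof.
move=> m0 yJ Gy.
case: (@Order.TotalTheory.arg_minP _ R _ (Ordinal m0) xpredT
  (fun i : 'I_m => blockw i y) isT) => i _ imin.
have ex0 : exists j, 2 ^+ j <= blockw i y by exists 0%N; rewrite expr0 blockw_ge1.
have bnd j : 2 ^+ j <= blockw i y -> (j <= J)%N.
  move=> ji; rewrite leqNgt; apply/negP => Jj.
  have := le_lt_trans ji (yJ i); rewrite ltNge => /negP; apply.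
  by apply: (ler_weXn2l _ (ltnW Jj)); rewrite ler1n.
case: (ex_maxnP ex0 bnd) => j ji jmax.
have jJ : (j < J)%N.
  rewrite ltn_neqAle (bnd _ ji) andbT; apply/eqP => jJ.
  by have := le_lt_trans ji (yJ i); rewrite jJ ltxx.
exists i, (Ordinal jJ); rewrite /level Gy/=; apply/andP; split.
  rewrite -exprS leNgt; apply/negP => /ltW /jmax; by rewrite ltnn.
apply/forallP => i'; apply/implyP => _; apply: le_trans ji _; exact: imin.
Qed.

Lemma discrete_le (C : R) : m = (2 * n + 5)%N -> 0 <= C ->
  (forall (i : nat) (D : nat) (eta L l1 l2 e h r : R) (S : {set 'I_D * 'I_D}),
    (i < m)%N -> 0 < eta -> eta <= 1 -> eta <= h -> 1 <= r ->
    (forall p, p \in S ->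
      [/\ `|quad (qa i) (qb i) (qk i) l1 l2 e (gpos eta L p.1) (gpos eta L p.2)| <= h,
        `|gpos eta L p.1| <= r & `|gpos eta L p.2| <= r]) ->
    #|S|%:R <= C * r * h / eta ^+ 2) ->
  \sum_(y | `|G y - z| <= t * Phi y) \prod_l p l (y l) <=
  m%:R * (M ^+ 2 * 9 ^+ n * C * 2 ^+ (2 * n + 2) * (1 - th)^-1 * B ^+ m.*2.+1 * 2) * t.
Proof.
move=> mE C0 hC.
have m0 : (0 < m)%N by rewrite mE addnS.
set c := M ^+ 2 * 9 ^+ n * C * 2 ^+ (2 * n + 2) * (1 - th)^-1 * B ^+ m.*2.+1.
have c0 : 0 <= c.
  rewrite /c mulr_ge0 ?exprn_ge0 ?(ltW B0)// mulr_ge0 ?invr_ge0 ?subr_ge0 ?(ltW th1)//.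
  by rewrite mulr_ge0 ?exprn_ge0// mulr_ge0// mulr_ge0 ?exprn_ge0.
case: (pickP (fun y : {ffun 'I_N -> point} => `|G y - z| <= t * Phi y)) => [y0 _|nE]; last first.
  by rewrite big_pred0// mulr_ge0 ?(ltW t0)// mulr_ge0// mulr_ge0.
have N0 : (0 < N)%N by apply: leq_trans mN; rewrite double_gt0.
pose d := y0 (Ordinal N0).
(* There are finitely many configurations, so finitely many dyadic scales suffice; their number [J]
   drops out of the geometric sum. *)
pose J := Num.bound (\sum_(y : {ffun 'I_N -> point}) \sum_(i < m) blockw i y).
have bw0 i y : 0 <= blockw i y by exact: le_trans (blockw_ge1 i y).
have yJ y (i : 'I_m) : blockw i y < 2 ^+ J.
  apply: (@le_lt_trans _ _ (\sum_(y : {ffun 'I_N -> point}) \sum_(i < m) blockw i y)).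
    rewrite (bigD1 y)//= (bigD1 i)//= -addrA lerDl addr_ge0// ?sumr_ge0// => y' _.
    by rewrite sumr_ge0.
  apply: lt_trans (archi_boundP _) _.
    by apply: sumr_ge0 => y' _; exact: sumr_ge0.
  by rewrite -natrX ltr_nat ltn_expl.
apply: (@le_trans _ _ (\sum_(i < m) \sum_(j < J)
    \sum_(y | level i (2 ^+ j) y) \prod_l p l (y l))).
  under [X in _ <= X]eq_bigr => i _ do (under eq_bigr => j _ do rewrite big_mkcond/=;
    rewrite exchange_big/=).
  rewrite exchange_big/= big_mkcond/=; apply: ler_sum => y _.
  have P0 : 0 <= \prod_l p l (y l) by exact: prodr_ge0.
  have Q0 (i : 'I_m) (j : 'I_J) : 0 <= if level i (2 ^+ j) y then \prod_l p l (y l) else 0.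
    by case: ifP.
  case: ifP => [Gy|_]; last by apply: sumr_ge0 => i _; exact: sumr_ge0.
  have [i [j ij]] := @level_cover y J m0 (yJ y) Gy.
  rewrite (bigD1 i)//= (bigD1 j)//= ij -addrA lerDl addr_ge0// ?sumr_ge0// => i' _.
  exact: sumr_ge0.
rewrite (_ : _ * t = \sum_(i < m) (c * 2 * t)); last first.
  by rewrite sumr_const card_ord -[RHS]mulr_natl !mulrA.
apply: ler_sum => i _.
apply: (@le_trans _ _ (\sum_(j < J) (2^-1) ^+ j * (c * t))).
  apply: ler_sum => j _.
  have u1 : (1 : R) <= 2 ^+ j by rewrite exprn_ege1// ler1n.
  have i0N : (i.*2 < N)%N.
    by apply: leq_trans mN; rewrite ltn_double.
  have i1N : (i.*2.+1 < N)%N.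
    by apply: leq_trans mN; rewrite -doubleS leq_double.
  have := @level_pair_le i (2 ^+ j) u1 (Ordinal i0N) (Ordinal i1N) erefl erefl C d.
  move=> /(_ _ C0)/le_trans; apply.
    by move=> D' eta' L' l1 l2 e h r' S; exact: hC (ltn_ord i).
  rewrite le_eqVlt; apply/orP; left; apply/eqP.
  (* The gain [u ^+ (m - 2)] exceeds the cost [r ^+ (2 * n + 2)] by exactly one power of
     [u = 2 ^+ j]. *)
  rewrite mE (_ : 2 * n + 5 - 2 = 2 * n + 2 + 1)%N; last by rewrite -addnBA// -addnA.
  rewrite exprMn (exprD _ (2 * n + 2) 1) expr1 exprVn /c mE.
  have v0 : (2 ^+ j : R) != 0 by rewrite gt_eqF// (lt_le_trans ltr01).
  have w0 : (2 ^+ j : R) ^+ (2 * n + 2) != 0 by rewrite expf_neq0.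
  have th1' : 1 - th != 0 by rewrite gt_eqF// subr_gt0.
  by move: v0 w0 th1'; move: (2 ^+ j) => v; move: (v ^+ (2 * n + 2)) => w v0 w0 th1';
    field; rewrite v0 w0 th1'.
rewrite -mulr_suml.
have -> : c * 2 * t = 2 * (c * t) by ring.
apply: ler_wpM2r; first exact: mulr_ge0 c0 (ltW t0).
apply: le_trans (sum_geom_le _ _ _) _; rewrite ?invr_ge0// ?invf_lt1 ?ltr1n//.
rewrite (_ : 1 - 2^-1 = 2^-1) ?invrK//; lra.
Qed.

End grid.
End discrete.

(** * Truncations of the return *)

Section truncated.
Context {R : realType} {n : nat}.
Implicit Types (P A : 'M[R]_n) (x : 'cV[R]_n) (w u v : nat -> 'cV[R]_n).

Definition lin_term (g : R) P A x w k : R := g ^+ k.+1 * bil (w k) P (A ^+ k.+1 *m x).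
Definition diag_term (g : R) P w v k : R := g ^+ k.+1 * bil (w k) P (v k).
Definition cross_term (g : R) P A w v k : R :=
  g ^+ k.+1 * bil (w k) P (\sum_(0 <= tau < k) A ^+ (k - tau) *m v tau).

Definition GN (g : R) P A x w N : R :=
  bil x P x + 2 * (\sum_(0 <= k < N) lin_term g P A x w k)
  + \sum_(0 <= k < N) diag_term g P w w k
  + 2 * (\sum_(1 <= k < N) cross_term g P A w w k).

(** The quadratic part of [GN] as a bilinear, not symmetrized form: [u] fills the left slots and [v]
    the right ones. *)
Definition bilG (g : R) P A N u v : R :=
  \sum_(0 <= k < N) diag_term g P u v k + 2 * (\sum_(1 <= k < N) cross_term g P A u v k).

Lemma GNE g P A x w N : GN g P A x w N =
  bil x P x + 2 * (\sum_(0 <= k < N) lin_term g P A x w k) + bilG g P A N w w.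
Proof. by rewrite /GN /bilG addrA. Qed.

Lemma lin_termD g P A x u v k c :
  lin_term g P A x (fun k => u k + c *: v k) k =
  lin_term g P A x u k + c * lin_term g P A x v k.
Proof. by rewrite /lin_term bilDl bilZl; ring. Qed.

Lemma bilG_linl g P A N u u' v c :
  bilG g P A N (fun k => u k + c *: u' k) v =
  bilG g P A N u v + c * bilG g P A N u' v.
Proof.
rewrite /bilG mulrDr mulrCA !mulr_sumr addrACA -!big_split/=.
by congr (_ + _); apply: eq_bigr => k _; rewrite /diag_term /cross_term bilDl bilZl; ring.
Qed.

Lemma bilG_linr g P A N u v v' c :
  bilG g P A N u (fun k => v k + c *: v' k) =
  bilG g P A N u v + c * bilG g P A N u v'.
Proof.
rewrite /bilG mulrDr mulrCA !mulr_sumr addrACA -!big_split/=.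
congr (_ + _); apply: eq_bigr => k _; rewrite /diag_term /cross_term.
  by rewrite bilDr bilZr; ring.
under eq_bigr do rewrite mulmxDr -scalemxAr.
by rewrite big_split/= -scaler_sumr bilDr bilZr; ring.
Qed.

Definition spike k0 (e : 'cV[R]_n) : nat -> 'cV[R]_n := fun k => if k == k0 then e else 0.

(** The cross terms pair a noise on the left with strictly earlier noises on the right, whence the
    asymmetry in [i] and [j]. *)
Lemma bilG_spike g P A N i j e e' : (i < N)%N -> (j < N)%N ->
  bilG g P A N (spike i e) (spike j e') =
  if i == j then g ^+ i.+1 * bil e P e'
  else if (j < i)%N then 2 * (g ^+ i.+1 * bil e P (A ^+ (i - j) *m e')) else 0.
Proof.
move=> iN jN; rewrite /bilG.
have -> : \sum_(0 <= k < N) diag_term g P (spike i e) (spike j e') k =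
    if i == j then g ^+ i.+1 * bil e P e' else 0.
  rewrite (big_cat_nat (leq0n i) (ltnW iN))/=.
  rewrite [X in _ + X]big_ltn// big_nat big1 ?add0r; last first.
    by move=> k /andP[_ ki]; rewrite /diag_term /spike ltn_eqF// bil0l mulr0.
  rewrite big_nat big1 ?addr0; last first.
    by move=> k /andP[ki _]; rewrite /diag_term /spike gtn_eqF// bil0l mulr0.
  by rewrite /diag_term /spike eqxx; case: eqP => // _; rewrite bil0r mulr0.
have -> : \sum_(1 <= k < N) cross_term g P A (spike i e) (spike j e') k =
    if (j < i)%N then g ^+ i.+1 * bil e P (A ^+ (i - j) *m e') else 0.
  have inner : \sum_(0 <= tau < i) A ^+ (i - tau) *m spike j e' tau =
      if (j < i)%N then A ^+ (i - j) *m e' else 0.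
    case: ltnP => ij; last first.
      rewrite big_nat big1// => tau /andP[_ ti].
      by rewrite /spike ltn_eqF ?mulmx0// (leq_trans ti).
    rewrite (big_cat_nat (leq0n j) (ltnW ij))/=.
    rewrite [X in _ + X]big_ltn// big_nat big1 ?add0r; last first.
      by move=> k /andP[_ ki]; rewrite /spike ltn_eqF// mulmx0.
    rewrite big_nat big1 ?addr0 /spike ?eqxx//.
    by move=> k /andP[ki _]; rewrite gtn_eqF// mulmx0.
  have [i0|i0] := posnP i.
    rewrite i0 ltn0 big_nat big1// => k /andP[k0 _].
    by rewrite /cross_term /spike gtn_eqF// bil0l mulr0.
  rewrite (big_cat_nat i0 (ltnW iN))/=.
  rewrite [X in _ + X]big_ltn// big_nat big1 ?add0r; last first.
    by move=> k /andP[_ ki]; rewrite /cross_term /spike ltn_eqF// bil0l mulr0.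
  rewrite big_nat big1 ?addr0; last first.
    by move=> k /andP[ki _]; rewrite /cross_term /spike gtn_eqF// bil0l mulr0.
  rewrite /cross_term inner /spike eqxx/=; case: (ltnP j i) => // _.
  by rewrite bil0r mulr0.
case: eqP => [->|_]; first by rewrite ltnn mulr0 addr0.
by case: ifP => _; rewrite ?mulr0 add0r.
Qed.

(** By bilinearity the second-order coefficients come from the two spikes alone, so they involve
    neither [w] nor [x]. For consecutive indices the mixed one contains a single power of [A], and
    the 2 of the cross term is the 2 in [quad]. *)
Lemma GN_quad g P A x w N (e : 'cV[R]_n) i j : (j < N)%N -> j = i.+1 ->
  exists l1 l2 c, forall s s' : R,
  GN g P A x (fun k => (w k + s *: spike i e k) + s' *: spike j e k) N =
  quad (g ^+ i.+1 * bil e P e) (g ^+ i.+2 * bil e P (A *m e))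
    (g ^+ i.+2 * bil e P e) l1 l2 c s s'.
Proof.
move=> jN jE; have iN : (i < N)%N by rewrite (ltn_trans _ jN)// jE.
pose lin v := \sum_(0 <= k < N) lin_term g P A x v k.
pose B := bilG g P A N.
exists (2 * lin (spike i e) + B w (spike i e) + B (spike i e) w).
exists (2 * lin (spike j e) + B w (spike j e) + B (spike j e) w).
exists (bil x P x + 2 * lin w + B w w) => s s'.
rewrite GNE; under eq_bigr do rewrite 2!lin_termD.
rewrite !big_split/= -!mulr_sumr -!/(lin _).
rewrite !bilG_linl !bilG_linr -!/(B _ _).
have -> : B (spike i e) (spike i e) = g ^+ i.+1 * bil e P e.
  by rewrite /B bilG_spike// eqxx.
have -> : B (spike j e) (spike j e) = g ^+ i.+2 * bil e P e.
  by rewrite /B bilG_spike// eqxx jE.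
have -> : B (spike i e) (spike j e) = 0.
  by rewrite /B bilG_spike// jE ltn_eqF// ltnNge leqnSn.
have -> : B (spike j e) (spike i e) = 2 * (g ^+ i.+2 * bil e P (A *m e)).
  by rewrite /B bilG_spike// jE gtn_eqF// ltnSn subSnn expr1.
by rewrite /quad; ring.
Qed.

Lemma cross_term0 g P A w v : cross_term g P A w v 0 = 0.
Proof. by rewrite /cross_term big_geq// bil0r mulr0. Qed.

Lemma sum_cross_term g P A w v N :
  \sum_(1 <= k < N) cross_term g P A w v k = \sum_(0 <= k < N) cross_term g P A w v k.
Proof.
case: N => [|N]; first by rewrite !big_geq.
by rewrite [RHS]big_ltn// cross_term0 add0r.
Qed.

Lemma cross_termE g P A w v k :
  cross_term g P A w v k = \sum_(tau < k) g ^+ k.+1 * bil (w k) (P *m A ^+ (k - tau)) (v tau).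
Proof.
rewrite /cross_term big_mkord bil_sumr mulr_sumr.
by apply: eq_bigr => tau _; rewrite bilM.
Qed.

End truncated.

(** Each of the first [k + 1] terms of the geometric series is at least [th ^+ k]. *)
Lemma mul_geom_le {R : realFieldType} (th : R) k : 0 <= th -> th < 1 ->
  k.+1%:R * th ^+ k <= (1 - th)^-1.
Proof.
move=> th0 th1; apply: le_trans (sum_geom_le k.+1 th0 th1).
rewrite mulr_natl -[X in _ *+ X]card_ord -sumr_const; apply: ler_sum => i _.
by apply: ler_wiXn2l; [|exact: ltW|rewrite -ltnS].
Qed.

(** * Discounted sums dominated by the accumulated noise energy *)

Section discounted.
Context {R : realType} {n : nat} (g th c : R) (x : 'cV[R]_n) (Mk : nat -> 'M[R]_n)
  (w : nat -> 'cV[R]_n).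
Hypotheses (th0 : 0 < th) (th1 : th < 1) (gE : g = th ^+ 4) (c0 : 0 <= c).
(** Applied to [P *m A ^+ k] for convergence and to [P *m A ^+ k - Pt *m At ^+ k] for the
    perturbation; the growth in [k] comes from telescoping a difference of powers. *)
Hypothesis hM : forall k, mxbound (c * k.+1%:R) (Mk k).

Definition energy k : R := 1 + vnorm2 (w k) ^+ 2.
Definition PhiN N : R := \sum_(k < N) th ^+ k * energy k.
Let U : R := (1 - th)^-1.

Let U1 : 1 <= U. Proof. by rewrite /U invf_ge1 ?subr_gt0// gerBl ltW. Qed.
Let thX k : 0 <= th ^+ k. Proof. by rewrite exprn_ge0// ltW. Qed.
Let thX1 k : th ^+ k <= 1. Proof. by rewrite exprn_ile1// ltW. Qed.

Lemma energy_ge1 k : 1 <= energy k.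
Proof. by rewrite /energy lerDl sqr_ge0. Qed.

Lemma energy_ge0 k : 0 <= energy k. Proof. exact: le_trans (energy_ge1 k). Qed.

Lemma vnorm2_le_energy k : vnorm2 (w k) <= energy k.
Proof. rewrite /energy; have := vnorm2_ge0 (w k); nra. Qed.

Lemma PhiN_ge0 N : 0 <= PhiN N.
Proof. by apply: sumr_ge0 => k _; rewrite mulr_ge0// energy_ge0. Qed.

Lemma PhiN_le k N : (k <= N)%N -> PhiN k <= PhiN N.
Proof.
move=> kN; rewrite /PhiN -!(big_mkord xpredT (fun k => th ^+ k * energy k)).
rewrite (big_cat_nat (leq0n k) kN)/= lerDl; apply: sumr_ge0 => i _.
by rewrite mulr_ge0// energy_ge0.
Qed.

Lemma PhiN_ge1 N : (0 < N)%N -> 1 <= PhiN N.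
Proof.
move=> N0; apply: le_trans (PhiN_le N0).
by rewrite /PhiN big_ord1 expr0 mul1r energy_ge1.
Qed.

(** Three copies of [th ^+ k] are what the cross terms consume: up to two absorb factors [k + 1],
    the others discount the energies. *)
Let gX k : g ^+ k.+1 <= th ^+ k * th ^+ k * th ^+ k.
Proof.
rewrite gE -exprM -!exprD; apply: ler_wiXn2l; [exact: ltW|exact: ltW|].
by rewrite mulnS -addnA addnC -!addnA; lia.
Qed.

Let g0 k : 0 <= g ^+ k. Proof. by rewrite gE -exprM. Qed.


Let gX1 k : g ^+ k.+1 <= th ^+ k.+1 * th ^+ k.
Proof.
by rewrite gE -exprM -!exprD; apply: ler_wiXn2l; [exact: ltW|exact: ltW|lia].
Qed.

Let term_le k (M : 'M[R]_n) d u v : mxbound (c * d) M -> 0 <= d ->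
  `|g ^+ k.+1 * bil u M v| <= c * (g ^+ k.+1 * d) * (vnorm2 u * vnorm2 v).
Proof.
move=> hMd d0; rewrite normrM (ger0_norm (g0 _)).
have -> : c * (g ^+ k.+1 * d) = g ^+ k.+1 * (c * d) by ring.
by rewrite -mulrA ler_wpM2l.
Qed.

Lemma lin_bound k : `|g ^+ k.+1 * bil (w k) (Mk k.+1) x| <=
  c * U * vnorm2 x * (th ^+ k * energy k).
Proof.
apply: le_trans (term_le _ _ _ (hM k.+1) (ler0n _ _)) _.
have -> : c * U * vnorm2 x * (th ^+ k * energy k) =
  c * (U * th ^+ k) * (energy k * vnorm2 x) by ring.
have h1 : g ^+ k.+1 * k.+2%:R <= U * th ^+ k.
  apply: (@le_trans _ _ (k.+2%:R * th ^+ k.+1 * th ^+ k)).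
    by rewrite mulrC -mulrA ler_wpM2l.
  by rewrite ler_wpM2r// mul_geom_le// ltW.
have h2 : vnorm2 (w k) * vnorm2 x <= energy k * vnorm2 x.
  by rewrite ler_wpM2r ?vnorm2_ge0 ?vnorm2_le_energy.
apply: ler_pM; rewrite ?mulr_ge0 ?vnorm2_ge0//.
by rewrite ler_wpM2l.
Qed.

Lemma diag_bound k : `|g ^+ k.+1 * bil (w k) (Mk 0) (w k)| <= c * (th ^+ k * energy k).
Proof.
apply: le_trans (term_le _ _ _ (hM 0) (ler0n _ _)) _.
rewrite -mulrA ler_wpM2l// mulr1 -expr2.
apply: ler_pM => //; first exact: sqr_ge0.
  apply: le_trans (gX1 k) _; rewrite ler_piMl//.
by rewrite /energy lerDr.
Qed.

(** The product of the two norms is at most the sum of the two energies. For [energy k] there are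
    [k] equal summands, so two factors of order [k] must be absorbed; for [energy tau] the needed
    discount [th ^+ tau] comes from [th ^+ k], as [tau < k]. *)
Lemma cross_bound k :
  `|\sum_(tau < k) g ^+ k.+1 * bil (w k) (Mk (k - tau)) (w tau)| <=
  c * U ^+ 2 * (th ^+ k * energy k) + c * U * th ^+ k * PhiN k.
Proof.
apply: le_trans (ler_norm_sum _ _ _) _.
have U0 : 0 <= U by exact: le_trans U1.
apply: (@le_trans _ _ (\sum_(tau < k) (c * (g ^+ k.+1 * k.+1%:R) * (energy k + energy tau)))).
  apply: ler_sum => tau _.
  apply: le_trans (term_le _ _ _ (hM (k - tau)) (ler0n _ _)) _.
  rewrite -!mulrA ler_wpM2l// ler_wpM2l// ler_pM ?mulr_ge0 ?vnorm2_ge0//.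
    by rewrite ler_nat ltnS leq_subr.
  rewrite /energy; have := sqr_ge0 (vnorm2 (w k) - vnorm2 (w tau)).
  have := sqr_ge0 (vnorm2 (w k)); have := sqr_ge0 (vnorm2 (w tau)).
  rewrite sqrrB => *; nra.
set G := g ^+ k.+1 * k.+1%:R.
have a1 : G * k%:R <= U ^+ 2 * th ^+ k.
  apply: (@le_trans _ _ (k.+1%:R * th ^+ k * (k.+1%:R * th ^+ k) * th ^+ k)).
    apply: (@le_trans _ _ (g ^+ k.+1 * (k.+1%:R * k.+1%:R))).
      by rewrite /G -mulrA ler_wpM2l// ler_wpM2l// ler_nat.
    have -> : k.+1%:R * th ^+ k * (k.+1%:R * th ^+ k) * th ^+ k =
      th ^+ k * th ^+ k * th ^+ k * (k.+1%:R * k.+1%:R) by ring.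
    by rewrite ler_wpM2r.
  by rewrite ler_wpM2r// expr2 ler_pM ?mulr_ge0 ?mul_geom_le ?(ltW th0).
have a2 (tau : 'I_k) : G <= U * th ^+ k * th ^+ tau.
  apply: (@le_trans _ _ (k.+1%:R * th ^+ k * th ^+ k * th ^+ k)).
    have -> : k.+1%:R * th ^+ k * th ^+ k * th ^+ k =
      th ^+ k * th ^+ k * th ^+ k * k.+1%:R by ring.
    by rewrite ler_wpM2r.
  apply: ler_pM; rewrite ?mulr_ge0//.
    by rewrite ler_wpM2r// mul_geom_le// ltW.
  by apply: ler_wiXn2l; [exact: ltW|exact: ltW|exact: ltnW].
under eq_bigr do rewrite mulrDr.
rewrite big_split/= sumr_const card_ord; apply: lerD.
  rewrite -[leLHS]mulr_natr.
  have -> : c * G * energy k * k%:R = c * (G * k%:R) * energy k by ring.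
  have -> : c * U ^+ 2 * (th ^+ k * energy k) = c * (U ^+ 2 * th ^+ k) * energy k by ring.
  by rewrite ler_wpM2r ?energy_ge0// ler_wpM2l.
rewrite /PhiN mulr_sumr; apply: ler_sum => tau _.
have -> : c * U * th ^+ k * (th ^+ tau * energy tau) =
  c * (U * th ^+ k * th ^+ tau) * energy tau by ring.
by rewrite ler_wpM2r ?energy_ge0// ler_wpM2l.
Qed.

Lemma sum_lin_bound N :
  \sum_(0 <= k < N) `|g ^+ k.+1 * bil (w k) (Mk k.+1) x| <= c * U * vnorm2 x * PhiN N.
Proof.
rewrite big_mkord /PhiN mulr_sumr; apply: ler_sum => k _; exact: lin_bound.
Qed.

Lemma sum_diag_bound N :
  \sum_(0 <= k < N) `|g ^+ k.+1 * bil (w k) (Mk 0) (w k)| <= c * PhiN N.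
Proof.
rewrite big_mkord /PhiN mulr_sumr; apply: ler_sum => k _; exact: diag_bound.
Qed.

Lemma sum_cross_bound N :
  \sum_(0 <= k < N) `|\sum_(tau < k) g ^+ k.+1 * bil (w k) (Mk (k - tau)) (w tau)| <=
  2 * c * U ^+ 2 * PhiN N.
Proof.
have U0 : 0 <= U by exact: le_trans U1.
apply: (@le_trans _ _ (\sum_(k < N) (c * U ^+ 2 * (th ^+ k * energy k) +
   c * U * PhiN N * th ^+ k))).
  rewrite big_mkord; apply: ler_sum => k _; apply: le_trans (cross_bound k) _.
  rewrite lerD2l mulrAC ler_wpM2r// ler_wpM2l ?mulr_ge0//.
  by apply: PhiN_le; exact: ltnW.
rewrite big_split/= -!mulr_sumr -/(PhiN N).
have -> : 2 * c * U ^+ 2 * PhiN N = c * U ^+ 2 * PhiN N + c * U * PhiN N * U by ring.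
rewrite lerD2l ler_wpM2l ?mulr_ge0 ?PhiN_ge0//.
by apply: sum_geom_le => //; exact: ltW.
Qed.

End discounted.

(** * Perturbation and positivity for the Lyapunov equation *)

Section closed_loop.
Context {R : realType} {n : nat}.
Implicit Types (P A : 'M[R]_n) (x : 'cV[R]_n) (w : nat -> 'cV[R]_n).

Lemma GN_diff_le (g th c : R) P A Pt At x w N : 0 < th -> th < 1 -> g = th ^+ 4 ->
  0 <= c -> (0 < N)%N ->
  (forall k, mxbound (c * k.+1%:R) (P *m A ^+ k - Pt *m At ^+ k)) ->
  `|GN g P A x w N - GN g Pt At x w N| <=
  c * (vnorm2 x ^+ 2 + 2 * (1 - th)^-1 * vnorm2 x + 1 + 4 * (1 - th)^-1 ^+ 2)
    * PhiN th w N.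
Proof.
move=> th0 th1 gE c0 N0 hM; set U := (1 - th)^-1.
pose Mk k := P *m A ^+ k - Pt *m At ^+ k.
have Ph1 := PhiN_ge1 w th0 N0.
rewrite /GN !sum_cross_term.
set a1 := bil x P x; set a2 := bil x Pt x.
set b1 := \sum_(_ <= _ < _) lin_term _ P _ _ _ _.
set b2 := \sum_(_ <= _ < _) lin_term _ Pt _ _ _ _.
set d1 := \sum_(_ <= _ < _) diag_term _ P _ _ _.
set d2 := \sum_(_ <= _ < _) diag_term _ Pt _ _ _.
set e1 := \sum_(_ <= _ < _) cross_term _ P _ _ _ _.
set e2 := \sum_(_ <= _ < _) cross_term _ Pt _ _ _ _.
have ha : `|a1 - a2| <= c * vnorm2 x ^+ 2.
  have := hM 0 x x; rewrite !expr0 bilBm !bilM !mul1mx mulr1 -expr2; exact.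
have hb : `|b1 - b2| <= c * U * vnorm2 x * PhiN th w N.
  rewrite -sumrB; apply: le_trans (ler_norm_sum _ _ _) _.
  apply: le_trans (sum_lin_bound x w th0 th1 gE c0 hM N).
  rewrite le_eqVlt; apply/orP; left; apply/eqP; apply: eq_bigr => k _.
  by rewrite bilBm !bilM mulrBr.
have hd : `|d1 - d2| <= c * PhiN th w N.
  rewrite -sumrB; apply: le_trans (ler_norm_sum _ _ _) _.
  apply: le_trans (sum_diag_bound w th0 th1 gE c0 hM N).
  rewrite le_eqVlt; apply/orP; left; apply/eqP; apply: eq_bigr => k _.
  by rewrite bilBm !bilM !expr0 !mul1mx mulrBr.
have he : `|e1 - e2| <= 2 * c * U ^+ 2 * PhiN th w N.
  rewrite -sumrB; apply: le_trans (ler_norm_sum _ _ _) _.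
  apply: le_trans (sum_cross_bound w th0 th1 gE c0 hM N).
  rewrite le_eqVlt; apply/orP; left; apply/eqP; apply: eq_bigr => k _.
  rewrite !cross_termE -sumrB; congr (`|_|); apply: eq_bigr => tau _.
  by rewrite bilBm mulrBr.
have -> : a1 + 2 * b1 + d1 + 2 * e1 - (a2 + 2 * b2 + d2 + 2 * e2) =
  (a1 - a2) + 2 * (b1 - b2) + (d1 - d2) + 2 * (e1 - e2) by ring.
(* The noise-free term is absorbed into [PhiN], which is at least 1 for [0 < N]. *)
have ha' : c * vnorm2 x ^+ 2 <= c * vnorm2 x ^+ 2 * PhiN th w N.
  by rewrite ler_peMr// mulr_ge0// sqr_ge0.
have tri (u1 u2 u3 u4 : R) : `|u1 + u2 + u3 + u4| <= `|u1| + `|u2| + `|u3| + `|u4|.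
  do 2 (apply: le_trans (ler_normD _ _) _; rewrite lerD2r).
  exact: ler_normD.
apply: le_trans (tri _ _ _ _) _.
rewrite !normrM !(ger0_norm (ler0n R 2)).
have -> : c * (vnorm2 x ^+ 2 + 2 * U * vnorm2 x + 1 + 4 * U ^+ 2) * PhiN th w N =
  c * vnorm2 x ^+ 2 * PhiN th w N + 2 * (c * U * vnorm2 x * PhiN th w N) +
  c * PhiN th w N + 2 * (2 * c * U ^+ 2 * PhiN th w N) by ring.
by rewrite !lerD// ?ler_pM2l// (le_trans ha).
Qed.

Lemma mxbound_powB (d : R) A At k : 0 <= d -> mxbound 1 A -> mxbound 1 At ->
  mxbound d (A - At) -> mxbound (d * k%:R) (A ^+ k - At ^+ k).
Proof.
move=> d0 hA hAt hd; elim: k => [|k IH].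
  by rewrite !expr0 subrr => u v; rewrite /bil mulmx0 mul0mx mxE normr0 mulr0 mul0r.
have -> : A ^+ k.+1 - At ^+ k.+1 = (A - At) *m A ^+ k + At *m (A ^+ k - At ^+ k).
  by rewrite !exprS mulmxBl mulmxBr addrA subrK.
rewrite -natr1 mulrDr mulr1 addrC; apply: mxboundD.
  by rewrite -[d]mulr1; apply: mxboundM => //; exact: mxboundX.
by rewrite -[_ * _]mul1r; apply: mxboundM => //; rewrite mulr_ge0.
Qed.

(** [P - Pt] solves the Lyapunov equation of [A] with source
    [g *: (A^T *m Pt *m A - At^T *m Pt *m At)], which is of order [d]. The difference of powers is
    telescoped by [mxbound_powB]. *)
Lemma lyapunov_diff (g q d : R) (Y A At P Pt : 'M[R]_n) : 0 < g < 1 -> 0 <= d -> 0 <= q ->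
  mxbound q Y -> mxbound 1 A -> mxbound 1 At -> mxbound d (A - At) ->
  P = Y + g *: (A^T *m P *m A) -> Pt = Y + g *: (At^T *m Pt *m At) ->
  forall k, mxbound (d * (2 * (q / (1 - g)) / (1 - g) + q / (1 - g)) * k.+1%:R)
    (P *m A ^+ k - Pt *m At ^+ k).
Proof.
move=> /andP[g0 g1] d0 q0 hY hA hAt hd PE PtE k.
have g01 : 0 <= g < 1 by rewrite ltW.
have S0 : 0 <= q / (1 - g) by rewrite divr_ge0// subr_ge0 ltW.
set S := q / (1 - g) in S0 *.
have hPt : mxbound S Pt by exact: lyapunov_mxbound hAt hY PtE.
clearbody S.
have hD : mxbound (2 * S * d / (1 - g)) (P - Pt).
  apply: (@lyapunov_mxbound R n g _ A _ (g *: (A^T *m Pt *m A - At^T *m Pt *m At))) => //.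
  - by rewrite !mulr_ge0.
  - apply: (@mxboundW _ _ (g * (2 * S * d))) => [|u v].
      by rewrite ler_piMl ?(ltW g1)// !mulr_ge0.
    rewrite bilZm normrM (gtr0_norm g0) -mulrA ler_pM2l// bilBm -!mulmxA !bilTM !bilM.
    have -> : bil (A *m u) Pt (A *m v) - bil (At *m u) Pt (At *m v) =
        bil (A *m u) Pt ((A - At) *m v) + bil ((A - At) *m u) Pt (At *m v).
      by rewrite !mulmxBl bilBr bilBl; ring.
    have nA y : vnorm2 (A *m y) <= vnorm2 y.
      by have /mxboundP := hA => /(_ ler01 y); rewrite mul1r.
    have nAt y : vnorm2 (At *m y) <= vnorm2 y.
      by have /mxboundP := hAt => /(_ ler01 y); rewrite mul1r.
    have nd y : vnorm2 ((A - At) *m y) <= d * vnorm2 y.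
      by have /mxboundP := hd; exact.
    have -> : 2 * S * d * (vnorm2 u * vnorm2 v) =
       S * (vnorm2 u * (d * vnorm2 v)) + S * ((d * vnorm2 u) * vnorm2 v) by ring.
    apply: le_trans (ler_normD _ _) _; apply: lerD.
      by apply: le_trans (hPt _ _) _; rewrite ler_wpM2l// ler_pM ?vnorm2_ge0.
    by apply: le_trans (hPt _ _) _; rewrite ler_wpM2l// ler_pM ?vnorm2_ge0.
  rewrite [in LHS]PE [in LHS]PtE opprD addrACA subrr add0r -scalerBr -scalerDr.
  congr (_ *: _); by rewrite mulmxBr mulmxBl [RHS]addrC subrKA.
have -> : P *m A ^+ k - Pt *m At ^+ k = (P - Pt) *m A ^+ k + Pt *m (A ^+ k - At ^+ k).
  by rewrite mulmxBl mulmxBr addrA subrK.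
apply: (@mxboundW _ _ (2 * S * d / (1 - g) * 1 + S * (d * k%:R))); last first.
  apply: mxboundD.
    by apply: mxboundM => //; [rewrite divr_ge0 ?subr_ge0 ?(ltW g1)// !mulr_ge0|exact: mxboundX].
  by apply: mxboundM => //; [rewrite mulr_ge0|exact: mxbound_powB].
rewrite -(natr1 k).
have h1 : 0 <= d * (2 * S / (1 - g)) * k%:R.
  by rewrite !mulr_ge0// invr_ge0 subr_ge0 ltW.
have h2 : 0 <= d * S by rewrite mulr_ge0.
have -> : d * (2 * S / (1 - g) + S) * (k%:R + 1) =
  2 * S * d / (1 - g) * 1 + S * (d * k%:R) + (d * (2 * S / (1 - g)) * k%:R + d * S) by ring.
by rewrite lerDl addr_ge0.
Qed.

(** The difference of two solutions solves the equation with source 0, and [lyapunov_mxbound] gives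
    it norm 0. *)
Lemma lyapunov_unique (g : R) (Y A P P' : 'M[R]_n) : 0 <= g < 1 -> mxbound 1 A ->
  P = Y + g *: (A^T *m P *m A) -> P' = Y + g *: (A^T *m P' *m A) -> P = P'.
Proof.
move=> g01 hA PE PE'; apply/eqP; rewrite -subr_eq0; apply/eqP; apply: mxbound0_eq0.
rewrite -[0](mul0r (1 - g)^-1); apply: (@lyapunov_mxbound R n g 0 A _ 0) => //.
  by move=> u v; rewrite /bil mulmx0 mul0mx mxE normr0 mul0r.
rewrite [in LHS]PE [in LHS]PE' opprD addrACA subrr -scalerBr.
by rewrite mulmxBr mulmxBl.
Qed.

Lemma lyapunov_sym (g : R) (Y A P : 'M[R]_n) : 0 <= g < 1 -> mxbound 1 A ->
  Y^T = Y -> P = Y + g *: (A^T *m P *m A) -> P^T = P.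
Proof.
move=> g01 hA YT PE; apply: (lyapunov_unique g01 hA _ PE).
by rewrite {1}PE linearD/= linearZ/= !trmx_mul trmxK YT mulmxA.
Qed.

(** It suffices that [P] is nonnegative. Iterating the equation [k] times and dropping the
    nonnegative source terms bounds [bil v P v] below by [- g ^+ k] times a constant. *)
Lemma lyapunov_ge (g : R) (Y A P : 'M[R]_n) : 0 < g < 1 -> mxbound 1 A ->
  (forall v, 0 <= bil v Y v) -> P = Y + g *: (A^T *m P *m A) ->
  forall v, bil v Y v <= bil v P v.
Proof.
move=> /andP[g0 g1] hA Y0 PE.
have step v : bil v P v = bil v Y v + g * bil (A *m v) P (A *m v).
  by rewrite {1}PE bilDm bilZm -mulmxA bilTM bilM.
suff P0 v : 0 <= bil v P v.
  by move=> v; rewrite step lerDl mulr_ge0// ltW.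
have iter k : - (g ^+ k * (specnorm P * (vnorm2 v * vnorm2 v))) <= bil v P v.
  have nA y : vnorm2 (A *m y) <= vnorm2 y.
    by have /mxboundP := hA => /(_ ler01 y); rewrite mul1r.
  elim: k v => [|k IH] v.
    rewrite expr0 mul1r lerNl.
    by have := mxbound_specnorm P v v; rewrite ler_norml lerNl => /andP[].
  rewrite step exprS; apply: (@le_trans _ _ (g * bil (A *m v) P (A *m v))); last first.
    by rewrite lerDr.
  rewrite -mulrA -mulrN ler_pM2l//; apply: le_trans (IH (A *m v)).
  rewrite lerN2 ler_wpM2l ?exprn_ge0 ?(ltW g0)// ler_wpM2l ?specnorm_ge0//.
  by rewrite ler_pM ?vnorm2_ge0.
rewrite leNgt; apply/negP => Pv.
set C := specnorm P * (vnorm2 v * vnorm2 v) in iter.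
have C0 : 0 <= C by rewrite !mulr_ge0 ?specnorm_ge0 ?vnorm2_ge0.
(* By [mul_geom_le], [g ^+ k] is at most of order [1 / k], so the Archimedean property refutes a
   negative value. *)
have [k kP] : exists k : nat, C * (1 - g)^-1 / (- bil v P v) < k%:R.
  exists (Num.bound (C * (1 - g)^-1 / (- bil v P v))); apply: archi_boundP; apply: divr_ge0; last by rewrite oppr_ge0 ltW.
  by apply: divr_ge0 => //; rewrite subr_ge0 ltW.
move: kP; rewrite ltr_pdivrMr ?oppr_gt0// => kP.
have h1 : C * (k.+1%:R * g ^+ k) <= C * (1 - g)^-1.
  by rewrite ler_wpM2l// mul_geom_le// ltW.
have h2 := iter k.
have h3 : k.+1%:R * (- bil v P v) <= k.+1%:R * (g ^+ k * C).
  by rewrite ler_wpM2l// lerNl.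
have h4 : k%:R * - bil v P v <= k.+1%:R * - bil v P v.
  by rewrite ler_wpM2r ?oppr_ge0 ?(ltW Pv)// ler_nat.
have : k.+1%:R * (g ^+ k * C) = C * (k.+1%:R * g ^+ k) by ring.
by lra.
Qed.

(** Definiteness of the planar form of two consecutive noises. Cauchy-Schwarz for [P], read off at
    the vector [p *: (A *m e) - c *: e], gives [c ^+ 2 <= p * r], and the Lyapunov equation at [e]
    gives [g * r < p]. *)
Lemma lyapunov_pair_det (g : R) (Y A P : 'M[R]_n) (e : 'cV[R]_n) : 0 < g < 1 -> mxbound 1 A ->
  Y^T = Y -> (forall v, v != 0 -> 0 < bil v Y v) -> P = Y + g *: (A^T *m P *m A) ->
  e != 0 -> 0 < bil e P e /\ g * bil e P (A *m e) ^+ 2 < bil e P e ^+ 2.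
Proof.
move=> g01 hA YT Y0 PE e0; have /andP[g0 g1] := g01.
have Y0' v : 0 <= bil v Y v.
  by have [->|/Y0/ltW//] := eqVneq v 0; rewrite bil0l.
have PY := lyapunov_ge g01 hA Y0' PE.
have p0 : 0 < bil e P e by exact: lt_le_trans (Y0 _ e0) (PY _).
split => //.
have PT : P^T = P by apply: (@lyapunov_sym g Y A) => //; rewrite ltW.
set p := bil e P e in p0 *; set c := bil e P (A *m e); set r := bil (A *m e) P (A *m e).
have pE : p = bil e Y e + g * r.
  by rewrite /p {1}PE bilDm bilZm -mulmxA bilTM bilM.
have cs : c ^+ 2 <= p * r.
  have := le_trans (Y0' _) (PY (p *: (A *m e) - c *: e)).
  rewrite !bilBl !bilBr !bilZl !bilZr -/p -/r -/c.
  have -> : bil (A *m e) P e = c by rewrite -bilT PT.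
  have -> : p * (p * r) - p * (c * c) - (c * (p * c) - c * (c * p)) = p * (p * r - c ^+ 2).
    by ring.
  by rewrite pmulr_rge0// subr_ge0.
have Ye := Y0 _ e0.
apply: (@le_lt_trans _ _ (p * (g * r))).
  have -> : p * (g * r) = g * (p * r) by ring.
  by rewrite ler_pM2l.
by rewrite expr2 ltr_pM2l// [ltRHS]pE ltrDr.
Qed.

End closed_loop.

Section convergence.
Context {R : realType}.

Lemma bounded_series_cvg (f : nat -> R) H : (forall N, \sum_(0 <= k < N) `|f k| <= H) ->
  cvgn (fun N => \sum_(0 <= k < N) f k).
Proof.
move=> fH; apply: (@normed_cvg R R^o f).
apply: nondecreasing_is_cvgn; first by apply: nondecreasing_series => k _ _; exact: normr_ge0.
by exists H => _ [N _ <-]; exact: fH.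
Qed.

(** A bound on [PhiN] makes the three series absolutely convergent, so the [limn] in [Gseries] are
    true limits at this outcome. *)
Lemma GN_cvg n (g th c lam : R) (P A : 'M[R]_n) x d (T : measurableType d)
    (w : nat -> T -> n.-tuple R) om :
  0 < th -> th < 1 -> g = th ^+ 4 -> 0 <= c ->
  (forall k, mxbound (c * k.+1%:R) (P *m A ^+ k)) ->
  (forall N, PhiN th (fun k => tcol (w k om)) N <= lam) ->
  GN g P A x (fun k => tcol (w k om)) N @[N --> \oo] --> Gseries g P A w x om.
Proof.
move=> th0 th1 gE c0 hM Phl; set W := fun k => tcol (w k om).
have U0 : 0 <= (1 - th)^-1 by rewrite invr_ge0 subr_ge0 ltW.
have c1 : cvgn (fun N => \sum_(0 <= k < N) lin_term g P A x W k).
  apply: (@bounded_series_cvg _ (c * (1 - th)^-1 * vnorm2 x * lam)) => N.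
  apply: le_trans (ler_wpM2l _ (Phl N)); last by rewrite !mulr_ge0 ?vnorm2_ge0.
  apply: le_trans (sum_lin_bound x W th0 th1 gE c0 hM N).
  rewrite le_eqVlt; apply/orP; left; apply/eqP; apply: eq_bigr => k _.
  by rewrite bilM.
have c2 : cvgn (fun N => \sum_(0 <= k < N) diag_term g P W W k).
  apply: (@bounded_series_cvg _ (c * lam)) => N.
  apply: le_trans (ler_wpM2l _ (Phl N)) => //.
  apply: le_trans (sum_diag_bound W th0 th1 gE c0 hM N).
  rewrite le_eqVlt; apply/orP; left; apply/eqP; apply: eq_bigr => k _.
  by rewrite bilM expr0 mul1mx.
have c3 : cvgn (fun N => \sum_(1 <= k < N) cross_term g P A W W k).
  under eq_fun do rewrite sum_cross_term.
  apply: (@bounded_series_cvg _ (2 * c * (1 - th)^-1 ^+ 2 * lam)) => N.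
  apply: le_trans (ler_wpM2l _ (Phl N)); last by rewrite !mulr_ge0 ?exprn_ge0.
  apply: le_trans (sum_cross_bound W th0 th1 gE c0 hM N).
  rewrite le_eqVlt; apply/orP; left; apply/eqP; apply: eq_bigr => k _.
  by rewrite cross_termE.
rewrite /Gseries /GN; apply: cvgD; [apply: cvgD; [apply: cvgD|]|].
- exact: cvg_cst.
- by apply: cvgM; [exact: cvg_cst|exact: c1].
- exact: c2.
- by apply: cvgM; [exact: cvg_cst|exact: c3].
Qed.

End convergence.

(** * Measure-theoretic tools *)

Section measure_lemmas.
Context {R : realType}.

(** Meant for the inner integrals of [box_int], whose measurability is not at hand; monotonicity is
    therefore taken from the definition of the integral as a supremum over simple functions. *)
Lemma Rintegral_itv_le (a b C : R) (h : R -> R) : a <= b -> 0 <= C ->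
  (forall t, 0 <= h t <= C) ->
  0 <= Rintegral lebesgue_measure `[a, b] h <= C * (b - a).
Proof.
move=> ab C0 hC; rewrite Rintegral_ge0/=; last by move=> t _; case/andP: (hC t).
have mab : measurable (`[a, b]%classic : set R) by exact: measurable_itv.
have le : (\int[lebesgue_measure]_(x in `[a, b]) (h x)%:E <= (C * (b - a))%:E)%E.
  apply: (@le_trans _ _ (\int[lebesgue_measure]_(x in `[a, b]) C%:E)%E); last first.
    rewrite integral_cst//=. rewrite lebesgue_measure_itv/= lte_fin.
    case: ltP => ba; first by rewrite -EFinB -EFinM.
    by rewrite mule0 lee_fin mulr_ge0// subr_ge0.
  have h0 t : `[a, b]%classic t -> (0 <= (h t)%:E)%E.
    by move=> _; rewrite lee_fin; case/andP: (hC t).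
  have C0' t : `[a, b]%classic t -> (0 <= (cst C%:E : R -> \bar R) t)%E.
    by move=> _; rewrite lee_fin.
  rewrite ge0_integralE; last exact: h0.
  rewrite [X in (_ <= X)%E]ge0_integralE; last exact: C0'.
  apply: ub_ereal_sup => _ [g hg <-]; apply: ereal_sup_ubound.
  exists g => // t; apply: le_trans (hg t) _.
  rewrite /patch; case: ifP => // _; rewrite lee_fin; by case/andP: (hC t).
rewrite /Rintegral -lee_fin fineK// ge0_fin_numE; last first.
  by apply: integral_ge0 => t _; rewrite lee_fin; case/andP: (hC t).
exact: le_lt_trans le (ltry _).
Qed.

Lemma box_int_le (a b : nat -> R) k (f : (nat -> R) -> R) M : 0 <= M ->
  (forall j, a j <= b j) -> (forall y, 0 <= f y <= M) ->
  forall y, 0 <= box_int a b k f y <= M * \prod_(j < k) (b j - a j).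
Proof.
move=> M0 ab fM; elim: k => [|k IH] y /=.
  by rewrite big_ord0 mulr1.
rewrite big_ord_recr/= mulrA; apply: Rintegral_itv_le => //.
by rewrite mulr_ge0// prodr_ge0// => j _; rewrite subr_ge0.
Qed.

Lemma pdf_box_le d (T : measurableType d) (P : probability T R) n
    (X : T -> n.-tuple R) f M (a b : nat -> R) :
  is_pdf P X f -> (forall v, f v <= M) -> (forall j, a j <= b j) ->
  (P (X @^-1` @box R n a b) <= (M * \prod_(j < n) (b j - a j))%:E)%E.
Proof.
move=> [mf [f0 fP]] fM ab; rewrite fP// lee_fin.
have M0 : 0 <= M by apply: le_trans (f0 [tuple 0 | i < n]) (fM _).
have /(_ (fun y => f [tuple y (val i) | i < n])) := box_int_le n M0 ab.
by move=> /(_ _ (fun _ => 0)) /andP[] // y; rewrite f0 fM.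
Qed.

(** Fatou's lemma for sets: [A] lies in the union of the tail intersections [C q], which increase
    with [q] and satisfy [C q] inside [B q]. *)
Lemma measure_liminf_le d (T : measurableType d) (P : probability T R)
    (A : set T) (B : nat -> set T) (c : \bar R) :
  measurable A -> (forall q, measurable (B q)) ->
  (forall om, A om -> \forall q \near \oo, B q om) ->
  (\forall q \near \oo, (P (B q) <= c)%E) -> (P A <= c)%E.
Proof.
move=> mA mB AB Bc.
pose C q := \bigcap_(k in [set k | (q <= k)%N]) B k.
have mC q : measurable (C q) by apply: bigcap_measurable => //; exists q => /=.
have mUC : measurable (\bigcup_q C q) by exact: bigcupT_measurable.
have AC : A `<=` \bigcup_q C q.
  by move=> om /AB[q _ hq]; exists q => // k /= qk; exact: hq.
apply: (@le_trans _ _ (P (\bigcup_q C q))); first by rewrite le_measure ?inE.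
have Cc : P \o C @ \oo --> P (\bigcup_q C q).
  apply: nondecreasing_cvg_mu => // q q' qq'; apply/subsetPset => om Co k /= q'k.
  by apply: Co => /=; exact: leq_trans q'k.
rewrite -(cvg_lim _ Cc)//; apply: lime_le; first by apply/cvg_ex; eexists; exact: Cc.
near=> q; apply: (@le_trans _ _ (P (B q))); last by near: q.
by rewrite le_measure ?inE// => om; apply => /=.
Unshelve. all: by end_near.
Qed.

Lemma integral_sum_indic d (T : measurableType d) (P : probability T R)
    (I : finType) (A : I -> set T) (c : I -> R) : (forall i, measurable (A i)) ->
  (forall i, 0 <= c i) ->
  (\int[P]_om (\sum_i c i * \1_(A i) om)%:E = (\sum_i c i * fine (P (A i)))%:E)%E.
Proof.
move=> mA c0.
under eq_integral do rewrite -sumEFin.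
rewrite ge0_integral_sum//=; last 2 first.
- by move=> i; apply/measurable_EFinP; apply: measurable_funM => //; exact: measurable_indic.
- by move=> i om _; rewrite lee_fin mulr_ge0.
rewrite -sumEFin; apply: eq_bigr => i _.
under eq_integral do rewrite EFinM.
rewrite ge0_integralZl//; last 2 first.
- by apply/measurable_EFinP; exact: measurable_indic.
- by rewrite lee_fin.
by rewrite integral_indic// setIT EFinM fineK// fin_num_measure.
Qed.

(** At each outcome at most one summand is present, and [phi] dominates it. For grid cells this
    bounds total mass and second moment; for a single set it is Markov's inequality. *)
Lemma sum_disjoint_le d (T : measurableType d) (P : probability T R)
    (I : finType) (A : I -> set T) (c : I -> R) (phi : T -> R) (B : R) :
  (forall i, measurable (A i)) -> (forall i, 0 <= c i) ->
  measurable_fun setT phi -> (forall om, 0 <= phi om) ->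
  (\int[P]_om (phi om)%:E <= B%:E)%E ->
  (forall i j om, A i om -> A j om -> i = j) ->
  (forall i om, A i om -> c i <= phi om) ->
  \sum_i c i * fine (P (A i)) <= B.
Proof.
move=> mA c0 mphi phi0 phiB disj cphi.
rewrite -lee_fin -integral_sum_indic//; apply: le_trans phiB.
apply: ge0_le_integral => //.
- by move=> om _; rewrite lee_fin sumr_ge0// => i _; rewrite mulr_ge0.
- apply/measurable_EFinP; apply: measurable_sum => i.
  by apply: measurable_funM => //; exact: measurable_indic.
- exact/measurable_EFinP.
move=> om _; rewrite lee_fin.
have [[i Ai]|nA] := pselect (exists i, A i om); last first.
  rewrite big1// => i _; rewrite indicE memNset ?mulr0// => Ai; apply: nA; by exists i.
rewrite (bigD1 i)//= big1 ?addr0.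
  by rewrite indicE mem_set// mulr1; exact: cphi.
move=> j ji; rewrite indicE memNset ?mulr0// => Aj.
by move: ji; rewrite (disj _ _ _ Ai Aj) eqxx.
Qed.

Lemma measure_cover_le d (T : measurableType d) (P : probability T R)
    (I : finType) (E : pred I) (A : set T) (C : I -> set T) :
  measurable A -> (forall i, measurable (C i)) ->
  (forall om, A om -> exists2 i, E i & C i om) ->
  (P A <= (\sum_(i | E i) fine (P (C i)))%:E)%E.
Proof.
move=> mA mC AC.
have -> : \sum_(i | E i) fine (P (C i)) = \sum_i (E i)%:R * fine (P (C i)).
  by rewrite big_mkcond/=; apply: eq_bigr => i _; case: (E i); rewrite ?mul1r ?mul0r.
rewrite -integral_sum_indic// -[A]setIT -integral_indic//.
apply: ge0_le_integral => //.
- by apply/measurable_EFinP; exact: measurable_indic.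
- apply/measurable_EFinP; apply: measurable_sum => i.
  by apply: measurable_funM => //; exact: measurable_indic.
move=> om _; rewrite lee_fin.
have S0 (Q : pred I) : 0 <= \sum_(i | Q i) (E i)%:R * \1_(C i) om :> R.
  by apply: sumr_ge0 => i _; rewrite mulr_ge0.
rewrite indicE; case: (boolP (om \in A)) => [|_]; last exact: S0.
rewrite inE => /AC[i Ei Ci]; rewrite (bigD1 i)//= Ei indicE mem_set// mulr1.
by rewrite lerDl; exact: S0.
Qed.

End measure_lemmas.

Section measurability.
Context {R : realType} {n : nat} {d : measure_display} {T : measurableType d}
  (w : nat -> T -> n.-tuple R).
Hypothesis mw : forall k, measurable_fun setT (w k).

Lemma measurable_coord k i : measurable_fun setT (fun om => tcol (w k om) i 0).
Proof.
have := (measurable_fun_tnthP (w k)).1 (mw k) i.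
by congr measurable_fun; apply/funext => om; rewrite mxE.
Qed.

Lemma measurable_bil k l (P : 'M[R]_n) :
  measurable_fun setT (fun om => bil (tcol (w k om)) P (tcol (w l om))).
Proof.
under eq_fun do rewrite bilE.
apply: measurable_sum => i; apply: measurable_funM; first exact: measurable_coord.
under eq_fun do rewrite mxE.
by apply: measurable_sum => j; apply: measurable_funM => //; exact: measurable_coord.
Qed.

Lemma measurable_bill k (P : 'M[R]_n) y :
  measurable_fun setT (fun om => bil (tcol (w k om)) P y).
Proof.
under eq_fun do rewrite bilE.
by apply: measurable_sum => i; apply: measurable_funM => //; exact: measurable_coord.
Qed.

Lemma measurable_vnorm2 k : measurable_fun setT (fun om => vnorm2 (tcol (w k om)) ^+ 2).
Proof.
under eq_fun do rewrite sqr_vnorm2.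
by apply: measurable_sum => i; apply: measurable_funX; exact: measurable_coord.
Qed.

Lemma measurable_PhiN th N : measurable_fun setT (fun om => PhiN th (fun k => tcol (w k om)) N).
Proof.
apply: measurable_sum => k; apply: measurable_funM => //.
by apply: measurable_funD => //; exact: measurable_vnorm2.
Qed.

Lemma measurable_lin_sum g P A x N : measurable_fun setT
  (fun om => \sum_(0 <= k < N) lin_term g P A x (fun k => tcol (w k om)) k).
Proof.
by apply: measurable_sum => k; apply: measurable_funM => //; exact: measurable_bill.
Qed.

Lemma measurable_diag_sum g P N : measurable_fun setT
  (fun om => \sum_(0 <= k < N)
     diag_term g P (fun k => tcol (w k om)) (fun k => tcol (w k om)) k).
Proof.
by apply: measurable_sum => k; apply: measurable_funM => //; exact: measurable_bil.
Qed.

Lemma measurable_cross_sum g P A N : measurable_fun setT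
  (fun om => \sum_(1 <= k < N)
     cross_term g P A (fun k => tcol (w k om)) (fun k => tcol (w k om)) k).
Proof.
apply: measurable_sum => k; under eq_fun do rewrite cross_termE.
apply: measurable_sum => tau.
by apply: measurable_funM => //; exact: measurable_bil.
Qed.

Lemma measurable_GN g P A x N :
  measurable_fun setT (fun om => GN g P A x (fun k => tcol (w k om)) N).
Proof.
apply: measurable_funD; [apply: measurable_funD; [apply: measurable_funD => //|]|].
- by apply: measurable_funM => //; exact: measurable_lin_sum.
- exact: measurable_diag_sum.
- by apply: measurable_funM => //; exact: measurable_cross_sum.
Qed.

End measurability.

(** The set [C] of convergence is measurable by the Cauchy criterion. Multiplied by its indicator,
    the sequence converges everywhere; off [C], [limn] is the default [point], restored by a
    separate term. *)
Lemma measurable_limn {R : realType} d (T : measurableType d) (u : nat -> T -> R) :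
  (forall N, measurable_fun setT (u N)) -> measurable_fun setT (fun om => limn (u^~ om)).
Proof.
move=> mu.
pose C := [set om | cvgn (u^~ om)].
have CE : C = \bigcap_k \bigcup_N \bigcap_m [set om | `|u (N + m)%N om - u N om| <= k.+1%:R^-1].
  apply/seteqP; split => [om /= cu k _|om /= hu].
    have /cvg_ex[l ul] := cu.
    have /cvgrPdist_lt/(_ (k.+1%:R^-1 / 2)) := ul.
    have k0 : 0 < k.+1%:R^-1 / 2 :> R by rewrite divr_gt0// invr_gt0.
    move=> /(_ k0)[N _ hN]; exists N => // m _ /=.
    have h1 := hN N (leqnn N); have h2 := hN (N + m)%N (leq_addr m N).
    rewrite /= in h1 h2.
    have -> : u (N + m)%N om - u N om = (l - u N om) - (l - u (N + m)%N om) by ring.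
    apply: le_trans (ler_normB _ _) _.
    by rewrite (splitr k.+1%:R^-1) ltW// ltrD.
  apply/cauchy_cvgP/cauchy_exP => e e0.
  have [k ke] : exists k : nat, k.+1%:R^-1 < e.
    exists (Num.bound e^-1); rewrite invf_plt ?posrE//.
    apply: lt_le_trans (archi_boundP _) _; first by rewrite invr_ge0 ltW.
    by rewrite ler_nat.
  have [N _ hN] := hu k I; exists (u N om); exists N => // j /= Nj.
  rewrite /ball/= distrC; apply: le_lt_trans ke.
  by have := hN (j - N)%N I; rewrite /= subnKC.
have mC : measurable C.
  rewrite CE; apply: bigcapT_measurable => k; apply: bigcupT_measurable => N.
  apply: bigcapT_measurable => m; rewrite -[X in measurable X]setTI.
  apply: (@measurable_fun_le _ _ _ setT (fun om => `|u (N + m)%N om - u N om|) (cst _)) => //.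
  by apply: measurableT_comp => //; exact: measurable_funB.
pose v N om := u N om * \1_C om.
have mv N : measurable_fun setT (v N).
  by apply: measurable_funM => //; exact: measurable_indic.
have -> : (fun om => limn (u^~ om)) =
  (fun om => limn (v^~ om) + (point : R) * (1 - \1_C om)).
  apply/funext => om; have [cu|ncu] := pselect (C om).
    have -> : v^~ om = u^~ om.
      by apply/funext => N; rewrite /v indicE mem_set// mulr1.
    by rewrite indicE mem_set// subrr mulr0 addr0.
  have -> : v^~ om = cst 0.
    by apply/funext => N; rewrite /v indicE memNset// mulr0.
  rewrite indicE memNset// subr0 mulr1.
  by rewrite lim_cst// add0r dvgP.
apply: measurable_funD; last first.
  apply: measurable_funM => //; apply: measurable_funB => //; exact: measurable_indic.
apply: (@measurable_fun_cvg _ _ _ setT v) => // om _.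
have [cu|ncu] := pselect (C om).
  have -> : v^~ om = u^~ om.
    by apply/funext => N; rewrite /v indicE mem_set// mulr1.
  exact: cu.
have -> : v^~ om = cst 0.
  by apply/funext => N; rewrite /v indicE memNset// mulr0.
exact: is_cvg_cst.
Qed.

Lemma measurable_Gseries {R : realType} n d (T : measurableType d) g P A
    (w : nat -> T -> n.-tuple R) x : (forall k, measurable_fun setT (w k)) ->
  measurable_fun setT (Gseries g P A w x).
Proof.
move=> mw.
apply: measurable_funD; [apply: measurable_funD; [apply: measurable_funD => //|]|].
- apply: measurable_funM => //; apply: measurable_limn => N; exact: measurable_lin_sum.
- apply: measurable_limn => N; exact: measurable_diag_sum.
- apply: measurable_funM => //; apply: measurable_limn => N; exact: measurable_cross_sum.
Qed.

(** * Continuity of the truncations in the noise *)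

Section continuity.
Context {R : realType} {n : nat} (Y : nat -> nat -> 'cV[R]_n) (w : nat -> 'cV[R]_n).
Hypothesis Yw : forall k i, Y q k i 0 @[q --> \oo] --> w k i 0.

Lemma cvg_bigsum (I : Type) (s : seq I) (f : nat -> I -> R) (l : I -> R) :
  (forall i, f q i @[q --> \oo] --> l i) ->
  \sum_(i <- s) f q i @[q --> \oo] --> \sum_(i <- s) l i.
Proof.
move=> fl; elim: s => [|i s IH].
  by under eq_fun do rewrite big_nil; rewrite big_nil; exact: cvg_cst.
under eq_fun do rewrite big_cons; rewrite big_cons; exact: cvgD.
Qed.

Lemma cvg_bil k l (P : 'M[R]_n) : bil (Y q k) P (Y q l) @[q --> \oo] --> bil (w k) P (w l).
Proof.
rewrite bilE; under eq_fun do rewrite bilE.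
apply: cvg_bigsum => i; apply: cvgM; first exact: Yw.
rewrite mxE; under eq_fun do rewrite mxE.
by apply: cvg_bigsum => j; apply: cvgM; [exact: cvg_cst|exact: Yw].
Qed.

Lemma cvg_bill k (P : 'M[R]_n) y : bil (Y q k) P y @[q --> \oo] --> bil (w k) P y.
Proof.
rewrite bilE; under eq_fun do rewrite bilE.
by apply: cvg_bigsum => i; apply: cvgM; [exact: Yw|exact: cvg_cst].
Qed.

Lemma cvg_GN g P A x N : GN g P A x (Y q) N @[q --> \oo] --> GN g P A x w N.
Proof.
apply: cvgD; [apply: cvgD; [apply: cvgD|]|].
- exact: cvg_cst.
- apply: cvgM; first exact: cvg_cst.
  by apply: cvg_bigsum => k; apply: cvgM; [exact: cvg_cst|exact: cvg_bill].
- by apply: cvg_bigsum => k; apply: cvgM; [exact: cvg_cst|exact: cvg_bil].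
- apply: cvgM; first exact: cvg_cst.
  apply: cvg_bigsum => k; rewrite cross_termE; under eq_fun do rewrite cross_termE.
  by apply: cvg_bigsum => tau; apply: cvgM; [exact: cvg_cst|exact: cvg_bil].
Qed.

Lemma cvg_PhiN th N : PhiN th (Y q) N @[q --> \oo] --> PhiN th w N.
Proof.
apply: cvg_bigsum => k; apply: cvgM; first exact: cvg_cst.
apply: cvgD; first exact: cvg_cst.
rewrite sqr_vnorm2; under eq_fun do rewrite sqr_vnorm2.
by apply: cvg_bigsum => i; under eq_fun do rewrite expr2; rewrite expr2; apply: cvgM; exact: Yw.
Qed.

End continuity.

(** * The small-ball bound for the truncated return *)

Section cells.
Context {R : realType} {n D : nat} (eta L : R).
Hypotheses (eta0 : 0 < eta) (eta1 : eta <= 1).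
Notation point := {ffun 'I_n.+1 -> 'I_D}.
Notation pos := (@gpos R D eta L).

(** Half-open, so that distinct cells are disjoint; the density bound is applied to the closed box
    around a cell. *)
Definition cell (g : point) : set (n.+1.-tuple R) :=
  [set v | forall x, pos (g x) <= tnth v x < pos (g x) + eta].

Lemma measurable_cell g : measurable (cell g).
Proof.
have -> : cell g = \bigcap_(x in [set: 'I_n.+1])
    ((fun v => tnth v x) @^-1` `[pos (g x), pos (g x) + eta[%classic).
  apply/seteqP; split => [v /= h x _|v /= h x]; first by rewrite /= in_itv/= h.
  by have := h x I; rewrite /= in_itv.
apply: fin_bigcap_measurable => // x _; rewrite -[X in measurable X]setTI.
by apply: measurable_tnth => //; exact: measurable_itv.
Qed.

Lemma cell_inj v g g' : cell g v -> cell g' v -> g = g'.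
Proof.
move=> cg cg'; apply/ffunP => x; apply/val_inj/eqP; rewrite eqn_leq /=.
have le (a b : 'I_D) (y : R) : pos a <= y -> y < pos b + eta -> (a <= b)%N.
  move=> ay yb; have := le_lt_trans ay yb; rewrite /gpos.
  rewrite -subr_gt0 (_ : _ - _ = eta * ((b : nat).+1%:R - (a : nat)%:R)); last first.
    by rewrite -(natr1 b); ring.
  by rewrite pmulr_rgt0// subr_gt0 ltr_nat ltnS.
have /andP[a1 b1] := cg x; have /andP[a2 b2] := cg' x.
by rewrite (le _ _ _ a1 b2) (le _ _ _ a2 b1).
Qed.

Lemma cell_prob_le d (T : measurableType d) (Pr : probability T R) X f M g :
  measurable_fun setT X -> is_pdf Pr X f -> (forall v, f v <= M) ->
  fine (Pr (X @^-1` cell g)) <= M * eta ^+ n.+1.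
Proof.
move=> mX Xf fM.
(* Boxes have corners indexed by all naturals; the value 0 out of range is never read. *)
pose a (j : nat) : R := if insub j is Some x then pos (g x) else 0.
have ab j : a j <= a j + eta by rewrite lerDl ltW.
have aE (x : 'I_n.+1) : a x = pos (g x) by rewrite /a valK.
have mc : measurable (X @^-1` cell g).
  by rewrite -[X in measurable X]setTI; apply: mX => //; exact: measurable_cell.
have mb : measurable (X @^-1` @box R n.+1 a (fun j => a j + eta)).
  rewrite -[X in measurable X]setTI; apply: mX => //.
  have -> : @box R n.+1 a (fun j => a j + eta) = \bigcap_(x in [set: 'I_n.+1])
      ((fun v => tnth v x) @^-1` `[a x, a x + eta]%classic).
    apply/seteqP; split => [v /= h x _|v /= h x]; first by rewrite /= in_itv/= h.
    by have := h x I; rewrite /= in_itv.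
  apply: fin_bigcap_measurable => // x _; rewrite -[X in measurable X]setTI.
  by apply: measurable_tnth => //; exact: measurable_itv.
have := pdf_box_le Xf fM ab; rewrite (eq_bigr (fun=> eta)); last first.
  by move=> j _; rewrite addrC addKr.
rewrite prodr_const card_ord => h.
rewrite -lee_fin fineK ?fin_num_measure//; apply: le_trans h.
rewrite le_measure ?inE// => om /= ch x.
by rewrite aE; have /andP[-> /ltW ->] := ch x.
Qed.

Lemma wgt_le_cell v g : cell g v ->
  wgt eta L g <= 1 + 2 * vnorm2 (tcol v) ^+ 2 + 2 * n.+1%:R.
Proof.
move=> cg; rewrite /wgt sqr_vnorm2 -addrA lerD2l.
have -> : 2 * n.+1%:R = \sum_(x < n.+1) (2 : R).
  by rewrite sumr_const card_ord -[RHS]mulr_natr.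
rewrite mulr_sumr -big_split/=; apply: ler_sum => x _; rewrite mxE.
have /andP[a1 a2] := cg x.
set p := pos (g x) in a1 a2 *; set y := tnth v x in a1 a2 *.
have r0 : 0 <= y - p by rewrite subr_ge0.
have r1 : y - p <= 1 by apply: le_trans eta1; rewrite lerBlDl ltW.
have : (y - p) ^+ 2 <= 1 by rewrite exprn_ile1.
(* This square is the gap in [p ^+ 2 <= 2 * y ^+ 2 + 2 * (y - p) ^+ 2]. *)
have := sqr_ge0 (p - 2 * y); rewrite !expr2; lra.
Qed.

(** The grid of mesh [1 / (q + 1)] with [2 * q * (q + 1)] points per axis fills the window from
    [- q] to [q]. The explicit rounding formula is kept for the limit in [q]. *)
Lemma ex_cell v (q : nat) : L = q%:R -> eta = q.+1%:R^-1 -> D = (2 * q * q.+1)%N ->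
  (forall x, `|tnth v x| < q%:R) ->
  exists2 g : point, cell g v & forall x,
    pos (g x) = eta * (Num.truncn ((tnth v x + q%:R) * q.+1%:R))%:R - L.
Proof.
move=> LE etaE DE vq.
have q1 : 0 < q.+1%:R :> R by rewrite ltr0n.
pose s x := (tnth v x + q%:R) * q.+1%:R.
have s0 x : 0 <= s x.
  rewrite mulr_ge0// -lerBlDr sub0r; have := vq x; rewrite ltr_norml => /andP[/ltW].
  by [].
have sD x : (Num.truncn (s x) < D)%N.
  have /andP[t1 _] := truncn_itv (s0 x).
  rewrite -(ltr_nat R); apply: le_lt_trans t1 _.
  rewrite DE !natrM /s ltr_pM2r// mulr2n mulrDl mul1r ltrD2r.
  by have := vq x; rewrite ltr_norml => /andP[].
exists [ffun x => Ordinal (sD x)] => [x|x]; last by rewrite /gpos ffunE.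
have /andP[t1 t2] := truncn_itv (s0 x).
rewrite /gpos ffunE/= LE.
have se : tnth v x = eta * s x - q%:R.
  by rewrite etaE /s mulrCA mulVf ?gt_eqF// mulr1 addrK.
rewrite se; apply/andP; split.
  by rewrite lerD2r ler_pM2l.
by rewrite addrAC ltrD2r -[X in _ < _ + X]mulr1 -mulrDr natr1 ltr_pM2l.
Qed.

End cells.

Lemma GN_ext {R : realType} n (g : R) (P A : 'M[R]_n) x w w' N :
  (forall k, (k < N)%N -> w k = w' k) -> GN g P A x w N = GN g P A x w' N.
Proof.
move=> ww'; rewrite /GN; congr (_ + 2 * _ + _ + 2 * _).
- by apply: eq_big_nat => k /andP[_ kN]; rewrite /lin_term ww'.
- by apply: eq_big_nat => k /andP[_ kN]; rewrite /diag_term ww'.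
- apply: eq_big_nat => k /andP[_ kN]; rewrite /cross_term ww'//.
  congr (_ * bil _ _ _); apply: eq_big_nat => tau /andP[_ tk].
  by rewrite ww'// (ltn_trans tk).
Qed.

Lemma PhiN_ext {R : realType} n (th : R) (w w' : nat -> 'cV[R]_n) N :
  (forall k, (k < N)%N -> w k = w' k) -> PhiN th w N = PhiN th w' N.
Proof. by move=> ww'; apply: eq_bigr => k _; rewrite /energy ww'. Qed.

Section grid_noise.
Context {R : realType} {n N D : nat} (eta L : R).
Notation point := {ffun 'I_n.+1 -> 'I_D}.
Implicit Types y : {ffun 'I_N -> point}.

Definition grid_vec y (k : nat) : 'cV[R]_n.+1 :=
  if insub k is Some k' then \col_x gpos eta L (y k' x) else 0.

Lemma grid_vecE y (k : 'I_N) : grid_vec y k = \col_x gpos eta L (y k x).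
Proof. by rewrite /grid_vec valK. Qed.

Lemma PhiN_grid th y : PhiN th (grid_vec y) N = Phi th eta L y.
Proof.
apply: eq_bigr => k _; rewrite /energy grid_vecE sqr_vnorm2; congr (_ * (_ + _)).
by apply: eq_bigr => x _; rewrite mxE.
Qed.

Lemma GN_grid_quad (g : R) (P A : 'M[R]_n.+1) x (i : nat) (k0 k1 : 'I_N) y
    (g0 g1 : point) : k0 = i.*2 :> nat -> k1 = i.*2.+1 :> nat ->
  let e := delta_mx ord0 0 : 'cV[R]_n.+1 in
  exists l1 l2 c, forall s s' : 'I_D,
  GN g P A x (grid_vec (upd (upd y k1 (upd g1 ord0 s')) k0 (upd g0 ord0 s))) N =
  quad (g ^+ i.*2.+1 * bil e P e) (g ^+ i.*2.+2 * bil e P (A *m e))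
    (g ^+ i.*2.+2 * bil e P e) l1 l2 c (gpos eta L s) (gpos eta L s').
Proof.
move=> k0E k1E e.
pose y2 := upd (upd y k1 g1) k0 g0.
(* The first coordinate of the two noises is cleared, so that adding a multiple of [e] sets it
   rather than shifts it. *)
pose base (k : nat) := grid_vec y2 k -
  (if (k == i.*2) || (k == i.*2.+1) then grid_vec y2 k ord0 0 else 0) *: e.
have k1N : (i.*2.+1 < N)%N by rewrite -k1E.
have [l1 [l2 [c h]]] := GN_quad g P A x base e k1N erefl.
exists l1, l2, c => s s'; rewrite -h; apply: GN_ext => k kN.
pose kk := Ordinal kN.
have -> : k = kk :> nat by [].
rewrite /base !grid_vecE /spike -k1E -k0E !val_eqE.
apply/matrixP => a b; rewrite ord1 {b} !mxE.
have k01 : (k0 == k1) = false by rewrite -val_eqE /= k0E k1E ltn_eqF.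
rewrite /y2 !updE.
have [kkE|kk0] := eqVneq kk k0.
  rewrite kkE k01 /= !mxE !updE; case: eqVneq => [->|a0]; rewrite ?updE ?mxE ?eqxx/=; ring.
have [kkE|kk1] := eqVneq kk k1.
  by rewrite /= !mxE !updE; case: eqVneq => [->|a0]; rewrite ?updE ?mxE ?eqxx/=; ring.
by rewrite /= !mxE; ring.
Qed.

End grid_noise.

Lemma det_pos {R : realType} (g p c : R) i : 0 < g -> g * c ^+ 2 < p ^+ 2 ->
  0 < g ^+ i.*2.+1 * p * (g ^+ i.*2.+2 * p) - (g ^+ i.*2.+2 * c) ^+ 2.
Proof.
move=> g0 h; have -> : g ^+ i.*2.+1 * p * (g ^+ i.*2.+2 * p) - (g ^+ i.*2.+2 * c) ^+ 2 =
  g ^+ i.*2.+1 * g ^+ i.*2.+2 * (p ^+ 2 - g * c ^+ 2) by rewrite (exprS g i.*2.+1); ring.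
apply: mulr_gt0; last by rewrite subr_gt0.
by apply: mulr_gt0; exact: exprn_gt0.
Qed.

Lemma independent_cells {R : realType} d (T : measurableType d) (Pr : probability T R) n
    (w : nat -> T -> n.-tuple R) N (B : 'I_N -> set (n.-tuple R)) :
  mutually_independent Pr w -> (forall k, measurable_fun setT (w k)) ->
  (forall k, measurable (B k)) ->
  fine (Pr [set om | forall k, B k (w k om)]) =
  \prod_(k < N) fine (Pr (w k @^-1` B k)).
Proof.
move=> iw mw mB.
pose B' (k : nat) : set (n.-tuple R) := if insub k is Some k' then B k' else setT.
have B'E (k : 'I_N) : B' k = B k by rewrite /B' valK.
have mB' k : measurable (B' k) by rewrite /B'; case: insubP => // *; exact: measurableT.
have := iw (iota 0 N) B' (iota_uniq _ _) mB'.
have -> : \bigcap_(k in [set` iota 0 N]) w k @^-1` B' k =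
    [set om | forall k : 'I_N, B k (w k om)].
  apply/seteqP; split => [om /= h k|om /= h k].
    by rewrite -B'E; apply: h => /=; rewrite mem_iota /=.
  by rewrite /= mem_iota add0n => kN; rewrite -[k]/(nat_of_ord (Ordinal kN)) B'E; exact: h.
move=> ->.
have -> : (\big[*%E/1%E]_(k <- iota 0 N) Pr (w k @^-1` B' k) =
    (\prod_(k < N) fine (Pr (w k @^-1` B k)))%:E)%E.
  have <- : index_iota 0 N = iota 0 N by rewrite /index_iota subn0.
  rewrite big_mkord (big_morph EFin (@EFinM R) erefl).
  apply: eq_bigr => k _; rewrite B'E fineK// fin_num_measure//.
  by rewrite -[X in measurable X]setTI; exact: mw.
by [].
Qed.

Lemma near_nat_gt {R : realType} (r : R) : \forall q \near \oo, r < q%:R.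
Proof.
exists (Num.bound `|r|) => // q /= bq; apply: le_lt_trans (ler_norm r) _.
by apply: lt_le_trans (archi_boundP _) _ => //; rewrite ler_nat.
Qed.

Lemma near_invS_le {R : realType} (eps : R) : 0 < eps ->
  \forall q \near \oo, q.+1%:R^-1 <= eps.
Proof.
move=> e0; have := near_nat_gt eps^-1; apply: filterS => q eq.
rewrite invf_ple ?posrE ?ltr0n//; apply: le_trans (ltW eq) _; by rewrite ler_nat.
Qed.

Lemma rounding_cvg {R : realType} (v : R) :
  q.+1%:R^-1 * (Num.truncn ((v + q%:R) * q.+1%:R))%:R - q%:R @[q --> \oo] --> v.
Proof.
apply/cvgrPdist_le => eps e0; near=> q.
have vq : `|v| < q%:R by near: q; exact: near_nat_gt.
have eq : q.+1%:R^-1 <= eps by near: q; exact: near_invS_le.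
have q1 : 0 < q.+1%:R :> R by rewrite ltr0n.
set s := (v + q%:R) * q.+1%:R.
have s0 : 0 <= s.
  by rewrite mulr_ge0// -lerBlDr sub0r; move: vq; rewrite ltr_norml => /andP[/ltW].
have /andP[t1 t2] := truncn_itv s0.
apply: le_trans eq.
have -> : v = q.+1%:R^-1 * s - q%:R.
  by rewrite /s mulrCA mulVf ?gt_eqF// mulr1 addrK.
rewrite -/s opprB addrA subrK -mulrBr normrM gtr0_norm ?invr_gt0//.
rewrite -[leRHS]mulr1 ler_pM2l ?invr_gt0// ger0_norm ?subr_ge0//.
by rewrite lerBlDl natr1 ltW.
Unshelve. all: by end_near.
Qed.

Section small_ball.
Context {R : realType} {n : nat} (g th M : R) (P A : 'M[R]_n.+1) (x : 'cV[R]_n.+1).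
Hypotheses (g01 : 0 < g < 1) (th0 : 0 < th) (th1 : th < 1) (M0 : 0 <= M).
Let e : 'cV[R]_n.+1 := delta_mx ord0 0.
Hypotheses (Pe : 0 < bil e P e) (PAe : g * bil e P (A *m e) ^+ 2 < bil e P e ^+ 2).

(** [C] is fixed before the probability space, the truncation [N] and the level [z], which the limit
    in [N] and the order of quantifiers in the theorem require. *)
Lemma GN_small_ball (sigma : R) : exists2 C, 0 <= C &
  forall d (T : measurableType d) (Pr : probability T R) (w : nat -> T -> n.+1.-tuple R),
  (forall k, measurable_fun setT (w k)) -> mutually_independent Pr w ->
  (forall k, exists f, is_pdf Pr (w k) f /\ forall v, f v <= M) ->
  (forall k, (\int[Pr]_om (vnorm2 (tcol (w k om)) ^+ 2)%:E <= (sigma ^+ 2)%:E)%E) ->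
  forall N (t z : R), ((2 * n + 5).*2 <= N)%N -> 0 < t ->
  (Pr [set om | (`|GN g P A x (fun k => tcol (w k om)) N - z|
     <= t * PhiN th (fun k => tcol (w k om)) N)%R] <= (C * t)%:E)%E.
Proof.
have /andP[g0 g1] := g01.
pose qa i := g ^+ i.*2.+1 * bil e P e.
pose qb i := g ^+ i.*2.+2 * bil e P (A *m e).
pose qk i := g ^+ i.*2.+2 * bil e P e.
have qa0 i : 0 < qa i by rewrite mulr_gt0// exprn_gt0.
have qk0 i : 0 < qk i by rewrite mulr_gt0// exprn_gt0.
have det0 i : 0 < qa i * qk i - qb i ^+ 2 by exact: det_pos.
have [Cf Cf0 CfP] : exists2 Cf : nat -> R, forall i, 0 <= Cf i & forall i D eta L l1 l2 c h r
    (S : {set 'I_D * 'I_D}),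
  0 < eta -> eta <= 1 -> eta <= h -> 1 <= r ->
  (forall p, p \in S ->
    [/\ `|quad (qa i) (qb i) (qk i) l1 l2 c (gpos eta L p.1) (gpos eta L p.2)| <= h,
        `|gpos eta L p.1| <= r & `|gpos eta L p.2| <= r]) ->
  #|S|%:R <= Cf i * r * h / eta ^+ 2.
  have /choice[Cf CfP] : forall i, exists C : R, 0 <= C /\ forall D eta L l1 l2 c h r
      (S : {set 'I_D * 'I_D}),
    0 < eta -> eta <= 1 -> eta <= h -> 1 <= r ->
    (forall p, p \in S ->
      [/\ `|quad (qa i) (qb i) (qk i) l1 l2 c (gpos eta L p.1) (gpos eta L p.2)| <= h,
          `|gpos eta L p.1| <= r & `|gpos eta L p.2| <= r]) ->
    #|S|%:R <= C * r * h / eta ^+ 2.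
    by move=> i; have [C C0 hC] := card_quad (qa0 i) (qk0 i) (det0 i); exists C.
  by exists Cf => i; have [] := CfP i.
pose m := (2 * n + 5)%N.
pose C := \sum_(i < m) Cf i.
have C0 : 0 <= C by exact: sumr_ge0.
(* Bounds the expected weight of a rounded noise, by [wgt_le_cell]. *)
pose Bs : R := 1 + 2 * sigma ^+ 2 + 2 * n.+1%:R.
have Bs1 : 1 <= Bs.
  rewrite /Bs -addrA lerDl; apply: addr_ge0; apply: mulr_ge0 => //.
  exact: sqr_ge0.
pose K := m%:R * (M ^+ 2 * 9 ^+ n * C * 2 ^+ (2 * n + 2) * (1 - th)^-1 * Bs ^+ m.*2.+1 * 2).
have K0 : 0 <= K.
  have Bs0 : 0 <= Bs by exact: le_trans Bs1.
  have q1 : 0 <= (1 - th)^-1 by rewrite invr_ge0 subr_ge0 ltW.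
  have q2 : 0 <= Bs ^+ m.*2.+1 by exact: exprn_ge0.
  apply: mulr_ge0 => //; apply: mulr_ge0 => //; apply: mulr_ge0 => //.
  apply: mulr_ge0 => //; apply: mulr_ge0; last exact: exprn_ge0.
  by apply: mulr_ge0 => //; apply: mulr_ge0; exact: exprn_ge0.
(* The discrete bound [K] is applied to the rounded noise with threshold [2 * t]. *)
exists (K * 2); first by rewrite mulr_ge0.
move=> d T Pr w mw iw pw sw N t z mN t0.
pose Lq (q : nat) : R := q%:R.
pose etaq (q : nat) : R := q.+1%:R^-1.
pose Dq (q : nat) := (2 * q * q.+1)%N.
have etaq0 q : 0 < etaq q by rewrite invr_gt0 ltr0n.
have etaq1 q : etaq q <= 1 by rewrite invf_le1 ?ltr0n// ler1n.
pose good q (y : {ffun 'I_N -> {ffun 'I_n.+1 -> 'I_(Dq q)}}) :=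
  `|GN g P A x (grid_vec (etaq q) (Lq q) y) N - z| <= 2 * t * Phi th (etaq q) (Lq q) y.
pose Cy q (y : {ffun 'I_N -> {ffun 'I_n.+1 -> 'I_(Dq q)}}) :=
  [set om | forall k, cell (etaq q) (Lq q) (y k) (w k om)].
have mcell q (gg : {ffun 'I_n.+1 -> 'I_(Dq q)}) k :
    measurable (w k @^-1` cell (etaq q) (Lq q) gg).
  by rewrite -[X in measurable X]setTI; apply: mw => //; exact: measurable_cell.
have mCy q y : measurable (@Cy q y).
  have -> : @Cy q y = \bigcap_(k in [set: 'I_N])
      (w k @^-1` cell (etaq q) (Lq q) (y k)).
    by apply/seteqP; split => [om h k _|om h k]; [exact: h|exact: h].
  by apply: fin_bigcap_measurable.
pose Bq q := [set om | exists2 y, @good q y & @Cy q y om].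
have mBq q : measurable (Bq q).
  have -> : Bq q = \bigcup_(y in [set y | @good q y]) @Cy q y by [].
  apply: fin_bigcup_measurable => //.
apply: (@measure_liminf_le R d T Pr _ Bq) => //.
- rewrite -[X in measurable X]setTI.
  apply: (@measurable_fun_le _ _ _ setT
    (fun om => `|GN g P A x (fun k => tcol (w k om)) N - z|)) => //.
    apply: measurableT_comp => //; apply: measurable_funB => //; exact: measurable_GN.
  by apply: measurable_funM => //; exact: measurable_PhiN.
- move=> om /= Aom.
  pose v k := tcol (w k om).
  pose Yq q (k : nat) : 'cV[R]_n.+1 :=
    \col_a (etaq q * (Num.truncn ((tnth (w k om) a + q%:R) * q.+1%:R))%:R - Lq q).
  have Yv k i : Yq q k i 0 @[q --> \oo] --> v k i 0.
    by rewrite mxE; under eq_fun do rewrite mxE; exact: rounding_cvg.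
  have Ph0 : 1 <= PhiN th v N by apply: PhiN_ge1 => //; apply: leq_trans mN; rewrite addnC.
  (* Doubling [t] makes the inequality strict, as [PhiN] is at least 1; a strict inequality passes
     to the rounded noise once the grid is fine enough. *)
  have near1 : \forall q \near \oo,
      0 < 2 * t * PhiN th (Yq q) N - `|GN g P A x (Yq q) N - z|.
    have lim : 2 * t * PhiN th (Yq q) N - `|GN g P A x (Yq q) N - z| @[q --> \oo] -->
        2 * t * PhiN th v N - `|GN g P A x v N - z|.
      apply: cvgB; first by apply: cvgM; [exact: cvg_cst|exact: cvg_PhiN].
      by apply: cvg_norm; apply: cvgB; [exact: cvg_GN|exact: cvg_cst].
    apply: (cvgr_gt _ lim); rewrite subr_gt0; apply: le_lt_trans Aom _.
    by rewrite -mulrA mulr_natl mulr2n ltrDr mulr_gt0// (lt_le_trans _ Ph0).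
  near=> q.
  have vq (k : 'I_N) a : `|tnth (w k om) a| < q%:R.
    apply: (@le_lt_trans _ _ (\sum_(k < N) \sum_a `|tnth (w k om) a|)); last first.
      by near: q; exact: near_nat_gt.
    rewrite (bigD1 k)//= (bigD1 a)//= -addrA lerDl addr_ge0// sumr_ge0// => *.
    exact: sumr_ge0.
  have /choice[f fP] (k : 'I_N) := let: ex_intro2 gg c h :=
    @ex_cell R n (Dq q) (etaq q) (Lq q) (etaq0 q) (w k om) q erefl erefl erefl (vq k) in
    ex_intro _ gg (conj c h).
  exists [ffun k => f k]; last by move=> k /=; rewrite ffunE; have [] := fP k.
  have ext k : (k < N)%N -> grid_vec (etaq q) (Lq q) [ffun k => f k] k = Yq q k.
    move=> kN; rewrite -[k in LHS]/(nat_of_ord (Ordinal kN)) grid_vecE.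
    apply/matrixP => a b; rewrite !mxE ffunE.
    by have [_ ->] := fP (Ordinal kN).
  rewrite /good -PhiN_grid (PhiN_ext _ ext) (GN_ext _ _ _ _ ext) ltW// -subr_gt0.
  by near: q.
- have : \forall q \near \oo, etaq q <= 2 * t.
    by apply: near_invS_le; rewrite mulr_gt0.
  apply: filterS => q etaqt.
  have mB := mBq q.
  have := @measure_cover_le R d T Pr _ (@good q) (Bq q) (@Cy q) mB (@mCy q).
  move=> /(_ _)/le_trans; apply; first by move=> om [y gy cy]; exists y.
  rewrite lee_fin.
  pose p (k : 'I_N) (gg : {ffun 'I_n.+1 -> 'I_(Dq q)}) :=
    fine (Pr (w k @^-1` cell (etaq q) (Lq q) gg)).
  rewrite (eq_bigr (fun y : {ffun 'I_N -> {ffun 'I_n.+1 -> 'I_(Dq q)}} =>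
     \prod_k p k (y k))); last first.
    move=> y _; apply: independent_cells => // k; exact: measurable_cell.
  have p0 k gg : 0 <= p k gg by exact: fine_ge0.
  rewrite -mulrA.
  apply: (@discrete_le R n m qa qb qk M Bs th M0 Bs1 (ltW th0) th1 N (Dq q) (etaq q) (Lq q)
    (2 * t) z mN (etaq0 q) (etaq1 q) etaqt p
    (fun y => GN g P A x (grid_vec (etaq q) (Lq q) y) N) p0 _ _ _ _ C) => //.
  + move=> k; have := @sum_disjoint_le R d T Pr _ (fun gg => w k @^-1` cell (etaq q) (Lq q) gg)
      (fun=> 1) (fun=> 1) 1 (fun gg => mcell q gg k).
    under eq_bigr do rewrite mul1r.
    apply => //; last by move=> gg gg' om /=; exact: cell_inj.
    by rewrite integral_cst// mul1e probability_le1.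
  + move=> k; under eq_bigr do rewrite mulrC.
    apply: (@sum_disjoint_le R d T Pr _ (fun gg => w k @^-1` cell (etaq q) (Lq q) gg)
      (wgt (etaq q) (Lq q)) (fun om => 1 + 2 * vnorm2 (tcol (w k om)) ^+ 2 + 2 * n.+1%:R)).
    * by move=> gg; exact: mcell.
    * by move=> gg; exact: wgt_ge0.
    * apply: measurable_funD => //; apply: measurable_funD => //.
      by apply: measurable_funM => //; exact: measurable_vnorm2.
    * move=> om; apply: addr_ge0; last exact: mulr_ge0.
      by apply: addr_ge0 => //; apply: mulr_ge0 => //; exact: sqr_ge0.
    * have mv : measurable_fun setT (fun om => (vnorm2 (tcol (w k om)) ^+ 2)%:E).
        by apply/measurable_EFinP; exact: measurable_vnorm2.
      rewrite (eq_integral (fun om => ((1 + 2 * n.+1%:R)%:E +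
          2%:E * (vnorm2 (tcol (w k om)) ^+ 2)%:E)%E)); last first.
        by move=> om _; rewrite -EFinM -EFinD; congr EFin; ring.
      have c0 : 0 <= 1 + 2 * n.+1%:R :> R by apply: addr_ge0 => //; apply: mulr_ge0.
      rewrite ge0_integralD//; last 2 first.
      - by move=> om _; rewrite mule_ge0// lee_fin ?sqr_ge0.
      - by apply: measurable_funeM.
      rewrite integral_cst// ge0_integralZl//; last first.
        by move=> om _; rewrite lee_fin sqr_ge0.
      have -> : Bs%:E = ((1 + 2 * n.+1%:R)%:E + (2 * sigma ^+ 2)%:E)%E.
        by rewrite -EFinD /Bs; congr EFin; ring.
      apply: leeD.
        rewrite -[leRHS]mule1; apply: lee_wpmul2l; first by rewrite lee_fin.
        exact: probability_le1.
      by rewrite EFinM; apply: lee_wpmul2l; [rewrite lee_fin|exact: sw].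
    * by move=> gg gg' om /=; exact: cell_inj.
    * by move=> gg om /=; exact: wgt_le_cell.
  + move=> k gg; have [f [pf fM]] := pw k.
    exact: cell_prob_le pf fM.
  + by move=> i k0 k1 im k0E k1E y g0' g1'; exact: GN_grid_quad.
  + move=> i D eta L l1 l2 c h r S im h1 h2 h3 h4 hS.
    apply: le_trans (CfP i D eta L l1 l2 c h r S h1 h2 h3 h4 hS) _.
    have h0 : 0 <= h by apply: le_trans h3; exact: ltW.
    have r0 : 0 <= r by apply: le_trans h4.
    rewrite -!mulrA ler_wpM2r//.
      by rewrite !mulr_ge0// invr_ge0 sqr_ge0.
    rewrite /C (bigD1 (Ordinal im))//= lerDl; exact: sumr_ge0.
Unshelve. all: by end_near.
Qed.

End small_ball.

(** * Perturbation of the distribution function *)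

(** The expectation of [PhiN] is bounded uniformly in [N] by a geometric series, and the events
    increase with [N], so the Markov bound passes to their union. *)
Lemma PhiN_tail_le {R : realType} n d (T : measurableType d) (Pr : probability T R)
    (w : nat -> T -> n.-tuple R) (th sigma lam : R) :
  0 < th -> th < 1 -> 0 < lam -> (forall k, measurable_fun setT (w k)) ->
  (forall k, (\int[Pr]_om (vnorm2 (tcol (w k om)) ^+ 2)%:E <= (sigma ^+ 2)%:E)%E) ->
  let S := \bigcup_N [set om | lam < PhiN th (fun k => tcol (w k om)) N] in
  measurable S /\ (Pr S <= ((1 + sigma ^+ 2) / (1 - th) / lam)%:E)%E.
Proof.
move=> th0 th1 lam0 mw sw S.
pose B N := [set om | lam < PhiN th (fun k => tcol (w k om)) N].
have mB N : measurable (B N).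
  have -> : B N = ~` [set om | PhiN th (fun k => tcol (w k om)) N <= lam].
    apply/seteqP; split => om; rewrite /B/=; first by rewrite ltNge => /negP.
    by move/negP; rewrite -ltNge.
  apply: measurableC; rewrite -[X in measurable X]setTI.
  apply: (@measurable_fun_le _ _ _ setT (fun om => PhiN th (fun k => tcol (w k om)) N)
    (cst lam)) => //; exact: measurable_PhiN.
have mS : measurable S by exact: bigcupT_measurable.
split => //; apply: (@measure_liminf_le R d T Pr S B) => //.
  move=> om [N _ /= hN]; exists N => // N' /= NN'.
  by apply: lt_le_trans hN _; exact: PhiN_le.
apply: nearW => N.
have mv k : measurable_fun setT (fun om => (th ^+ k * energy (fun k => tcol (w k om)) k)%:E).
  apply/measurable_EFinP; apply: measurable_funM => //; apply: measurable_funD => //.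
  exact: measurable_vnorm2.
have v0 k om : (0 <= (th ^+ k * energy (fun k => tcol (w k om)) k)%:E)%E.
  by rewrite lee_fin mulr_ge0 ?energy_ge0 ?exprn_ge0 ?(ltW th0).
have E : (\int[Pr]_om (PhiN th (fun k => tcol (w k om)) N)%:E <=
    ((1 + sigma ^+ 2) / (1 - th))%:E)%E.
  rewrite /PhiN; under eq_integral do rewrite -sumEFin.
  rewrite ge0_integral_sum//.
  apply: (@le_trans _ _ (\sum_(k < N) (th ^+ k * (1 + sigma ^+ 2))%:E)%E).
    apply: lee_sum => k _; rewrite /energy.
    have mk : measurable_fun setT (fun om => (vnorm2 (tcol (w k om)) ^+ 2)%:E).
      by apply/measurable_EFinP; exact: measurable_vnorm2.
    rewrite (eq_integral (fun om => ((th ^+ k)%:E * (1 + (vnorm2 (tcol (w k om)) ^+ 2)%:E))%E)); last first.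
      by move=> om _; rewrite -EFinD -EFinM.
    have k0 om : (0 <= (vnorm2 (tcol (w k om)) ^+ 2)%:E)%E by rewrite lee_fin sqr_ge0.
    rewrite ge0_integralZl//; last 3 first.
    - exact: emeasurable_funD.
    - by move=> om _; rewrite adde_ge0.
    - by rewrite lee_fin exprn_ge0 ?(ltW th0).
    rewrite ge0_integralD// integral_cst// mul1e EFinM.
    apply: lee_wpmul2l; first by rewrite lee_fin exprn_ge0 ?(ltW th0).
    by rewrite EFinD; apply: leeD => //; exact: probability_le1.
  rewrite sumEFin lee_fin -mulr_suml mulrC ler_wpM2l ?addr_ge0 ?sqr_ge0//.
  by apply: sum_geom_le => //; exact: ltW.
have := @sum_disjoint_le R d T Pr _ (fun _ : 'I_1 => B N) (fun=> lam)
  (fun om => PhiN th (fun k => tcol (w k om)) N) _ (fun=> mB N) _ _ _ E.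
rewrite big_ord1 => h.
have {h}hl : lam * fine (Pr (B N)) <= (1 + sigma ^+ 2) / (1 - th).
  apply: h => [_|||i j om _ _|_ om /=]; first exact: ltW.
  - exact: measurable_PhiN.
  - by move=> om; exact: PhiN_ge0.
  - by rewrite !ord1.
  - exact: ltW.
have -> : Pr (B N) = (fine (Pr (B N)))%:E by rewrite fineK// fin_num_measure.
by rewrite lee_fin ler_pdivlMr// mulrC.
Qed.

Lemma mxboundN {R : realType} n c (M : 'M[R]_n) : mxbound c M -> mxbound c (- M).
Proof. by move=> hM u v; rewrite /bil mulmxN mulNmx mxE normrN; exact: hM. Qed.

Lemma le_add_eps {R : realFieldType} (a b c : R) : 0 <= c ->
  (forall e, 0 < e -> a <= b + c * e) -> a <= b.
Proof.
move=> c0 h; rewrite leNgt; apply/negP => ba.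
have d0 : 0 < c + 1 by lra.
have := h ((a - b) / (c + 1) / 2) _; rewrite !divr_gt0 ?subr_gt0// => /(_ isT).
have : c * ((a - b) / (c + 1) / 2) = (c / (c + 1)) * ((a - b) / 2) by ring.
have : c / (c + 1) <= 1 by rewrite ler_pdivrMr//; lra.
set r := c / (c + 1) => r1 -> h2.
have : r * ((a - b) / 2) <= 1 * ((a - b) / 2) by rewrite ler_wpM2r//; lra.
lra.
Qed.

(** If only one of [G] and [Gt] is at most [z], then [z] separates them, and [G] is no farther from
    [z] than from [Gt]: this is [A0]. Outside the tail event [S] the truncations converge, so [A0]
    passes to large [N] with a slack [e], which becomes [e * PhiN] since [PhiN] is at least 1. *)
Lemma cdf_diff_le {R : realType} n d (T : measurableType d) (Pr : probability T R)
    (w : nat -> T -> n.-tuple R) (g th sigma C D c ct : R) (P A Pt At : 'M[R]_n) x z N0 :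
  0 < th -> th < 1 -> g = th ^+ 4 -> 0 <= C -> 0 <= D -> 0 <= c -> 0 <= ct ->
  (forall k, measurable_fun setT (w k)) ->
  (forall k, (\int[Pr]_om (vnorm2 (tcol (w k om)) ^+ 2)%:E <= (sigma ^+ 2)%:E)%E) ->
  (forall k, mxbound (c * k.+1%:R) (P *m A ^+ k)) ->
  (forall k, mxbound (ct * k.+1%:R) (Pt *m At ^+ k)) ->
  (forall v N, (0 < N)%N -> `|GN g P A x v N - GN g Pt At x v N| <= D * PhiN th v N) ->
  (forall N (t : R), (N0 <= N)%N -> 0 < t ->
    (Pr [set om | (`|GN g P A x (fun k => tcol (w k om)) N - z|
     <= t * PhiN th (fun k => tcol (w k om)) N)%R] <= (C * t)%:E)%E) ->
  `|Gcdf Pr g P A w x z - Gcdf Pr g Pt At w x z| <= C * D.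
Proof.
move=> th0 th1 gE C0 D0 c0 ct0 mw sw hM hMt hD hC.
have [G GE] : {G | G = Gseries g P A w x} by exists (Gseries g P A w x).
have [Gt GtE] : {Gt | Gt = Gseries g Pt At w x} by exists (Gseries g Pt At w x).
have mG : measurable_fun setT G by rewrite GE; exact: measurable_Gseries.
have mGt : measurable_fun setT Gt by rewrite GtE; exact: measurable_Gseries.
pose E := [set om | G om <= z]; pose Et := [set om | Gt om <= z].
pose A0 := [set om | `|G om - z| <= `|G om - Gt om|].
have mE : measurable E.
  by rewrite -[E]setTI; apply: (@measurable_fun_le _ _ _ setT G (cst z)).
have mEt : measurable Et.
  by rewrite -[Et]setTI; apply: (@measurable_fun_le _ _ _ setT Gt (cst z)).
have mA0 : measurable A0.
  rewrite -[A0]setTI; apply: (@measurable_fun_le _ _ _ setT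
    (fun om => `|G om - z|) (fun om => `|G om - Gt om|)) => //;
    by apply: measurableT_comp => //; exact: measurable_funB.
have finP X : measurable X -> Pr X = (fine (Pr X))%:E.
  by move=> mX; rewrite fineK// fin_num_measure.
have step (e lam : R) : 0 < e -> 0 < lam ->
    fine (Pr A0) <= C * (D + e) + (1 + sigma ^+ 2) / (1 - th) / lam.
  move=> e0 lam0.
  have [mS PS] := PhiN_tail_le th0 th1 lam0 mw sw.
  set S := \bigcup_N _ in mS PS.
  have mAS : measurable (A0 `\` S) by exact: measurableD.
  have AS : A0 `<=` (A0 `\` S) `|` S.
    by move=> om ?; have [?|?] := pselect (S om); [right|left].
  rewrite -lee_fin -finP// EFinD.
  apply: (@le_trans _ _ (Pr ((A0 `\` S) `|` S))).
    by rewrite le_measure ?inE//; exact: measurableU.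
  apply: (le_trans (measureU2 _ mAS mS)); apply: leeD => //.
  pose B N := [set om | `|GN g P A x (fun k => tcol (w k om)) N - z|
     <= (D + e) * PhiN th (fun k => tcol (w k om)) N].
  have mB N : measurable (B N).
    rewrite -[B N]setTI; apply: (@measurable_fun_le _ _ _ setT
      (fun om => `|GN g P A x (fun k => tcol (w k om)) N - z|)) => //.
      by apply: measurableT_comp => //; apply: measurable_funB => //; exact: measurable_GN.
    by apply: measurable_funM => //; exact: measurable_PhiN.
  have t0 : 0 < D + e by rewrite ltr_wpDl.
  apply: (@measure_liminf_le R d T Pr _ B) => //; last first.
    by exists N0 => // N /= N0N; exact: hC.
  move=> om [/= A0om Som].
  have Phl N : PhiN th (fun k => tcol (w k om)) N <= lam.
    by rewrite leNgt; apply/negP => h; apply: Som; exists N.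
  have cG := @GN_cvg R n g th _ lam _ _ x d T w om th0 th1 gE c0 hM Phl; rewrite -GE in cG.
  have cGt := @GN_cvg R n g th _ lam _ _ x d T w om th0 th1 gE ct0 hMt Phl; rewrite -GtE in cGt.
  set u := fun N => GN g P A x (fun k => tcol (w k om)) N in cG.
  set ut := fun N => GN g Pt At x (fun k => tcol (w k om)) N in cGt.
  have lim : `|u N - ut N| - `|u N - z| @[N --> \oo] --> `|G om - Gt om| - `|G om - z|.
    by apply: cvgB; apply: cvg_norm; apply: cvgB => //; exact: cvg_cst.
  have : \forall N \near \oo, - e < `|u N - ut N| - `|u N - z|.
    by apply: (cvgr_gt _ lim); rewrite ltrBrDr; move: A0om; rewrite /A0/=; lra.
  move=> near1; near=> N.
  have N1 : (0 < N)%N by near: N; exact: nbhs_infty_gt.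
  have h1 : - e < `|u N - ut N| - `|u N - z| by near: N.
  have h2 := hD (fun k => tcol (w k om)) N N1.
  have h3 := PhiN_ge1 (fun k => tcol (w k om)) th0 N1.
  rewrite /B/= mulrDl; rewrite -/(u N) -/(ut N) in h2 *.
  have : e * 1 <= e * PhiN th (fun k => tcol (w k om)) N by rewrite ler_pM2l.
  lra.
have PA0 : fine (Pr A0) <= C * D.
  set K := (1 + sigma ^+ 2) / (1 - th).
  have K0 : 0 <= K by apply: divr_ge0; [rewrite addr_ge0 ?sqr_ge0|rewrite subr_ge0 ltW].
  (* With [lam = e^-1] a single limit removes both the slack and the tail. *)
  apply: (@le_add_eps _ _ _ (C + K)); first exact: addr_ge0.
  move=> e e0; have := step e e^-1 e0; rewrite invr_gt0 invrK => /(_ e0).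
  by rewrite -/K; lra.
have half (X Y : set T) : measurable X -> measurable Y -> X `<=` Y `|` A0 ->
    fine (Pr X) - fine (Pr Y) <= C * D.
  move=> mX mY XY; rewrite lerBlDl; apply: (@le_trans _ _ (fine (Pr Y) + fine (Pr A0))).
    rewrite -lee_fin EFinD -!finP//; apply: (@le_trans _ _ (Pr (Y `|` A0))).
      by rewrite le_measure ?inE//; exact: measurableU.
    exact: measureU2.
  by rewrite lerD2l.
rewrite /Gcdf -GE -GtE -/E -/Et ler_norml; apply/andP; split.
  rewrite lerNl opprB; apply: half => // om; rewrite /Et/= => Gtz.
  have [?|zG] := leP (G om) z; [by left|right].
  have le : Gt om <= G om by exact: le_trans (ltW zG).
  rewrite /A0/= (ger0_norm (_ : 0 <= G om - z)); last by lra.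
  by rewrite (ger0_norm (_ : 0 <= G om - Gt om)); lra.
apply: half => // om; rewrite /E/= => Gz.
have [?|zGt] := leP (Gt om) z; [by left|right].
have le : G om <= Gt om by exact: le_trans (ltW zGt).
rewrite /A0/= (ler0_norm (_ : G om - z <= 0)); last by lra.
by rewrite (ler0_norm (_ : G om - Gt om <= 0)); lra.
Unshelve. all: by end_near.
Qed.

Lemma posdef_closed_loop {R : realType} n p (Q : 'M[R]_n) (Rw : 'M[R]_p) (K : 'M[R]_(p, n)) :
  posdef Q -> posdef Rw ->
  (Q + K^T *m Rw *m K)^T = Q + K^T *m Rw *m K /\
  forall v, v != 0 -> 0 < bil v (Q + K^T *m Rw *m K) v.
Proof.
move=> [QT Q0] [RT R0]; split.
  by rewrite linearD/= QT !trmx_mul trmxK RT mulmxA.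
move=> v v0; rewrite bilDm; apply: ltr_wpDr; last exact: Q0.
rewrite /bil; have -> : v^T *m (K^T *m Rw *m K) *m v = (K *m v)^T *m Rw *m (K *m v).
  by rewrite trmx_mul !mulmxA.
have [->|Kv] := eqVneq (K *m v) 0; last exact: ltW (R0 _ Kv).
by rewrite mulmx0 mxE.
Qed.

Theorem theorem3 (R : realType) (n p : nat)
    (A : 'M[R]_n) (B : 'M[R]_(n, p)) (K : 'M[R]_(p, n))
    (Q : 'M[R]_n) (Rw : 'M[R]_p) (gamma : R) (x : 'cV[R]_n)
    (rhoK sigma M : R) :
  posdef Q -> posdef Rw -> 0 < gamma < 1 -> rhoK < 1 ->
  exists c1 c2 : R,
  forall (d : measure_display) (Omega : measurableType d)
         (Pr : probability Omega R) (w : nat -> Omega -> n.-tuple R),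
    (forall k, measurable_fun setT (w k)) ->
    mutually_independent Pr w ->
    identically_distributed Pr w ->
    (forall k, exists f, is_pdf Pr (w k) f /\ forall v, f v <= M) ->
    (forall k, (\int[Pr]_om (vnorm2 (tcol (w k om)) ^+ 2)%:E <= (sigma ^+ 2)%:E)%E) ->
  forall (DA : 'M[R]_n) (DB : 'M[R]_(n, p)) (P Pt : 'M[R]_n),
    let At := A + DA in
    let Bt := B + DB in
    let AK := A + B *m K in
    let AKt := At + Bt *m K in
    let DAK := AKt - AK in
    P - Q - K^T *m Rw *m K = gamma *: (AK^T *m P *m AK) ->
    Pt - Q - K^T *m Rw *m K = gamma *: (AKt^T *m Pt *m AKt) ->
    Num.max (specnorm AK) (specnorm AKt) = rhoK ->
    let H := kron (1%:M : 'M[R]_n) (1%:M : 'M[R]_n) - gamma *: kron AK^T AK^T in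
    let l := (specnorm (invmx H))^-1 in
    let eps := gamma * frobnorm AK * frobnorm DAK + gamma / 2 * frobnorm DAK ^+ 2 in
    l > 2 * eps ->
    forall z : R,
      `| Gcdf Pr gamma P AK w x z - Gcdf Pr gamma Pt AKt w x z |
        <= c1 * specnorm DAK + c2 * specnorm DAK ^+ 2.
Proof.
move=> Qpos Rpos g01 rho1; have /andP[g0 g1] := g01.
have g01' : 0 <= gamma < 1 by rewrite ltW.
case: n A B K Q x Qpos => [|n] A B K Q x Qpos.
  (* In dimension 0 all matrices agree, so both distribution functions coincide. *)
  exists 0, 0 => d Om Pr w _ _ _ _ _ DA DB P Pt At Bt AK AKt DAK _ _ _ H l eps _ z.
  by rewrite (flatmx0 P) (flatmx0 Pt) (flatmx0 AK) (flatmx0 AKt) subrr normr0 !mul0r addr0.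
pose AK := A + B *m K; pose Y := Q + K^T *m Rw *m K.
have [YT Y0] := posdef_closed_loop K Qpos Rpos.
rewrite -/Y in YT Y0.
have lyapE (X F : 'M[R]_n.+1) : X - Q - K^T *m Rw *m K = gamma *: (F^T *m X *m F) ->
    X = Y + gamma *: (F^T *m X *m F).
  by move=> <-; rewrite /Y -(addrA X) -opprD [RHS]addrC subrK.
(* The constants must be chosen before the noise and the perturbation, yet they depend on [P]. If
   one of these three facts fails, no instance satisfies the hypotheses and any constants do;
   otherwise [P] is available now. *)
have [[M0 AK1 [P PE]]|none] := pselect [/\ 0 <= M, specnorm AK <= 1 &
    exists P, P = Y + gamma *: (AK^T *m P *m AK)]; last first.
  exists 0, 0 => d Om Pr w _ _ _ pw _ DA DB P Pt At Bt AK' AKt DAK PE _ rhoE.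
  case: none; split.
  - have [f [[_ [f0 _]] fM]] := pw 0%N.
    exact: le_trans (f0 [tuple 0 | i < n.+1]) (fM _).
  - by apply: le_trans (ltW rho1); rewrite -rhoE le_max lexx.
  - by exists P; exact: lyapE.
have hA : mxbound 1 AK by apply: mxboundW AK1 (mxbound_specnorm _).
(* A fourth root of [gamma], obtained by two square roots, is small enough for the three copies of
   [th ^+ k] used in the cross terms. *)
pose th := Num.sqrt (Num.sqrt gamma).
have th0 : 0 < th by rewrite !sqrtr_gt0.
have thE : gamma = th ^+ 4.
  by rewrite (exprM th 2 2) !sqr_sqrtr ?sqrtr_ge0 ?(ltW g0).
have th1 : th < 1.
  rewrite ltNge; apply/negP => h; have : 1 <= th ^+ 4 by exact: exprn_ege1.
  by rewrite -thE leNgt g1.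
pose e : 'cV[R]_n.+1 := delta_mx ord0 0.
have e0 : e != 0.
  apply/eqP => /matrixP/(_ ord0 0); rewrite !mxE !eqxx => /eqP; by rewrite oner_eq0.
have [Pe PAe] := lyapunov_pair_det g01 hA YT Y0 PE e0.
have [C C0 hC] := GN_small_ball x g01 th0 th1 M0 Pe PAe sigma.
pose q := specnorm Y.
(* [k1] is the factor in [lyapunov_diff] and [k2] the one in [GN_diff_le]; multiplied by
   [specnorm DAK] they bound the truncated returns' difference in units of [PhiN]. *)
pose k1 := 2 * (q / (1 - gamma)) / (1 - gamma) + q / (1 - gamma).
pose k2 := vnorm2 x ^+ 2 + 2 * (1 - th)^-1 * vnorm2 x + 1 + 4 * (1 - th)^-1 ^+ 2.
have gq0 : 0 <= (1 - gamma)^-1 by rewrite invr_ge0 subr_ge0 ltW.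
have q0 : 0 <= q by exact: specnorm_ge0.
have k10 : 0 <= k1.
  by apply: addr_ge0; [do 2 (apply: mulr_ge0 => //)|]; apply: mulr_ge0.
have k20 : 0 <= k2.
  have u0 : 0 <= (1 - th)^-1 by rewrite invr_ge0 subr_ge0 ltW.
  apply: addr_ge0; last by apply: mulr_ge0 => //; exact: exprn_ge0.
  apply: addr_ge0 => //; apply: addr_ge0; first exact: sqr_ge0.
  by apply: mulr_ge0; [exact: mulr_ge0|exact: vnorm2_ge0].
exists (C * (k1 * k2)), 0 => d Om Pr w mw iw _ pw sw DA DB P' Pt At Bt AK' AKt DAK.
move=> PE' PtE rhoE H l eps _ z.
have hAt : mxbound 1 AKt.
  apply: mxboundW (mxbound_specnorm _).
  by apply: le_trans (ltW rho1); rewrite -rhoE le_max lexx orbT.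
(* The solution chosen in advance is the given one, by uniqueness. *)
have <- : P = P' := lyapunov_unique g01' hA PE (lyapE _ _ PE').
pose dl := specnorm DAK.
have dl0 : 0 <= dl by exact: specnorm_ge0.
have hd : mxbound dl (AK - AKt).
  by rewrite -opprB; apply: mxboundN; exact: mxbound_specnorm.
have hdiff := lyapunov_diff g01 dl0 q0 (mxbound_specnorm Y) hA hAt hd PE (lyapE _ _ PtE).
rewrite -/k1 in hdiff.
have hPA (X F : 'M[R]_n.+1) : mxbound 1 F ->
    forall k, mxbound (specnorm X * k.+1%:R) (X *m F ^+ k).
  move=> hF k; apply: (@mxboundW _ _ (specnorm X * 1)).
    by rewrite ler_wpM2l ?specnorm_ge0// ler1n.
  by apply: mxboundM; rewrite ?specnorm_ge0//; [exact: mxbound_specnorm|exact: mxboundX].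
rewrite mul0r addr0.
have -> : C * (k1 * k2) * specnorm DAK = C * (dl * k1 * k2) by rewrite -/dl; ring.
have dk0 : 0 <= dl * k1 by exact: mulr_ge0.
apply: (@cdf_diff_le R n.+1 d Om Pr w gamma th sigma C (dl * k1 * k2) (specnorm P)
  (specnorm Pt) P AK Pt AKt x z (2 * n + 5).*2) => //; rewrite ?specnorm_ge0//.
- exact: mulr_ge0.
- exact: hPA.
- exact: hPA.
- by move=> v N N0; exact: GN_diff_le.
- by move=> N t; exact: hC.
Qed.
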